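(* Let $K$ be a field with an automorphism $\lambda\mapsto\overline{\lambda}$ of order $2$, and let $h$ be a hyperbolic hermitian form (with respect to this automorphism) on a finite-dimensional vector space $V$ over $K$. Let $\dim V\ge 4$; if $|K|\le 9$, let $\dim V\ge 8$. Then $\mathrm{PSU}(V,K,h)$ has a conjugacy class with covering number $2$, i.e. there is a conjugacy class $C$ of $G=\mathrm{PSU}(V,K,h)$ such that $G=C^2=\{xy : x,y\in C\}$.
   Context: A hermitian form $h$ on $V$ is hyperbolic if $\dim V=2n$ is even and $h$ has, in a suitable basis, Gram matrix $\begin{pmatrix}0&\mathrm{I}_n\\ \mathrm{I}_n&0\end{pmatrix}$. $\mathrm{SU}(V,K,h)$ is the group of all $K$-linear isometries of $h$ with determinant $1$, and $\mathrm{PSU}(V,K,h)$ is its quotient by the subgroup of scalar transformations contained in it. *)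

(* Defs.v *)
From HB Require Import structures.
From mathcomp Require Import all_boot all_order all_algebra.
From mathcomp Require Import sesquilinear.
From mathcomp Require Import generic_quotient.
From mathcomp Require Import boolp classical_sets cardinality.

Set Implicit Arguments.
Unset Strict Implicit.
Unset Printing Implicit Defensive.

Import GRing.Theory passmx.

Local Open Scope group_scope.

Record normal_subgroup (G : groupType) := NormalSubgroup {
  nsub_pred :> {pred G};
  nsub_closed : group_closed nsub_pred;
  nsubJ : forall x y : G, x \in nsub_pred -> x ^ y \in nsub_pred
}.

Section QuotientGroup.
Variables (G : groupType) (N : normal_subgroup G).
Implicit Types x y z : G.

Let N1 : 1 \in N. Proof. by case: (nsub_closed N). Qed.

Let NF x y : x \in N -> y \in N -> x / y \in N.
Proof. by case: (nsub_closed N) => _; apply. Qed.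

Let NV x : x \in N -> x^-1 \in N.
Proof. by move=> Nx; rewrite -[x^-1]mul1g; apply: NF. Qed.

Let NM x y : x \in N -> y \in N -> x * y \in N.
Proof. by move=> Nx Ny; rewrite -[y]invgK; apply: NF => //; apply: NV. Qed.

Definition coset_rel x y : bool := x^-1 * y \in N.

Lemma coset_rel_refl : reflexive coset_rel.
Proof. by move=> x; rewrite /coset_rel mulVg. Qed.

Lemma coset_rel_sym : symmetric coset_rel.
Proof.
by move=> x y; apply/idP/idP => /NV; rewrite /coset_rel invgM invgK.
Qed.

Lemma coset_rel_trans : transitive coset_rel.
Proof.
move=> y x z /NM xNy /xNy; rewrite /coset_rel.
by rewrite mulgA -(mulgA x^-1) mulgV mulg1.
Qed.

Canonical coset_equiv :=
  EquivRel coset_rel coset_rel_refl coset_rel_sym coset_rel_trans.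

Definition quotg := {eq_quot coset_equiv}%qT.

HB.instance Definition _ := Choice.on quotg.
HB.instance Definition _ := EqQuotient.on quotg.

Local Open Scope quotient_scope.

Lemma quotg_eqP x y :
  reflect (\pi_quotg x = \pi_quotg y) (x^-1 * y \in N).
Proof. exact: (eqmodP coset_equiv). Qed.

Definition quotg_one : quotg := \pi_quotg 1.
Definition quotg_inv (a : quotg) : quotg := \pi_quotg (repr a)^-1.
Definition quotg_mul (a b : quotg) : quotg := \pi_quotg (repr a * repr b).

Lemma quotg_piM x y : quotg_mul (\pi_quotg x) (\pi y) = \pi_quotg (x * y).
Proof.
rewrite /quotg_mul; apply/quotg_eqP.
set x' := repr _; set y' := repr _.
have Nx : x'^-1 * x \in N by apply/quotg_eqP; rewrite reprK.
have Ny : y'^-1 * y \in N by apply/quotg_eqP; rewrite reprK.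
have -> : (x' * y')^-1 * (x * y) = (x'^-1 * x) ^ y' * (y'^-1 * y).
  by rewrite conjgE invgM !mulgA mulgK.
by apply: NM => //; apply: nsubJ.
Qed.

Lemma quotg_piV x : quotg_inv (\pi_quotg x) = \pi_quotg x^-1.
Proof.
rewrite /quotg_inv; apply/quotg_eqP; set x' := repr _.
have Nx : x'^-1 * x \in N by apply/quotg_eqP; rewrite reprK.
have -> : x'^-1^-1 * x^-1 = ((x'^-1 * x)^-1) ^ x'^-1.
  by rewrite conjgE invgM !invgK !mulgA mulgK.
by apply/nsubJ/NV.
Qed.

Lemma quotg_mulA : associative quotg_mul.
Proof.
elim/quotW=> x; elim/quotW=> y; elim/quotW=> z.
by rewrite (quotg_piM y z) (quotg_piM x y) (quotg_piM x) (quotg_piM _ z) mulgA.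
Qed.

Lemma quotg_mul1 : left_id quotg_one quotg_mul.
Proof. by elim/quotW=> x; rewrite (quotg_piM 1) mul1g. Qed.

Lemma quotg_mulr1 : right_id quotg_one quotg_mul.
Proof. by elim/quotW=> x; rewrite (quotg_piM x 1) mulg1. Qed.

Lemma quotg_mulV : left_inverse quotg_one quotg_inv quotg_mul.
Proof. by elim/quotW=> x; rewrite quotg_piV (quotg_piM _ x) mulVg. Qed.

Lemma quotg_mulrV : right_inverse quotg_one quotg_inv quotg_mul.
Proof. by elim/quotW=> x; rewrite quotg_piV (quotg_piM x) mulgV. Qed.

HB.instance Definition _ := isGroup.Build quotg
  quotg_mulA quotg_mul1 quotg_mulr1 quotg_mulV quotg_mulrV.

End QuotientGroup.

Section ConjugacyClass.
Local Open Scope classical_set_scope.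

Definition conj_class (G : groupType) (x : G) : set G :=
  [set x ^ g | g in [set: G]].

Definition is_conj_class (G : groupType) (C : set G) : Prop :=
  exists x : G, C = conj_class x.

Definition prodset (G : groupType) (A B : set G) : set G :=
  [set x * y | x in A & y in B].

End ConjugacyClass.

Local Close Scope group_scope.
Local Open Scope ring_scope.

Section LfunDet.
Variables (K : fieldType) (V : vectType K).
Implicit Types f g : 'End(V).

Definition lfun_det f : K := \det (mxof (vbasis {:V}) (vbasis {:V}) f).

Lemma lfun_detE (e : (\dim {:V}).-tuple V) f :
  basis_of {:V} e -> lfun_det f = \det (mxof e e f).
Proof.
move=> eb; have vb := vbasisP {:V}; set b := vbasis _ in vb.
have beK : mxof b e \1 *m mxof e b \1 = 1%:M.
  by rewrite -mxof_comp // comp_lfun1l mxof1 // (basis_free vb).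
have fE : mxof b b f = mxof b e \1 *m (mxof e e f *m mxof e b \1).
  by rewrite -!mxof_comp // comp_lfun1l comp_lfun1r.
by rewrite /lfun_det -/b fE !det_mulmx mulrCA -det_mulmx beK det1 mulr1.
Qed.

Lemma lfun_det1 : lfun_det \1%VF = 1.
Proof. by rewrite /lfun_det mxof1 ?det1 // (basis_free (vbasisP _)). Qed.

Lemma lfun_detM f g : lfun_det (f \o g)%VF = lfun_det f * lfun_det g.
Proof.
by rewrite /lfun_det (mxof_comp _ _ (vbasisP _)) det_mulmx mulrC.
Qed.

Lemma lfun_det_ker f : lfun_det f != 0 -> lker f == 0%VS.
Proof.
move=> df; have vb := vbasisP {:V}.
apply/lker0P => u v fuv; apply: (can_inj (rVofK vb)).
have Mu : mxof (vbasis {:V}) (vbasis {:V}) f \in unitmx by rewrite unitmxE unitfE.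
apply: (can_inj (mulmxK Mu)).
by rewrite -!(rVof_app _ vb) fuv.
Qed.

End LfunDet.

Section SpecialUnitary.
Variables (K : fieldType) (V : vectType K) (theta : {rmorphism K -> K}).
Variable h : {hermitian_sym V for theta}.
Implicit Types f g : 'End(V).

Definition hyperbolic_form : Prop :=
  exists (n : nat) (e : (n + n).-tuple V),
    basis_of {:V} e /\
    \matrix_(i, j) h (tnth e i) (tnth e j) = block_mx 0 1%:M 1%:M 0.

Definition SU_pred : {pred 'End(V)} :=
  fun f => `[< isometry h h f /\ lfun_det f = 1 >].

Definition SU := {f : 'End(V) | f \in SU_pred}.

HB.instance Definition _ := SubType.on SU.
HB.instance Definition _ := Choice.on SU.

Lemma SU_predP f :
  reflect (isometry h h f /\ lfun_det f = 1) (f \in SU_pred).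
Proof. exact: asboolP. Qed.

Lemma SU_lker f : f \in SU_pred -> lker f == 0%VS.
Proof.
by case/SU_predP=> _ df; apply: lfun_det_ker; rewrite df oner_eq0.
Qed.

Fact SU_one_subproof : \1%VF \in SU_pred.
Proof. by apply/SU_predP; split; [move=> u v; rewrite !lfunE | exact: lfun_det1]. Qed.

Fact SU_mul_subproof f g :
  f \in SU_pred -> g \in SU_pred -> (f \o g)%VF \in SU_pred.
Proof.
move=> /SU_predP[hf df] /SU_predP[hg dg]; apply/SU_predP; split.
  by move=> u v; rewrite !comp_lfunE hf hg.
by rewrite lfun_detM df dg mulr1.
Qed.

Fact SU_inv_subproof f : f \in SU_pred -> (f^-1)%VF \in SU_pred.
Proof.
move=> Sf; have fK := SU_lker Sf; have /SU_predP[hf df] := Sf.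
apply/SU_predP; split; first by move=> u v; rewrite -hf !lker0_lfunVK.
have := congr1 (@lfun_det K V) (lker0_compfV fK).
by rewrite lfun_detM df mul1r lfun_det1.
Qed.

Definition SU_one : SU := Sub \1%VF SU_one_subproof.
Definition SU_mul (x y : SU) : SU :=
  Sub (val x \o val y)%VF (SU_mul_subproof (valP x) (valP y)).
Definition SU_inv (x : SU) : SU := Sub (val x)^-1%VF (SU_inv_subproof (valP x)).

Lemma SU_mulA : associative SU_mul.
Proof. by move=> x y z; apply/val_inj; rewrite /= comp_lfunA. Qed.

Lemma SU_mul1 : left_id SU_one SU_mul.
Proof. by move=> x; apply/val_inj; rewrite /= comp_lfun1l. Qed.

Lemma SU_mulr1 : right_id SU_one SU_mul.
Proof. by move=> x; apply/val_inj; rewrite /= comp_lfun1r. Qed.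

Lemma SU_mulV : left_inverse SU_one SU_inv SU_mul.
Proof.
by move=> x; apply/val_inj; rewrite /= lker0_compVf ?(SU_lker (valP x)).
Qed.

Lemma SU_mulrV : right_inverse SU_one SU_inv SU_mul.
Proof.
by move=> x; apply/val_inj; rewrite /= lker0_compfV ?(SU_lker (valP x)).
Qed.

HB.instance Definition _ := isGroup.Build SU
  SU_mulA SU_mul1 SU_mulr1 SU_mulV SU_mulrV.

Lemma val_SU1 : val (1%g : SU) = \1%VF. Proof. by []. Qed.
Lemma val_SUM (x y : SU) : val (x * y)%g = (val x \o val y)%VF.
Proof. by []. Qed.
Lemma val_SUV (x : SU) : val (x^-1)%g = ((val x)^-1)%VF. Proof. by []. Qed.

Definition SU_scalar : {pred SU} :=
  fun x => `[< exists c : K, val x = c *: \1%VF >].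

Lemma SU_scalarP (x : SU) :
  reflect (exists c : K, val x = c *: \1%VF) (x \in SU_scalar).
Proof. exact: asboolP. Qed.

Fact SU_scalarJ (x y : SU) : x \in SU_scalar -> (x ^ y)%g \in SU_scalar.
Proof.
move=> /SU_scalarP[c xc]; apply/SU_scalarP; exists c.
rewrite conjgE !val_SUM val_SUV xc -comp_lfunZl comp_lfun1l -comp_lfunZr.
by rewrite lker0_compVf ?(SU_lker (valP y)).
Qed.

Fact SU_scalar_closed : group_closed SU_scalar.
Proof.
split=> [|x y /SU_scalarP[c xc] /SU_scalarP[d yd]]; apply/SU_scalarP.
  by exists 1; rewrite scale1r.
have dyV : d *: (val y)^-1%VF = \1%VF.
  rewrite -(lker0_compfV (SU_lker (valP y))) [X in (X \o _)%VF]yd.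
  by rewrite -comp_lfunZl comp_lfun1l.
have xyE : val (x / y)%g = c *: (val y)^-1%VF.
  by rewrite val_SUM val_SUV xc -comp_lfunZl comp_lfun1l.
have [d0|d0] := eqVneq d 0.
  exists c; rewrite xyE -[in LHS](comp_lfun1l (val y)^-1%VF) -dyV d0.
  by rewrite !scale0r comp_lfun0l.
by exists (c * d^-1); rewrite xyE -dyV scalerA -mulrA mulVf // mulr1.
Qed.

Definition SU_scalars : normal_subgroup SU :=
  NormalSubgroup SU_scalar_closed SU_scalarJ.

Definition PSU := quotg SU_scalars.

HB.instance Definition _ := Group.on PSU.

End SpecialUnitary.

(* Main.v *)
Require Import Defs.
From mathcomp Require Import all_boot all_order all_algebra.
From mathcomp Require Import sesquilinear boolp classical_sets cardinality.
From mathcomp Require Import zify ring.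

(** In a hyperbolic basis the group consists of the matrices [g] whose adjoint
    (conjugate transpose) satisfies [g J (adj g) = J], with [J = [[0, 1], [1, 0]]].
    Let [A'] be the inverse of [adj A] and [t = diag(A, A')], where [A] is the
    companion matrix of a polynomial over the fixed field, chosen so that [A] and
    [A'] have no common eigenvalue.  If the upper left block [P] of some conjugate
    of [g] is a product [X Y] of two matrices similar to [A], then the
    factorization [g = L diag(P, P') U], with [L] lower and [U] upper unipotent,
    writes [g] as the product of [L diag(X, X')] and [diag(Y, Y') U]; both are
    conjugate to [t] because the relevant Sylvester equations are solvable.  Such a
    factorization [P = X Y] exists when [det P = (det A)^2] and either [P] has all
    its eigenvalues in the field, one of them simple, or [P] is a scalar plus a
    nilpotent matrix of rank one.  Every nonscalar [g] has a conjugate with such a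
    block, which is built by splitting off blocks of size 1 and 2 along isotropic
    vectors.  For scalar [g] one uses that [t] is conjugate to its inverse.
    Conjugating matrices are corrected to determinant 1 inside the centralizer of
    [t], by Hilbert 90. *)

Set Implicit Arguments.
Unset Strict Implicit.
Unset Printing Implicit Defensive.

Import GRing.Theory passmx.

Local Open Scope ring_scope.

(** * Similar matrices *)

Section Similarity.
Variable K : fieldType.

(** The block [P] depends on the choice of a pair of complementary Lagrangians, and this freedom is
    what is exploited. If [P] is invertible, then [\det g = \det P / theta (\det P)], so
    [\det g = 1] puts [\det P] into the fixed field, where [(\det A)^2] lies as well. A block of
    size 1 contributes an eigenvalue on a single line over the fixed field. Blocks of size 2 are
    used because the determinant of their contribution can be scaled by any nonzero element of the
    fixed field while some choice of eigenvalues remains. The simple eigenvalue matters because the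
    factorization [X Y] leaves one row of the product uncontrolled; this row is removed by
    conjugation when the corner entry is no eigenvalue of the rest. The condition on [A] and [A']
    means that no two eigenvalues of [A], equal or not, have product 1. *)

Definition similar n (A B : 'M[K]_n) : Prop :=
  exists2 S, S \in unitmx & S *m A = B *m S.

Lemma similar_refl n (A : 'M[K]_n) : similar A A.
Proof. by exists 1%:M; rewrite ?unitmx1 ?mul1mx ?mulmx1. Qed.

Lemma similar_sym n (A B : 'M[K]_n) : similar A B -> similar B A.
Proof.
case=> S Su SA; exists (invmx S); rewrite ?unitmx_inv //.
by rewrite -[B](mulmxK Su) -SA -!mulmxA mulKmx.
Qed.

Lemma similar_trans n (B A C : 'M[K]_n) :
  similar A B -> similar B C -> similar A C.
Proof.
case=> S Su SA [T Tu TB]; exists (T *m S); first by rewrite unitmx_mul Tu.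
by rewrite -mulmxA SA mulmxA TB mulmxA.
Qed.

Lemma similar_conj n (A S : 'M[K]_n) : S \in unitmx ->
  similar A (S *m A *m invmx S).
Proof. by move=> Su; exists S => //; rewrite mulmxKV. Qed.

Lemma similarE n (A B : 'M[K]_n) : similar A B ->
  exists2 S, S \in unitmx & A = invmx S *m B *m S.
Proof. by case=> S Su SA; exists S => //; rewrite -mulmxA -SA mulKmx. Qed.

Lemma similar_det n (A B : 'M[K]_n) : similar A B -> \det A = \det B.
Proof.
case/similarE=> S Su ->; rewrite !det_mulmx det_inv mulrC mulrA divff ?mul1r //.
by rewrite -unitfE -unitmxE.
Qed.

Lemma similar_char_poly n (A B : 'M[K]_n) :
  similar A B -> char_poly A = char_poly B.
Proof.
case=> S Su SA; rewrite /char_poly /char_poly_mx.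
have polyM (M N : 'M[K]_n) :
    map_mx polyC (M *m N) = map_mx polyC M *m map_mx polyC N.
  exact: map_mxM.
have: map_mx polyC S *m ('X%:M - map_mx polyC A)
      = ('X%:M - map_mx polyC B) *m map_mx polyC S.
  by rewrite mulmxBr mulmxBl -!polyM SA scalar_mxC.
move/(congr1 determinant); rewrite !det_mulmx mulrC; apply/mulIf.
by rewrite det_map_mx polyC_eq0 -unitfE -unitmxE.
Qed.

Lemma similar_block_diag m n (A A' : 'M[K]_m) (B B' : 'M[K]_n) :
  similar A A' -> similar B B' ->
  similar (block_mx A 0 0 B) (block_mx A' 0 0 B').
Proof.
case=> S Su SA [T Tu TB]; exists (block_mx S 0 0 T).
  by rewrite unitmxE det_ublock unitrM -!unitmxE Su.
by rewrite !mulmx_block !(mul0mx, mulmx0, addr0, add0r) SA TB.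
Qed.

Lemma unitmx_row0 n (v : 'rV[K]_n.+1) : v != 0 ->
  exists2 S, S \in unitmx & delta_mx 0 0 *m S = v.
Proof.
move=> v0; have vr : \rank v = 1%N by rewrite rank_rV v0.
have := mulmx_ebase v; rewrite vr [col_ebase v]mx11_scalar.
set c := col_ebase v 0 0 => vE; exists (c *: row_ebase v).
  rewrite unitmxZ ?row_ebase_unit // unitfE; apply: contra v0 => /eqP c0.
  by rewrite -vE c0 mul_scalar_mx scale0r mul0mx.
rewrite -[RHS]vE -scalemxAr mul_scalar_mx -scalemxAl; congr (_ *: (_ *m _)).
by apply/rowP => j; rewrite !mxE eqxx /= -val_eqE /= eq_sym; case: (val j).
Qed.

Lemma unitmx_col0 n (u : 'cV[K]_n.+1) : u != 0 ->
  exists2 S, S \in unitmx & S *m u = delta_mx 0 0.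
Proof.
move=> u0; have /unitmx_row0[S Su Se] : u^T != 0.
  by apply: contra u0 => /eqP/(congr1 trmx); rewrite trmxK trmx0 => ->.
exists (invmx S)^T; first by rewrite unitmx_tr unitmx_inv.
by apply: trmx_inj; rewrite trmx_mul trmxK -Se mulmxK // trmx_delta.
Qed.

Lemma unitmx_row_row n (v w : 'rV[K]_n) : v != 0 -> w != 0 ->
  exists2 S, S \in unitmx & v *m S = w.
Proof.
case: n v w => [v|n v w v0 w0]; first by rewrite thinmx0 eqxx.
have [S Su Sv] := unitmx_row0 v0; have [T Tu Tw] := unitmx_row0 w0.
exists (invmx S *m T); first by rewrite unitmx_mul unitmx_inv Su.
by rewrite -Sv mulmxA mulmxK.
Qed.

(** Conjugation by a unipotent matrix with corner row [y] changes [r] by [y T - c y], which can be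
    made to cancel [r] because [c] is no eigenvalue of [T]. *)
Lemma similar_ublock n (c : K) (r : 'rV_n) (T : 'M_n) :
  T - c%:M \in unitmx ->
  similar (block_mx c%:M r 0 T) (block_mx (c%:M : 'M_1) 0 0 T).
Proof.
move=> Tc; pose y := - r *m invmx (T - c%:M).
have yE : y *m T - y *m c%:M = - r by rewrite -mulmxBr mulmxKV.
exists (block_mx 1%:M y 0 1%:M); first by rewrite unitmxE det_ublock !det1 mulr1 unitr1.
rewrite !mulmx_block !(mul0mx, mulmx0, addr0, add0r, mul1mx, mulmx1).
congr (block_mx _ _ _ _); rewrite mul_scalar_mx -mul_mx_scalar.
by rewrite -[y *m T](subrK (y *m c%:M)) yE addrA subrr add0r.
Qed.

Lemma similar_lblock n (c : K) (v : 'cV_n) (T : 'M_n) :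
  T - c%:M \in unitmx ->
  similar (block_mx c%:M 0 v T) (block_mx (c%:M : 'M_1) 0 0 T).
Proof.
move=> Tc; pose y := invmx (T - c%:M) *m v.
have yE : T *m y - c%:M *m y = v by rewrite -mulmxBl mulKVmx.
exists (block_mx 1%:M 0 y 1%:M); first by rewrite unitmxE det_lblock !det1 mulr1 unitr1.
rewrite !mulmx_block !(mul0mx, mulmx0, addr0, add0r, mul1mx, mulmx1).
congr (block_mx _ _ _ _); rewrite mul_mx_scalar -mul_scalar_mx.
by rewrite -[v in LHS]yE addrC subrK.
Qed.

Lemma char_poly_lblock m n (A : 'M[K]_m) C (B : 'M_n) :
  char_poly (block_mx A 0 C B) = char_poly A * char_poly B.
Proof.
rewrite /char_poly /char_poly_mx map_block_mx map_mx0 scalar_mx_block.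
by rewrite opp_block_mx add_block_mx subr0 det_lblock.
Qed.

Lemma char_poly1 (c : K) : char_poly (c%:M : 'M_1) = 'X - c%:P.
Proof. by rewrite /char_poly det_mx11 !mxE eqxx. Qed.

(** A row eigenvector becomes the first basis vector; matrices act on rows, hence the zero block to
    the right of [c]. *)
Lemma eigenrow n (A : 'M[K]_n.+1) c : root (char_poly A) c ->
  exists v T, @similar (1 + n) A (block_mx c%:M 0 v T).
Proof.
rewrite -eigenvalue_root_char => /eigenvalueP[v vA v0].
have [S Su Sv] := unitmx_row0 v0.
have [B AB BE] : exists2 B : 'M_(1 + n),
    @similar (1 + n) A B & delta_mx 0 0 *m B = c *: delta_mx 0 0 :> 'rV_(1 + n).
  exists (S *m A *m invmx S); first exact: similar_conj.
  by rewrite 2!mulmxA Sv vA -scalemxAl -[in v *m _]Sv mulmxK.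
exists (dlsubmx B), (drsubmx B).
have -> : block_mx c%:M 0 (dlsubmx B) (drsubmx B) = B.
  rewrite -[RHS]submxK; congr (block_mx _ _ _ _); apply/matrixP => i j.
    have /rowP/(_ (lshift n j)) := BE; rewrite -rowE [LHS]mxE !ord1 !mxE -!val_eqE /=.
    by rewrite mulr1 => <-; congr (B _ _); apply: val_inj.
  have /rowP/(_ (rshift 1 j)) := BE; rewrite -rowE [LHS]mxE !ord1 !mxE -!val_eqE /=.
  by rewrite mulr0 => <-; congr (B _ _); apply: val_inj.
exact: AB.
Qed.

Lemma similar_trig n (A : 'M[K]_n) (s : seq K) :
  char_poly A = \prod_(a <- s) ('X - a%:P) ->
  exists2 T, similar A T & is_trig_mx T.
Proof.
elim: n A s => [|n IHn] A s As.
  by exists A; [exact: similar_refl | apply/is_trig_mxP => -[]].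
case: s As => [|c s] As.
  have := size_char_poly A; rewrite As big_nil size_poly1 => -[]/eqP.
  by [].
have /eigenrow[v [T AT]] : root (char_poly A) c.
  by rewrite As big_cons rootM root_XsubC eqxx.
have cT : char_poly T = \prod_(a <- s) ('X - a%:P).
  have := similar_char_poly AT; rewrite [LHS]As char_poly_lblock char_poly1 big_cons.
  by move/mulfI=> -> //; rewrite polyXsubC_eq0.
have [T' [S Su ST] tT'] := IHn _ _ cT.
exists (block_mx (c%:M : 'M_1) 0 (S *m v) T' : 'M_(1 + n)).
  apply: similar_trans AT _; exists (block_mx 1%:M 0 0 S).
    by rewrite unitmxE det_ublock det1 mul1r -unitmxE.
  by rewrite !mulmx_block !(mul0mx, mulmx0, addr0, add0r, mul1mx, mulmx1) ST.
have := @is_trig_block_mx K 1 n 1 n c%:M 0 (S *m v) T' erefl.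
by rewrite eqxx tT' mx11_is_trig => ->.
Qed.

End Similarity.

(** * Companion matrices and products of two similar matrices *)

Section Companion.
Variables (K : fieldType) (n : nat).
Implicit Types (r w : 'rV[K]_n.+1) (M A P : 'M[K]_n.+1).

(** The last row is the parameter because it enters affinely: adding [d] to it adds a matrix of rank
    at most one. *)
Definition comp_mx r : 'M[K]_n.+1 :=
  \matrix_(i, j) if i == n :> nat then r 0 j else (i.+1 == j)%:R.

Lemma char_poly_comp_mx r : char_poly (comp_mx r) = 'X^(n.+1) - rVpoly r.
Proof.
set p := RHS; have sr : (size (rVpoly r) <= n.+1)%N by exact: size_poly.
have sp : size p = n.+2.
  by rewrite size_polyDl size_polyXn // size_polyN ltnS.
have pmon : p \is monic.
  rewrite monicE lead_coefDl ?lead_coefXn // size_polyXn size_polyN ltnS //.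
have pE (j : 'I_n.+1) : p`_j = - r 0 j.
  by rewrite coefB coefXn ltn_eqF // sub0r coef_rVpoly_ord.
(* The size of [companionmx p] is read off from [size p] and equals [n.+1] only up to a proof, hence
   the variable [m]. *)
have H m (Hm : m = n.+1) : char_poly (\matrix_(i < m, j < m)
    if (i == m.-1 :> nat) then - p`_j else (i.+1 == j :> nat)%:R)
    = char_poly (comp_mx r).
  subst m; congr char_poly; apply/matrixP => i j; rewrite !mxE pE opprK //.
by rewrite -[RHS]companionmxK // /companionmx (H _ (congr1 predn sp)).
Qed.

Lemma comp_mx_inj r w : char_poly (comp_mx r) = char_poly (comp_mx w) -> r = w.
Proof.
rewrite !char_poly_comp_mx => /addrI/oppr_inj/(congr1 (@poly_rV K n.+1)).
by rewrite !rVpolyK.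
Qed.

Lemma row_comp_mx r (i : 'I_n.+1) (lt_in : (i.+1 < n.+1)%N) :
  row i (comp_mx r) = delta_mx 0 (Ordinal lt_in).
Proof.
apply/rowP => j; rewrite !mxE -!val_eqE /= ltn_eqF 1?eq_sym //.
Qed.

Lemma row_last_comp_mx r : row ord_max (comp_mx r) = r.
Proof. by apply/rowP => j; rewrite !mxE eqxx. Qed.

Lemma comp_mxE r d : comp_mx (r + d) = comp_mx r + delta_mx ord_max 0 *m d.
Proof.
apply/row_matrixP => i; rewrite raddfD /= row_mul.
have [->|i_neq] := eqVneq i ord_max.
  rewrite !row_last_comp_mx rowE mul_delta_mx -rowE.
    by apply/rowP => j; rewrite !mxE.
have lt_in : (i.+1 < n.+1)%N by rewrite ltn_neqAle ltn_ord andbT eqSS.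
rewrite !row_comp_mx rowE mul_delta_mx_0 ?mul0mx ?addr0 //.
Qed.

Lemma mul_comp_mx S r (M : 'M[K]_n.+1) :
    (forall (i : 'I_n.+1) (lt_in : (i.+1 < n.+1)%N),
       row i S *m M = row (Ordinal lt_in) S) ->
    row ord_max S *m M = r *m S ->
  S *m M = comp_mx r *m S.
Proof.
move=> SM SMn; apply/row_matrixP => i; rewrite !row_mul.
have [->|i_neq] := eqVneq i ord_max; first by rewrite row_last_comp_mx.
have lt_in : (i.+1 < n.+1)%N by rewrite ltn_neqAle ltn_ord andbT eqSS.
by rewrite (SM i lt_in) row_comp_mx -rowE.
Qed.

Lemma similar_comp_mx S M : S \in unitmx ->
    (forall (i : 'I_n.+1) (lt_in : (i.+1 < n.+1)%N),
       row i S *m M = row (Ordinal lt_in) S) ->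
  exists r, similar M (comp_mx r).
Proof.
move=> Su SM; exists (row ord_max S *m M *m invmx S), S => //.
by apply: mul_comp_mx => //; rewrite mulmxKV.
Qed.

(** Unreduced lower Hessenberg matrices: the rows [e_0 M^k] form a triangular matrix with nonzero
    diagonal, so [e_0] is a cyclic vector and [M] is similar to a companion matrix. *)
Definition hessenberg M : Prop :=
  (forall i j : 'I_n.+1, (i.+1 < j)%N -> M i j = 0) /\
  (forall i j : 'I_n.+1, i.+1 = j -> M i j != 0).

Section Hessenberg.
Variable M : 'M[K]_n.+1.
Hypothesis hM : hessenberg M.

Let S := \matrix_(k < n.+1) (delta_mx 0 0 *m M ^+ k : 'rV_n.+1).

Let v_trig k (j : 'I_n.+1) : (k < j)%N -> (delta_mx 0 0 *m M ^+ k : 'rV_n.+1) 0 j = 0 :> K.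
Proof.
elim: k j => [|k IHk] j ltkj.
  by rewrite expr0 mulmx1 mxE eqxx -val_eqE /= gtn_eqF.
rewrite exprSr -mulmxE mulmxA mxE big1 // => i _.
have [ltki|leik] := ltnP k i; first by rewrite IHk ?mul0r.
by rewrite (proj1 hM) ?mulr0 // (leq_ltn_trans _ ltkj).
Qed.

Let v_diag (k : 'I_n.+1) : (delta_mx 0 0 *m M ^+ k : 'rV_n.+1) 0 k != 0 :> K.
Proof.
case: k => k; elim: k => [|k IHk] lt_kn /=.
  by rewrite expr0 mulmx1 mxE eqxx -val_eqE /= oner_eq0.
have lt_kn' : (k < n.+1)%N by exact: ltnW.
rewrite exprSr -mulmxE mulmxA mxE (bigD1 (Ordinal lt_kn')) //= big1 ?addr0.
  by rewrite mulf_neq0 ?IHk // (proj2 hM).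
move=> i; rewrite -val_eqE /= => ik.
have [ltki|leik] := ltnP k i; first by rewrite v_trig ?mul0r.
by rewrite (proj1 hM) ?mulr0 //= ltnS ltn_neqAle ik.
Qed.

Let S_trig : is_trig_mx S.
Proof. by apply/is_trig_mxP => i j ltij; rewrite mxE v_trig. Qed.

Let S_unit : S \in unitmx.
Proof.
rewrite unitmxE det_trig // unitfE; apply/prodf_neq0 => i _.
by rewrite mxE v_diag.
Qed.

Let S_row (i : 'I_n.+1) (lt_in : (i.+1 < n.+1)%N) :
  row i S *m M = row (Ordinal lt_in) S.
Proof. by rewrite !rowK -mulmxA mulmxE -exprSr. Qed.

Lemma hessenberg_similar : exists r, similar M (comp_mx r).
Proof. exact: similar_comp_mx S_unit S_row. Qed.

(** Pole placement with the last row as the only free parameter. The Krylov matrix [S] is lower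
    triangular, so its last column is a multiple of the last basis vector: a change in the last row
    of [M] leaves the Krylov rows intact and alters only the last row of the companion form, at
    will. *)
Lemma hessenberg_place r :
  exists d : 'rV_n.+1, similar (M + delta_mx ord_max 0 *m d) (comp_mx r).
Proof.
pose k := S ord_max ord_max.
have k0 : k != 0 by rewrite /k mxE v_diag.
have Se : S *m delta_mx ord_max 0 = k *: delta_mx ord_max 0 :> 'cV_n.+1.
  apply/matrixP => i j; rewrite -colE [LHS]mxE [RHS]mxE [delta_mx _ _ _ _]mxE (ord1 j) eqxx andbT.
  have [->|i_neq] := eqVneq i ord_max; first by rewrite mulr1.
  rewrite mulr0 (is_trig_mxP S_trig) // ltn_neqAle -[(i <= _)%N]ltnS ltn_ord andbT.
  exact: i_neq.
exists (k^-1 *: (r *m S - row ord_max S *m M)), S => //.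
have rowd (i : 'I_n.+1) d : row i (S *m (delta_mx ord_max 0 *m d))
    = (k * (i == ord_max)%:R) *: d :> 'rV[K]_n.+1.
  rewrite mulmxA Se row_mul; apply/rowP => j; rewrite !mxE big_ord1 !mxE eqxx.
  by rewrite andbT.
apply: mul_comp_mx => [i lt_in|]; rewrite mulmxDr.
  have := rowd i (k^-1 *: (r *m S - row ord_max S *m M)).
  rewrite row_mul => ->; rewrite -val_eqE /= ltn_eqF // mulr0 scale0r addr0.
  exact: S_row.
have := rowd ord_max (k^-1 *: (r *m S - row ord_max S *m M)).
by rewrite row_mul => ->; rewrite eqxx mulr1 scalerA divff // scale1r addrC subrK.
Qed.

End Hessenberg.

Lemma hessenberg_char_poly M N : hessenberg M -> hessenberg N ->
  char_poly M = char_poly N -> similar M N.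
Proof.
move=> /hessenberg_similar[r Mr] /hessenberg_similar[w Nw] MN.
apply: (similar_trans Mr); apply/similar_sym.
rewrite (@comp_mx_inj r w) //.
by rewrite -(similar_char_poly Mr) MN (similar_char_poly Nw).
Qed.

Lemma hessenberg_comp_mx r : hessenberg (comp_mx r).
Proof.
split=> i j ij; rewrite mxE.
  by rewrite (ltn_eqF ij) ltn_eqF // -ltnS (ltn_trans ij).
by rewrite ij eqxx ltn_eqF ?oner_eq0 // -ltnS ij ltn_ord.
Qed.

(** Reversing the basis makes the transpose Hessenberg again, and Hessenberg matrices are classified
    by their characteristic polynomials. *)
Lemma comp_mx_similar_tr r : similar (comp_mx r) (comp_mx r)^T.
Proof.
set A := comp_mx r; pose R : 'M[K]_n.+1 := \matrix_(i, j) (j == rev_ord i)%:R.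
have RE m (B : 'M_(n.+1, m)) i j : (R *m B) i j = B (rev_ord i) j.
  rewrite mxE (bigD1 (rev_ord i)) //= mxE eqxx mul1r big1 ?addr0 // => k ki.
  by rewrite mxE (negPf ki) mul0r.
have RR : R *m R = 1%:M.
  by apply/matrixP => i j; rewrite RE !mxE rev_ordK eq_sym.
have Ru : R \in unitmx by case/mulmx1_unit: RR.
have ER m (B : 'M_(m, n.+1)) i j : (B *m R) i j = B i (rev_ord j).
  rewrite mxE (bigD1 (rev_ord j)) //= mxE rev_ordK eqxx mulr1 big1 ?addr0 //.
  by move=> k kj; rewrite mxE -(inj_eq rev_ord_inj) rev_ordK eq_sym (negPf kj) mulr0.
pose B := R *m A^T *m R.
have BE i j : B i j = A (rev_ord j) (rev_ord i).
  by rewrite ER RE mxE.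
have AB : similar B A^T.
  exists R => //; by rewrite /B !mulmxA RR mul1mx.
apply: (similar_trans _ AB); apply: hessenberg_char_poly.
- exact: hessenberg_comp_mx.
- split=> i j ij; rewrite BE !mxE /=; have := ltn_ord i; have := ltn_ord j => ltj lti.
    have -> : (n.+1 - j.+1 == n)%N = false by lia.
    by have -> : ((n.+1 - j.+1).+1 == n.+1 - i.+1)%N = false by lia.
  have -> : (n.+1 - j.+1 == n)%N = false by lia.
  have -> : ((n.+1 - j.+1).+1 == n.+1 - i.+1)%N.
    by lia.
  exact: oner_neq0.
rewrite (similar_char_poly AB) /char_poly -[in LHS]det_tr; congr (\det _).
by apply/matrixP => i j; rewrite !mxE eq_sym.
Qed.

(** The inverse shifts the basis vectors backwards, so it is a companion matrix for the reversed
    basis. This allows [X^-1] to be taken as a companion matrix in the factorization. *)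
Lemma comp_mx_inv r : comp_mx r \in unitmx ->
  exists q, similar (invmx (comp_mx r)) (comp_mx q).
Proof.
set A := comp_mx r => Au.
pose R : 'M[K]_n.+1 := \matrix_i delta_mx 0 (rev_ord i).
have RR : R *m R = 1%:M.
  apply/row_matrixP => i; rewrite row_mul !rowK -rowE rowK rev_ordK.
  by rewrite row1.
apply: (@similar_comp_mx R); first by case/mulmx1_unit: RR.
move=> i lt_in; rewrite !rowK.
apply: (can_inj (mulmxK Au)); rewrite mulmxKV // -rowE.
have lt_rn : ((rev_ord (Ordinal lt_in)).+1 < n.+1)%N by have := ltn_ord i; rewrite /=; lia.
rewrite (row_comp_mx r lt_rn); congr (delta_mx _ _); apply: val_inj => /=; have := ltn_ord i; lia.
Qed.

End Companion.

Section Products.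
Variables (K : fieldType) (n : nat) (a : 'rV[K]_n.+1).
Let A := comp_mx a.
Hypothesis Au : A \in unitmx.

Lemma block_mx_row_id (Z : 'M[K]_(1 + n)) :
    (forall i : 'I_(1 + n), (0 < i)%N -> row i Z = delta_mx 0 i) ->
  exists (c : K) (v : 'rV_n), Z = block_mx (c%:M : 'M_1) v 0 1%:M.
Proof.
move=> Zrow; exists (ulsubmx Z 0 0), (ursubmx Z); rewrite -[LHS]submxK; congr (block_mx _ _ _ _).
- exact: mx11_scalar.
- apply/matrixP => i j; have /rowP/(_ (lshift n j)) := Zrow (rshift 1 i) isT.
  by rewrite !mxE -!val_eqE /= ord1 => ->.
apply/matrixP => i j; have /rowP/(_ (rshift 1 j)) := Zrow (rshift 1 i) isT.
by rewrite !mxE /= => ->; rewrite -!val_eqE /= eqn_add2l eq_sym.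
Qed.

(* The rows 1, ..., n of [X^-1 * Y] are prescribed, while the last rows of
   [X^-1] and [Y] are free: they are used to adjust the two characteristic
   polynomials. *)
Lemma comp_mx_mul_block (T : 'M_n) (c : K) :
    is_trig_mx T -> T \in unitmx -> c * \det T = \det A ^+ 2 ->
  exists X Y (v : 'rV_n),
    [/\ similar X A, similar Y A & X *m Y = block_mx (c%:M : 'M_1) v 0 T].
Proof.
move=> Ttrig Tu cT; have [q AVq] := comp_mx_inv Au.
set N := comp_mx q in AVq.
have Nu : N \in unitmx.
  by rewrite unitmxE -(similar_det AVq) det_inv unitrV -unitmxE.
pose D : 'M[K]_n.+1 := block_mx (1%:M : 'M_1) 0 0 T.
have Dtrig : is_trig_mx D.
  have := @is_trig_block_mx K 1 n 1 n 1%:M 0 0 T erefl.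
  by rewrite eqxx Ttrig mx11_is_trig => ->.
have dD : \det D = \det T.
  by have := @det_ublock K 1 n 1%:M 0 T; rewrite det1 mul1r => <-.
have Du : D \in unitmx by rewrite unitmxE dD -unitmxE.
have Ddiag i : D i i != 0.
  move: Du; rewrite unitmxE det_trig // unitfE => /prodf_neq0; exact.
(* Row [i] of the product is row [i+1] of [D], so the nonzero diagonal of [D] moves to the
   superdiagonal. *)
have hY0 : hessenberg (comp_mx 0 *m D).
  have YE (i j : 'I_n.+1) (lt_in : (i.+1 < n.+1)%N) :
      (comp_mx 0 *m D) i j = D (Ordinal lt_in) j.
    have : row i (comp_mx 0 *m D) = row (Ordinal lt_in) D.
      by rewrite row_mul row_comp_mx -rowE.
    by move/rowP/(_ j); rewrite !mxE.
  split=> i j ij.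
    have lt_in : (i.+1 < n.+1)%N by exact: ltn_trans ij (ltn_ord j).
    by rewrite (YE _ _ lt_in) (is_trig_mxP Dtrig).
  have lt_in : (i.+1 < n.+1)%N by rewrite ij.
  by rewrite (YE _ _ lt_in) (_ : Ordinal _ = j) ?Ddiag //; apply: val_inj.
have [d simY] := hessenberg_place hY0 a.
set Y := (_ + _) in simY.
pose w := d *m invmx D.
have YE : Y = comp_mx w *m D.
  by rewrite -[w]add0r comp_mxE mulmxDl -mulmxA mulmxKV.
(* Companion matrices agree in all rows but the last, and these rows are [e_1, ..., e_n]; so [Z]
   fixes each of these vectors. *)
set Z := invmx N *m comp_mx w.
have [c0 [v XV]] : exists c0 v, Z = block_mx (c0%:M : 'M_1) v 0 1%:M.
  apply: block_mx_row_id => i i0.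
  have lt_p : (i.-1 < n.+1)%N by rewrite (leq_ltn_trans (leq_pred _)).
  have lt_s : ((Ordinal lt_p).+1 < n.+1)%N by rewrite /= prednK.
  have iE : i = Ordinal lt_s by apply: val_inj; rewrite /= prednK.
  rewrite [in LHS]iE rowE -(row_comp_mx q lt_s) -/N rowE.
  by rewrite /Z mulmxA mulmxK // -rowE row_comp_mx -iE.
exists (invmx N), Y, (v *m T).
have PE : invmx N *m Y = block_mx (c0%:M : 'M_1) (v *m T) 0 T.
  rewrite YE mulmxA -/Z XV; apply: etrans (@mulmx_block K 1 n 1 n 1 n _ _ _ _ _ _ _ _) _.
  by rewrite !(mul0mx, mulmx0, addr0, add0r, mul1mx, mulmx1).
split=> //.
  apply: similar_sym; case: AVq => S Su SA; exists S => //.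
  by apply: (can_inj (mulKmx Nu)); rewrite mulKVmx // mulmxA -SA mulmxKV.
(* The corner is forced by the determinant, since [X] and [Y] both have determinant [\det A]. *)
suff <- : c0 = c by [].
have dT : \det T != 0 by rewrite -unitfE -unitmxE.
apply: (mulIf dT); rewrite cT -[c0]det_scalar1 -(det_ublock _ (v *m T)).
have := congr1 determinant PE => /= <-; rewrite det_mulmx det_inv.
by rewrite -(similar_det AVq) det_inv invrK (similar_det simY).
Qed.

Lemma mul_similar_conj (P Q : 'M[K]_n.+1) : similar P Q ->
    (exists X Y, [/\ similar X A, similar Y A & X *m Y = Q]) ->
  exists X Y, [/\ similar X A, similar Y A & X *m Y = P].
Proof.
move=> /similarE[S Su PE] [X [Y [XA YA XY]]].
have simS Z : similar (invmx S *m Z *m S) Z.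
  by exists S => //; rewrite !mulmxA mulmxV // mul1mx.
exists (invmx S *m X *m S), (invmx S *m Y *m S); split.
- exact: similar_trans (simS _) XA.
- exact: similar_trans (simS _) YA.
by rewrite PE -XY !mulmxA mulmxK.
Qed.

Lemma unitmx_sub_scalar m (T : 'M[K]_m) c s :
    char_poly T = \prod_(b <- s) ('X - b%:P) -> c \notin s ->
  T - c%:M \in unitmx.
Proof.
move=> cT cs; have : ~~ root (char_poly T) c by rewrite cT root_prod_XsubC.
rewrite -eigenvalue_root_char unitmxE unitfE; apply: contra => /eqP/eqP/det0P.
case=> v v0 vT; apply/eigenvalueP; exists v => //; apply/eqP.
by rewrite -subr_eq0 -mul_mx_scalar -mulmxBr vT.
Qed.

(** The row beside the corner [c] of the product is not under control, but [c] is no eigenvalue of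
    the rest: both [P] and the product are conjugate to the block diagonal matrix of [c] and
    [T']. *)
Lemma mul_similar_comp_simple (P : 'M[K]_n.+1) c s :
    char_poly P = \prod_(b <- c :: s) ('X - b%:P) -> c \notin s ->
    \det P = \det A ^+ 2 ->
  exists X Y, [/\ similar X A, similar Y A & X *m Y = P].
Proof.
move=> cP cs dP; have /eigenrow[v [T PT]] : root (char_poly P) c.
  by rewrite cP big_cons rootM root_XsubC eqxx.
have cT : char_poly T = \prod_(b <- s) ('X - b%:P).
  have := similar_char_poly PT; rewrite [LHS]cP char_poly_lblock char_poly1 big_cons.
  by move/mulfI=> -> //; rewrite polyXsubC_eq0.
have [T' TT' T'trig] := similar_trig cT.
have cT' := similar_char_poly TT'; rewrite cT in cT'.
have dcT : c * \det T' = \det A ^+ 2.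
  by rewrite -dP (similar_det PT) det_lblock det_scalar1 (similar_det TT').
have T'u : T' \in unitmx.
  move: Au; rewrite !unitmxE !unitfE; apply: contra => /eqP dT0.
  by move/eqP: dcT; rewrite dT0 mulr0 eq_sym expf_eq0.
have [X [Y [w [XA YA XY]]]] := comp_mx_mul_block T'trig T'u dcT.
apply: (@mul_similar_conj P (block_mx (c%:M : 'M_1) w 0 T')); last by exists X, Y.
apply: (similar_trans PT); apply: (similar_trans (similar_lblock _ _)).
  exact: unitmx_sub_scalar cT cs.
apply: (@similar_trans _ _ (block_mx (c%:M : 'M_1) 0 0 T')).
  exact: similar_block_diag (similar_refl _) TT'.
by apply/similar_sym/similar_ublock/unitmx_sub_scalar; [exact/esym/cT'|].
Qed.

(** The product obtained is [c] plus a matrix with the single row [(0, v)]. If [v] is nonzero it is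
    similar to [P], because nilpotent matrices of rank one are conjugate; [v = 0] would give
    [X Y = c] and make [A] similar to [c A^-1]. *)
Lemma mul_similar_comp_transvection (P : 'M[K]_n.+1) c (u : 'cV_n.+1) (w : 'rV_n.+1) :
    P = c%:M + u *m w -> u != 0 -> w != 0 -> w *m u = 0 ->
    \det P = \det A ^+ 2 -> ~ similar A (c *: invmx A) ->
  exists X Y, [/\ similar X A, similar Y A & X *m Y = P].
Proof.
have normal_form (u' : 'cV[K]_(1 + n)) (w' : 'rV_(1 + n)) : u' != 0 -> w' != 0 ->
    w' *m u' = 0 ->
    exists2 r : 'rV_n, r != 0 & similar (c%:M + u' *m w') (block_mx (c%:M : 'M_1) r 0 c%:M).
  move=> u0 w0 wu; have [S Su Se] := unitmx_col0 u0.
  have [x xE] : exists x : 'rV_(1 + n), x = w' *m invmx S by eexists.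
  have x0 : lsubmx x = 0.
    have : x *m (S *m u') = 0 by rewrite xE mulmxA mulmxKV.
    rewrite Se -colE => /colP/(_ 0); rewrite !mxE => x0.
    by apply/matrixP => i j; rewrite !mxE !ord1 -[RHS]x0; congr (x _ _); apply: val_inj.
  have xr : x = row_mx 0 (rsubmx x) by rewrite -[LHS]hsubmxK x0.
  exists (rsubmx x).
    apply: contra w0 => /eqP r0; rewrite -[w'](mulmxKV Su) -xE xr r0 row_mx0.
    by rewrite mul0mx.
  exists S => //; rewrite mulmxDr mulmxA Se scalar_mxC.
  have -> : block_mx (c%:M : 'M_1) (rsubmx x) 0 c%:M = c%:M + delta_mx 0 0 *m x.
    have dE : delta_mx 0 0 = col_mx 1%:M 0 :> 'cV[K]_(1 + n).
      apply/colP => i; rewrite !mxE; case: splitP => j; rewrite ?ord1 !mxE -val_eqE /= => -> //.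
    have xrE : (delta_mx 0 0 : 'cV_(1 + n)) *m x = block_mx (0 : 'M_1) (rsubmx x) 0 0.
      by rewrite dE {1}xr mul_col_row !(mul0mx, mul1mx, mulmx0).
    have cE : c%:M = block_mx c%:M 0 0 c%:M :> 'M[K]_(1 + n) by exact: scalar_mx_block.
    apply/esym; rewrite xrE; apply: etrans (congr1 (fun M => M + _) cE) _.
    by rewrite add_block_mx !(add0r, addr0).
  by rewrite mulmxDl xE -!mulmxA mulVmx // mulmx1.
move=> PE u0 w0 wu dP simA.
have [r r0 Pr] := normal_form u w u0 w0 wu.
rewrite -PE in Pr.
have dcT : c * \det (c%:M : 'M_n) = \det A ^+ 2.
  by rewrite -dP (similar_det Pr) (@det_ublock _ 1 n) det_scalar1.
have Tu : (c%:M : 'M[K]_n) \in unitmx.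
  move: Au; rewrite !unitmxE !unitfE; apply: contra => /eqP dT0.
  by move/eqP: dcT; rewrite dT0 mulr0 eq_sym expf_eq0.
have [X [Y [v [XA YA XY]]]] := comp_mx_mul_block (scalar_mx_is_trig _ _) Tu dcT.
have [v0|v0] := eqVneq v 0.
  case: simA; have Xu : X \in unitmx by rewrite unitmxE (similar_det XA) -unitmxE.
  have YE : Y = c *: invmx X.
    have XYc : X *m Y = c%:M.
      by rewrite XY v0; apply/esym; exact: (@scalar_mx_block K 1 n).
    by rewrite -[Y](mulKmx Xu) XYc mul_mx_scalar.
  apply: (similar_trans (similar_sym YA)); rewrite YE.
  have [S Su SX] := XA; exists S => //; rewrite -scalemxAr -scalemxAl; congr (_ *: _).
  by apply: (can_inj (mulKmx Au)); rewrite mulKVmx // mulmxA -SX mulmxK.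
apply: (@mul_similar_conj P (block_mx (c%:M : 'M_1) v 0 c%:M)); last by exists X, Y.
apply: (similar_trans Pr).
have [S Su rS] := unitmx_row_row r0 v0.
have Su' := Su; rewrite -unitmx_inv in Su'.
exists (block_mx (1%:M : 'M_1) 0 0 (invmx S)).
  by rewrite unitmxE (@det_ublock _ 1 n) det1 mul1r -unitmxE.
apply: etrans (@mulmx_block _ 1 n 1 n 1 n _ _ _ _ _ _ _ _) _.
apply: etrans _ (esym (@mulmx_block _ 1 n 1 n 1 n _ _ _ _ _ _ _ _)).
rewrite !(mul0mx, mul1mx, mulmx0, mulmx1, add0r, addr0) scalar_mxC.
by rewrite -rS mulmxK.
Qed.

End Products.

(** * Unitary matrices of the hyperbolic form *)

Section Adjoint.
Variables (K : fieldType) (theta : {rmorphism K -> K}).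
Hypothesis theta_inv : involutive theta.

Definition adj m n (M : 'M[K]_(m, n)) : 'M[K]_(n, m) := (map_mx theta M)^T.

Lemma adjE m n (M : 'M_(m, n)) i j : adj M i j = theta (M j i).
Proof. by rewrite !mxE. Qed.

Lemma adjK m n (M : 'M_(m, n)) : adj (adj M) = M.
Proof. by apply/matrixP => i j; rewrite !adjE theta_inv. Qed.

Lemma adjD m n (M N : 'M_(m, n)) : adj (M + N) = adj M + adj N.
Proof. by rewrite /adj raddfD raddfD. Qed.

Lemma adjN m n (M : 'M_(m, n)) : adj (- M) = - adj M.
Proof. by rewrite /adj raddfN raddfN. Qed.

Lemma adj0 m n : adj (0 : 'M_(m, n)) = 0.
Proof. by rewrite /adj raddf0 raddf0. Qed.

Lemma adj1 n : adj (1%:M : 'M_n) = 1%:M.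
Proof. by rewrite /adj map_mx1 trmx1. Qed.

Lemma adj_scalar n c : adj (c%:M : 'M_n) = (theta c)%:M.
Proof. by rewrite /adj map_scalar_mx tr_scalar_mx. Qed.

Lemma adjZ m n c (M : 'M_(m, n)) : adj (c *: M) = theta c *: adj M.
Proof. by apply/matrixP => i j; rewrite !mxE rmorphM. Qed.

Lemma adjM m n p (M : 'M_(m, n)) (N : 'M_(n, p)) :
  adj (M *m N) = adj N *m adj M.
Proof. by rewrite /adj map_mxM trmx_mul. Qed.

Lemma adj_block m1 m2 n1 n2 (P : 'M_(m1, n1)) Q R (S : 'M_(m2, n2)) :
  adj (block_mx P Q R S) = block_mx (adj P) (adj R) (adj Q) (adj S).
Proof. by rewrite /adj map_block_mx tr_block_mx. Qed.

Lemma adj_row m n1 n2 (P : 'M_(m, n1)) (Q : 'M_(m, n2)) :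
  adj (row_mx P Q) = col_mx (adj P) (adj Q).
Proof. by rewrite /adj map_row_mx tr_row_mx. Qed.

Lemma adj_unit n (M : 'M_n) : (adj M \in unitmx) = (M \in unitmx).
Proof. by rewrite /adj unitmx_tr map_unitmx. Qed.

Lemma adj_inv n (M : 'M_n) : adj (invmx M) = invmx (adj M).
Proof. by rewrite /adj map_invmx trmx_inv. Qed.

Lemma det_adj n (M : 'M_n) : \det (adj M) = theta (\det M).
Proof. by rewrite /adj det_tr det_map_mx. Qed.

Definition adjE_simp := (adjD, adjN, adj0, adj1, adjK, adjM).

Definition hypJ n : 'M[K]_(n + n) := block_mx 0 1%:M 1%:M 0.

Definition unitary n (g : 'M_(n + n)) := g *m hypJ n *m adj g = hypJ n.

Definition skew n (B : 'M_n) := B + adj B = 0.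

Lemma hypJ2 n : hypJ n *m hypJ n = 1%:M.
Proof.
by rewrite mulmx_block !(mulmx0, mul0mx, mulmx1, add0r, addr0) -scalar_mx_block.
Qed.

Lemma adj_hypJ n : adj (hypJ n) = hypJ n.
Proof. by rewrite adj_block !adj0 adj1. Qed.

Lemma unitary_block n (P Q R S : 'M_n) :
  unitary (block_mx P Q R S) <->
  [/\ P *m adj Q + Q *m adj P = 0, P *m adj S + Q *m adj R = 1%:M
    & R *m adj S + S *m adj R = 0].
Proof.
rewrite /unitary adj_block /hypJ !mulmx_block !(mulmx0, mulmx1, add0r, addr0).
split.
  by case/eq_block_mx; rewrite ![Q *m _ + _]addrC ![S *m _ + _]addrC => -> -> _ ->.
case=> PQ PS RS; congr block_mx; rewrite addrC //.
have := congr1 (@adj _ _) PS; rewrite !adjE_simp addrC => <-.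
by rewrite addrC.
Qed.

Lemma unitary_unit n (g : 'M_(n + n)) : unitary g -> g \in unitmx.
Proof.
move=> /(congr1 (mulmx^~ (hypJ n))); rewrite hypJ2 -!mulmxA.
by case/mulmx1_unit.
Qed.

Lemma unitary_inv n (g : 'M_(n + n)) : unitary g ->
  invmx g = hypJ n *m adj g *m hypJ n.
Proof.
move=> ug; have gu := unitary_unit ug.
apply: (can_inj (mulKmx gu)); rewrite mulmxV // !mulmxA.
by rewrite [_ *m adj g]ug hypJ2.
Qed.

Lemma unitary_adj n (g : 'M_(n + n)) : unitary g ->
  adj g *m hypJ n *m g = hypJ n.
Proof.
move=> ug; have := mulVmx (unitary_unit ug); rewrite unitary_inv //.
move/(congr1 (mulmx (hypJ n))); rewrite !mulmxA hypJ2 mul1mx => ->.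
by rewrite mulmx1.
Qed.

Lemma unitary1 n : unitary (1%:M : 'M_(n + n)).
Proof. by rewrite /unitary adj1 mul1mx mulmx1. Qed.

Lemma unitaryM n (g k : 'M_(n + n)) : unitary g -> unitary k -> unitary (g *m k).
Proof.
move=> ug uk; rewrite /unitary adjM !mulmxA.
by rewrite -[g *m k *m _]mulmxA -[g *m _ *m adj k]mulmxA uk.
Qed.

Lemma unitaryV n (g : 'M_(n + n)) : unitary g -> unitary (invmx g).
Proof.
move=> ug; have gu := unitary_unit ug.
rewrite /unitary -[X in _ *m X *m _]ug !mulmxA mulVmx // mul1mx.
by rewrite -mulmxA -adjM mulVmx // adj1 mulmx1.
Qed.

Lemma unitary_hypJ n : unitary (hypJ n).
Proof. by rewrite /unitary adj_hypJ hypJ2 mul1mx. Qed.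

Lemma det_unitary n (g : 'M_(n + n)) : unitary g -> \det g * theta (\det g) = 1.
Proof.
move=> /(congr1 determinant); rewrite !det_mulmx det_adj mulrAC.
have := congr1 determinant (hypJ2 n); rewrite det_mulmx det1 => JJ.
have J0 : \det (hypJ n) != 0.
  by apply: contra_eq_neq JJ => ->; rewrite mul0r eq_sym oner_neq0.
by rewrite -[RHS]mul1r => /(mulIf J0).
Qed.

(** The Levi subgroup stabilizing both coordinate Lagrangians; [lower] and [upper], taken at skew
    [B], give the unipotent radicals of the two opposite parabolic subgroups. *)
Definition levi n (S : 'M_n) := block_mx S 0 0 (adj (invmx S)).

Lemma unitary_levi n (S : 'M_n) : S \in unitmx -> unitary (levi S).
Proof.
move=> Su; apply/unitary_block.
by rewrite !(adj0, mulmx0, mul0mx, addr0) adjK mulmxV.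
Qed.

Lemma leviM n (S T : 'M_n) : S \in unitmx -> T \in unitmx ->
  levi (S *m T) = levi S *m levi T.
Proof.
move=> Su Tu; rewrite mulmx_block !(mulmx0, mul0mx, addr0, add0r) -adjM.
congr (block_mx _ _ _ (adj _)).
have STu : S *m T \in unitmx by rewrite unitmx_mul Su.
by apply: (can_inj (mulmxK STu)); rewrite mulVmx // mulmxA mulmxKV // mulVmx.
Qed.

Lemma det_levi n (S : 'M_n) : \det (levi S) = \det S / theta (\det S).
Proof. by rewrite det_ublock det_adj det_inv fmorphV. Qed.

Definition lower n (B : 'M[K]_n) := block_mx 1%:M 0 B 1%:M : 'M_(n + n).

Lemma unitary_lower n (B : 'M_n) : skew B -> unitary (lower B).
Proof.
move=> Bs; apply/unitary_block.
by rewrite !(adj0, adj1, mulmx0, mul0mx, mulmx1, mul1mx, addr0).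
Qed.

Definition upper n (B : 'M[K]_n) := block_mx 1%:M B 0 1%:M : 'M_(n + n).

Lemma unitary_upper n (B : 'M_n) : skew B -> unitary (upper B).
Proof.
move=> Bs; apply/unitary_block.
rewrite !(adj0, adj1, mulmx0, mul0mx, mulmx1, mul1mx, addr0).
by rewrite addrC.
Qed.

Lemma det_lower n (B : 'M[K]_n) : \det (lower B) = 1.
Proof. by rewrite det_lblock !det1 mulr1. Qed.

Lemma det_upper n (B : 'M[K]_n) : \det (upper B) = 1.
Proof. by rewrite det_ublock !det1 mulr1. Qed.

Lemma unitary_LDU n (P Q R S : 'M_n) :
    P \in unitmx -> unitary (block_mx P Q R S) ->
  [/\ skew (R *m invmx P), skew (invmx P *m Q)
    & block_mx P Q R S = lower (R *m invmx P) *m levi P *m upper (invmx P *m Q)].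
Proof.
move=> Pu ug.
have [PQ PS _] := proj1 (unitary_block P Q R S) ug.
have Rs : skew (R *m invmx P).
  have := unitary_adj ug; rewrite adj_block !mulmx_block.
  rewrite !(mulmx0, mulmx1, add0r, addr0) => /eq_block_mx[RP _ _ _].
  have := congr1 (fun M => adj (invmx P) *m M *m invmx P) RP.
  rewrite mulmxDr mulmxDl mulmx0 mul0mx -!mulmxA mulmxV // mulmx1 => RP'.
  rewrite /skew -[RHS]RP' addrC !adjM.
  by rewrite [_ *m (adj P *m _)]mulmxA -[_ *m adj P]adjM mulmxV // adj1 mul1mx.
have Qs : skew (invmx P *m Q).
  have := congr1 (fun M => invmx P *m M *m adj (invmx P)) PQ.
  rewrite mulmxDr mulmxDl mulmx0 mul0mx !mulmxA mulVmx // mul1mx.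
  rewrite -[_ *m adj P *m _]mulmxA -[adj P *m _]adjM mulVmx // adj1 mulmx1 => QP.
  by rewrite /skew adjM -[RHS]QP addrC.
split=> //; rewrite !mulmx_block !(mulmx0, mul0mx, mulmx1, mul1mx, add0r, addr0).
rewrite mulmxKV // mulKVmx //; congr block_mx; apply: (can_inj (@adjK _ _)).
have := congr1 (fun M => invmx P *m M) PS; rewrite mulmxDr mulKmx // mulmx1.
move=> /(canRL (addrK _)) ->; rewrite addrC adjD adjK; congr (_ + _).
move/eqP: Qs; rewrite addrC addr_eq0 => /eqP; rewrite adjM => ->.
by rewrite mulNmx mulmxA.
Qed.

Lemma det_unitary_ulsubmx n (P Q R S : 'M_n) : P \in unitmx ->
  unitary (block_mx P Q R S) ->
  \det (block_mx P Q R S) = \det P / theta (\det P).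
Proof.
move=> Pu /(unitary_LDU Pu)[_ _ ->].
by rewrite !det_mulmx det_lower det_levi det_upper mul1r mulr1.
Qed.

(** Used to turn uniqueness for a Sylvester equation into solvability. *)
Lemma lin_mx_surj n (f : {linear 'M[K]_n -> 'M[K]_n}) :
  (forall B, f B = 0 -> B = 0) -> forall C, exists B, f B = C.
Proof.
move=> f0 C; have fu : lin_mx f \in unitmx.
  rewrite -row_free_unit -kermx_eq0; apply/eqP/row_matrixP => i; rewrite row0.
  apply: (can_inj vec_mxK); rewrite linear0; apply: f0; apply: (can_inj mxvecK).
  rewrite linear0 -mul_vec_lin vec_mxK -row_mul mulmx_ker row0.
  by [].
exists (vec_mx (mxvec C *m invmx (lin_mx f))); apply: (can_inj mxvecK).
by rewrite -mul_vec_lin vec_mxK mulmxKV.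
Qed.

Section Conjugate.
Variables (n : nat) (A : 'M[K]_n).
Hypothesis Au : A \in unitmx.
Let A' := adj (invmx A).

(** A Levi element first turns [X] into [A], which forces the last block to be [A']; then [lower B]
    removes the remaining block [D] when [B A - A' B = - D]. *)
Lemma conj_lower_levi (X C X' : 'M_n) :
    (forall B, B *m A = A' *m B -> B = 0) ->
    unitary (block_mx X 0 C X') -> similar X A ->
  exists2 a, unitary a & a *m block_mx X 0 C X' = levi A *m a.
Proof.
move=> A0.
have conjA (D : 'M_n) : unitary (block_mx A 0 D A') ->
    exists2 a, unitary a & a *m block_mx A 0 D A' = levi A *m a.
  move=> /unitary_block[_ _]; rewrite /A' adjK => Dskew.
  pose f := (mulmxr A \- mulmx A')%R.
  have [B fB] := @lin_mx_surj _ f (fun B fB0 => A0 B (subr0_eq fB0)) (- D).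
  have {fB} BD : B *m A - A' *m B = - D by [].
  (* [D] satisfies the skewness relation of a unitary matrix, so [B + adj B] solves the homogeneous
     equation and vanishes. *)
  have Bs : skew B.
    apply: A0; apply/eqP; rewrite -subr_eq0 mulmxDl mulmxDr opprD addrACA BD.
    have BA : adj B *m A = A' *m adj B + D.
      have AA : A' *m adj A = 1%:M by rewrite -adjM mulmxV // adj1.
      have := congr1 (fun M => A' *m adj M *m A) BD.
      rewrite !adjE_simp mulmxBr mulmxBl mulmxA AA mul1mx.
      rewrite -!mulmxA mulVmx // mulmx1 => /eqP; rewrite subr_eq => /eqP ->.
      rewrite addrC; congr (_ + _); rewrite mulmxA mulmxN mulNmx.
      have /eqP := Dskew; rewrite addrC addr_eq0 => /eqP ->.
      by rewrite mulNmx opprK mulmxKV.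
    by rewrite BA addrAC subrr add0r addNr.
  exists (lower B); first exact: unitary_lower.
  rewrite !mulmx_block !(mulmx0, mul0mx, mulmx1, mul1mx, addr0, add0r).
  by congr block_mx; apply/eqP; rewrite -subr_eq0 addrAC BD addNr.
move=> ux [S Su SX].
have X'E : S *m X *m invmx S = A by rewrite SX mulmxK.
have Lu := unitary_unit (unitary_levi Su).
have leviV : invmx (levi S) = levi (invmx S).
  apply: (can_inj (mulKmx Lu)).
  rewrite mulmxV // -leviM ?unitmx_inv // mulmxV // /levi invmx1 adj1.
  exact: scalar_mx_block.
have uD := unitaryM (unitaryM (unitary_levi Su) ux) (unitaryV (unitary_levi Su)).
set Z := (_ *m invmx _) in uD.
have [D [X'' ZE]] : exists D X'', Z = block_mx A 0 D X''.
  rewrite /Z leviV !mulmx_block !(mulmx0, mul0mx, add0r, addr0) X'E.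
  by eexists; eexists.
have X''E : X'' = A'.
  move: uD; rewrite ZE => /unitary_block[_]; rewrite mul0mx addr0 => AX _.
  by rewrite -[X'']adjK -[adj X''](mulKmx Au) AX mulmx1.
move: uD; rewrite ZE X''E => /conjA[a ua aD].
exists (a *m levi S); first exact: unitaryM ua (unitary_levi Su).
apply: (can_inj (mulmxK (_ : invmx (levi S) \in unitmx))); rewrite ?unitmx_inv //.
by rewrite -!mulmxA [levi S *m _]mulmxA -/Z ZE X''E mulmxV // mulmx1.
Qed.

Lemma similar_adj_inv (X : 'M_n) : similar X A -> similar (adj (invmx X)) A'.
Proof.
case=> S Su SX; exists (adj (invmx S)); first by rewrite adj_unit unitmx_inv.
have Xu : X \in unitmx.
  by rewrite unitmxE (@similar_det _ _ X A) -?unitmxE //; exists S.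
rewrite -!adjM; congr adj.
have SXu : S *m X \in unitmx by rewrite unitmx_mul Su.
apply: (can_inj (mulmxK SXu)); rewrite mulmxA mulmxKV // mulVmx // SX.
by rewrite mulmxA mulmxKV // mulVmx.
Qed.

End Conjugate.

Lemma adj_invK n (B : 'M_n) : adj (invmx (adj (invmx B))) = B.
Proof. by rewrite -adj_inv adjK invmxK. Qed.

Lemma levi_swap n (B : 'M_n) :
  levi (adj (invmx B)) = hypJ n *m levi B *m hypJ n.
Proof.
rewrite !mulmx_block !(mulmx0, mul0mx, mulmx1, mul1mx, add0r, addr0).
by rewrite /levi adj_invK.
Qed.

(** Conjugation by [hypJ] exchanges upper with lower and [A] with its inverse adjoint, hence the
    mirrored Sylvester hypothesis. *)
Lemma conj_upper_levi n (A Y D Y' : 'M_n) : A \in unitmx ->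
    (forall B, B *m adj (invmx A) = A *m B -> B = 0) ->
    unitary (block_mx Y D 0 Y') -> similar Y A ->
  exists2 a, unitary a & a *m block_mx Y D 0 Y' = levi A *m a.
Proof.
move=> Au A0 uM YA; set M := block_mx _ _ _ _ in uM *.
have Yu : Y \in unitmx by rewrite unitmxE (similar_det YA) -unitmxE.
have Y'E : Y' = adj (invmx Y).
  have /unitary_block[_] := uM; rewrite adj0 mulmx0 addr0 => YY _.
  by rewrite -[Y']adjK -[adj Y'](mulKmx Yu) YY mulmx1.
have JMJ : hypJ n *m M *m hypJ n = block_mx Y' 0 D Y.
  by rewrite /M !mulmx_block !(mulmx0, mul0mx, mulmx1, mul1mx, add0r, addr0).
have A'u : adj (invmx A) \in unitmx by rewrite adj_unit unitmx_inv.
have uJMJ : unitary (block_mx Y' 0 D Y).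
  by rewrite -JMJ; apply: unitaryM (unitary_hypJ _); apply: unitaryM uM; exact: unitary_hypJ.
have [||a ua aM] := conj_lower_levi A'u _ uJMJ _.
- by move=> B; rewrite adj_invK; exact: A0.
- by rewrite Y'E; exact: similar_adj_inv.
exists (hypJ n *m a *m hypJ n).
  by apply: unitaryM (unitary_hypJ _); apply: unitaryM ua; exact: unitary_hypJ.
have := congr1 (fun Z => hypJ n *m Z *m hypJ n) aM.
rewrite -JMJ levi_swap !mulmxA hypJ2 mul1mx => <-.
by rewrite -[RHS]mulmxA hypJ2 mulmx1.
Qed.

(* [u1 levi(XY) u2], with [u1] lower and [u2] upper unipotent, is the product of
   [u1 levi(X)] and [levi(Y) u2], which are both conjugate to [levi(A)] since
   [A] and its inverse adjoint have no common eigenvalue. *)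
Theorem unitary_mul_conj_levi n (A P Q R S X Y : 'M_n) : A \in unitmx ->
    (forall B, B *m A = adj (invmx A) *m B -> B = 0) ->
    (forall B, B *m adj (invmx A) = A *m B -> B = 0) ->
    unitary (block_mx P Q R S) ->
    similar X A -> similar Y A -> X *m Y = P ->
  exists a b, [/\ unitary a, unitary b &
    block_mx P Q R S = (invmx a *m levi A *m a) *m (invmx b *m levi A *m b)].
Proof.
move=> Au A1 A2 ug XA YA XY.
have Xu : X \in unitmx by rewrite unitmxE (similar_det XA) -unitmxE.
have Yu : Y \in unitmx by rewrite unitmxE (similar_det YA) -unitmxE.
have Pu : P \in unitmx by rewrite -XY unitmx_mul Xu.
have [sR sQ gE] := unitary_LDU Pu ug.
have ux := unitaryM (unitary_lower sR) (unitary_levi Xu).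
have uy := unitaryM (unitary_levi Yu) (unitary_upper sQ).
have [a ua ax] : exists2 a, unitary a &
    a *m (lower (R *m invmx P) *m levi X) = levi A *m a.
  move: ux; rewrite mulmx_block !(mulmx0, mul0mx, mul1mx, mulmx1, addr0, add0r).
  by move=> ux; exact: conj_lower_levi.
have [b ub b_y] : exists2 b, unitary b &
    b *m (levi Y *m upper (invmx P *m Q)) = levi A *m b.
  move: uy; rewrite mulmx_block !(mulmx0, mul0mx, mul1mx, mulmx1, addr0, add0r).
  by move=> uy; exact: conj_upper_levi.
exists a, b; split=> //.
rewrite -[_ *m a]mulmxA -ax -[_ *m b]mulmxA -b_y !mulKmx ?unitary_unit //.
by rewrite gE -XY leviM // !mulmxA.
Qed.

End Adjoint.

(** * Isotropic vectors *)

Section Reduction.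
Variables (K : fieldType) (theta : {rmorphism K -> K}).
Hypothesis theta_inv : involutive theta.
Hypothesis theta_neq1 : exists a : K, theta a <> a.
Local Notation adj := (adj theta).
Local Notation unitary := (unitary theta).
Local Notation skew := (skew theta).
Local Notation levi := (levi theta).
Local Notation hypJ := (hypJ K).

Lemma exists_skew_elt : exists2 e : K, e != 0 & e + theta e = 0.
Proof.
have [a /eqP a_neq] := theta_neq1; exists (a - theta a).
  by rewrite subr_eq0 eq_sym.
by rewrite rmorphB theta_inv -[theta a - a]opprB subrr.
Qed.

(** Every [y + z theta(y)] solves the equation; [y = 1] gives a nonzero solution unless [z = -1],
    and then any element moved by [theta] does. *)
Lemma hilbert90 (z : K) : z * theta z = 1 -> exists2 v, v != 0 & v = z * theta v.
Proof.
move=> zz; have vE y : y + z * theta y = z * theta (y + z * theta y).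
  by rewrite rmorphD rmorphM theta_inv mulrDr mulrA zz mul1r addrC.
have [z1|z1] := eqVneq (1 + z) 0; last first.
  by exists (1 + z) => //; have := vE 1; rewrite rmorph1 mulr1.
have [a /eqP a_neq] := theta_neq1; exists (a + z * theta a); last exact: vE.
move/eqP: z1; rewrite addrC addr_eq0 => /eqP ->.
by rewrite mulN1r subr_eq0 eq_sym.
Qed.

(** Polarization with the coefficients 1 and [z], where [theta z] differs from [z], separates the
    two mixed terms in every characteristic. *)
Lemma form_eq0 n (A : 'M[K]_n) : (forall a : 'rV_n, a *m A *m adj a = 0) -> A = 0.
Proof.
move=> A0; have [z /eqP z_neq] := theta_neq1.
have pol (a b : 'rV_n) y : theta y *: (a *m A *m adj b) + y *: (b *m A *m adj a) = 0.
  have := A0 (a + y *: b); rewrite adjD adjZ !mulmxDl !mulmxDr A0 add0r.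
  by rewrite -!scalemxAl -!scalemxAr A0 !scaler0 addr0 addrC.
have A0' (a b : 'rV_n) : a *m A *m adj b = 0.
  have := pol a b z; have := pol a b 1; rewrite rmorph1 !scale1r => /eqP.
  rewrite addrC addr_eq0 => /eqP ->; rewrite scalerN -scalerBl => /eqP.
  by rewrite scaler_eq0 subr_eq0 (negPf z_neq) => /eqP.
apply/matrixP => i j; have /matrixP/(_ 0 0) := A0' (delta_mx 0 i) (delta_mx 0 j).
rewrite -rowE [RHS]mxE mxE [LHS](bigD1 j) //= !mxE !eqxx rmorph1 mulr1 big1 ?addr0 // => k kj.
by rewrite !mxE (negPf kj) andbF rmorph0 mulr0.
Qed.

(** All [y adj(N) - theta(y) N] are skew; comparing [y = 1] with a [y] moved by [theta] shows that
    [B] commutes with every [N]. *)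
Lemma commute_skew_scalar n (B : 'M[K]_n) :
  (forall T, skew T -> T *m B = B *m T) -> is_scalar_mx B.
Proof.
move=> BT; have [z /eqP z_neq] := theta_neq1.
have commB (N : 'M_n) : N *m B = B *m N.
  have sk y : skew (y *: adj N - theta y *: N).
    by rewrite /skew adjD adjN !adjZ adjK // theta_inv addrA subrK subrr.
  have LT y : y *: (adj N *m B - B *m adj N) = theta y *: (N *m B - B *m N).
    have := BT _ (sk y); rewrite mulmxBl mulmxBr -!scalemxAl -!scalemxAr => /(canRL (subrK _)).
    by rewrite !scalerBr => ->; rewrite addrAC [_ - _ - _]addrAC subrr add0r addrC.
  have := LT z; have := LT 1; rewrite rmorph1 !scale1r => -> /eqP.
  rewrite -subr_eq0 -scalerBl scaler_eq0 !subr_eq0 eq_sym (negPf z_neq).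
  by move=> /eqP.
case: n B BT commB => [|m] B _ commB; apply/is_scalar_mxP.
  by exists 0; apply/matrixP => -[].
have E (i j l : 'I_m.+1) : B j l = B i i *+ (l == j).
  have /matrixP/(_ i l) := commB (delta_mx i j).
  rewrite mxE (bigD1 j) //= big1 => [|k kj]; last by rewrite mxE (negPf kj) andbF mul0r.
  rewrite mxE !eqxx mul1r addr0 => ->; rewrite mxE (bigD1 i) //= big1 => [|k ki].
    by rewrite mxE eqxx /= addr0 mulr_natr.
  by rewrite mxE (negPf ki) mulr0.
by exists (B 0 0); apply/matrixP => j l; rewrite [LHS](E 0) [RHS]mxE eq_sym.
Qed.

(** If every isotropic [x] were orthogonal to [x g], the test vectors [(a, 0)], [(0, a)] and
    [(a, a T)] with [T] skew would show that [J adj(g)] has zero diagonal blocks and equal scalar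
    off-diagonal blocks. *)
Lemma exists_isotropic n (g : 'M_(n + n)) : unitary g -> ~ is_scalar_mx g ->
  exists2 x : 'rV_(n + n), x *m hypJ n *m adj x = 0 & x *m hypJ n *m adj (x *m g) <> 0.
Proof.
move=> ug gs; apply: contrapT => noiso; apply: gs.
have iso0 (a b : 'rV_n) : a *m adj b + b *m adj a = 0 ->
    row_mx a b *m (hypJ n *m adj g) *m adj (row_mx a b) = 0.
  move=> ab; apply: contrapT => nz; apply: noiso; exists (row_mx a b).
    rewrite mul_row_block adj_row mul_row_col.
    by rewrite !(mulmx0, mulmx1, add0r, addr0) addrC.
  by rewrite adjM mulmxA; rewrite mulmxA in nz.
have [A [B [C [D ME]]]] : exists A B C D, hypJ n *m adj g = block_mx A B C D.
  by do 4!eexists; exact/esym/submxK.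
have iso (a b : 'rV_n) : a *m adj b + b *m adj a = 0 ->
    (a *m A + b *m C) *m adj a + (a *m B + b *m D) *m adj b = 0.
  by move/iso0; rewrite ME mul_row_block adj_row mul_row_col.
have A0 : A = 0.
  apply: form_eq0 => a; have := iso a 0.
  by rewrite adj0 !(mulmx0, mul0mx, addr0) => ->.
have D0 : D = 0.
  apply: form_eq0 => a; have := iso 0 a.
  by rewrite adj0 !(mulmx0, mul0mx, add0r) => ->.
have TC T : skew T -> T *m C = B *m T.
  move=> sT; have aT : adj T = - T by apply/eqP; rewrite -addr_eq0 addrC; exact/eqP.
  apply/eqP; rewrite -subr_eq0; apply/eqP/form_eq0 => a.
  have aaT : a *m adj (a *m T) + a *m T *m adj a = 0.
    by rewrite adjM aT mulNmx mulmxN mulmxA addNr.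
  have := iso a (a *m T) aaT; rewrite A0 D0 !mulmx0 add0r addr0 adjM aT.
  by rewrite mulNmx mulmxN mulmxBr mulmxBl !mulmxA.
have [e e0 eN] := exists_skew_elt.
have CB : C = B.
  have := TC e%:M; rewrite mul_scalar_mx mul_mx_scalar => eCB.
  apply: (scalerI e0); apply: eCB.
  by rewrite /skew adj_scalar -raddfD /= eN raddf0.
have /is_scalar_mxP[c Bc] : is_scalar_mx B.
  by apply: commute_skew_scalar => T /TC <-; rewrite CB.
have gE : adj g = c%:M.
  rewrite -[LHS]mul1mx -(hypJ2 K n) -mulmxA ME A0 D0 CB Bc !mulmx_block.
  by rewrite !(mulmx0, mul0mx, mul1mx, add0r, addr0) -scalar_mx_block.
by rewrite -[g](adjK theta_inv) gE adj_scalar scalar_mx_is_scalar.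
Qed.

Section Pairs.
Variable m : nat.
Local Notation d0 := (delta_mx 0 0 : 'rV[K]_m.+1).

Lemma skew_row0 (c : 'rV[K]_m.+1) : c 0 0 + theta (c 0 0) = 0 ->
  exists2 B, skew B & d0 *m B = c.
Proof.
move=> c0; exists (\matrix_(i, j) if i == 0 then c 0 j else
   if j == 0 then - theta (c 0 i) else 0).
  apply/matrixP => i j; rewrite mxE !mxE.
  have [i0|i0] := eqVneq i 0; have [j0|j0] := eqVneq j 0; rewrite ?i0 ?j0.
  - exact: c0.
  - by rewrite rmorphN theta_inv subrr.
  - by rewrite addNr.
  by rewrite rmorph0 addr0.
by apply/rowP => j; rewrite -rowE !mxE eqxx.
Qed.

Lemma isotropicE (a b : 'rV[K]_m.+1) :
    row_mx a b *m hypJ m.+1 *m adj (row_mx a b) = 0 ->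
  (b *m adj a) 0 0 + theta ((b *m adj a) 0 0) = 0.
Proof.
rewrite mul_row_block adj_row mul_row_col.
rewrite !(mulmx0, mulmx1, add0r, addr0) => /matrixP/(_ 0 0).
by rewrite [RHS]mxE mxE -[in X in _ + X](adjK theta_inv (a *m adj b)) adjM adjK ?adjE.
Qed.

(** Witt's theorem for one vector. If the first half of [x] is nonzero, an upper unipotent and a
    Levi element suffice, isotropy being what a skew block requires; otherwise [hypJ] swaps the
    halves. *)
Lemma unitary_isotropic_row (x : 'rV_(m.+1 + m.+1)) : x != 0 ->
    x *m hypJ m.+1 *m adj x = 0 ->
  exists2 u, unitary u & row_mx d0 0 *m u = x.
Proof.
have main (a b : 'rV[K]_m.+1) : a != 0 ->
    row_mx a b *m hypJ m.+1 *m adj (row_mx a b) = 0 ->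
    exists2 u, unitary u & row_mx d0 0 *m u = row_mx a b.
  move=> a0 /isotropicE ab; have [S Su Sa] := unitmx_row0 a0.
  have b'E : b *m adj a = b *m adj S *m adj d0 by rewrite -Sa adjM mulmxA.
  have b'0 : (b *m adj a) 0 0 = (b *m adj S) 0 0.
    by rewrite b'E /adj map_delta_mx trmx_delta -colE mxE.
  rewrite b'0 in ab; have [B sB dB] := skew_row0 ab.
  exists (upper B *m levi S).
    by apply: unitaryM; [exact: unitary_upper | exact: unitary_levi].
  rewrite mulmxA mul_row_block mul_row_block.
  rewrite !(mulmx1, mul0mx, mulmx0, addr0, add0r) Sa dB -mulmxA -adjM.
  by rewrite mulVmx // adj1 mulmx1.
move=> x0; rewrite -[x]hsubmxK in x0 *; set a := lsubmx x in x0 *.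
set b := rsubmx x in x0 *; have [a0|a0] := eqVneq a 0; last exact: main.
have b0 : b != 0.
  by apply: contra x0 => /eqP ->; rewrite a0 row_mx0.
move=> iso; have [|u uu ux] := main b 0 b0.
  by rewrite mul_row_block adj_row mul_row_col adj0 !(mulmx0, mul0mx, mulmx1, addr0).
exists (u *m hypJ m.+1); first exact: unitaryM uu (unitary_hypJ _ _).
rewrite mulmxA ux mul_row_block a0.
by rewrite !(mulmx0, mulmx1, mul0mx, addr0, add0r).
Qed.

(** Witt's theorem for hyperbolic pairs. Once [x] is the first basis vector, a transvection [S2]
    takes [d0] to the second half of [f] while its inverse adjoint fixes [d0]; a lower unipotent
    then adjusts the first half. *)
Lemma unitary_hyperbolic_rows (x f : 'rV_(m.+1 + m.+1)) :
    x *m hypJ m.+1 *m adj x = 0 -> f *m hypJ m.+1 *m adj f = 0 ->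
    x *m hypJ m.+1 *m adj f = 1%:M ->
  exists u, [/\ unitary u, row_mx d0 0 *m u = x & row_mx 0 d0 *m u = f].
Proof.
move=> xx ff xf; have x0 : x != 0.
  apply: contraTneq isT => x0; move: xf; rewrite x0 !mul0mx => /matrixP/(_ 0 0)/eqP.
  by rewrite !mxE eq_sym oner_eq0.
have [u uu ux] := unitary_isotropic_row x0 xx.
have uu' := unitary_unit uu.
pose f1 := f *m invmx u; have fE : f = f1 *m u by rewrite mulmxKV.
have formE (y z : 'rV_(m.+1 + m.+1)) :
    y *m u *m hypJ m.+1 *m adj (z *m u) = y *m hypJ m.+1 *m adj z.
  by rewrite adjM !mulmxA -[y *m u *m _]mulmxA -[y *m _ *m adj u]mulmxA uu.
move: ff xf; rewrite fE -ux !formE -[f1]hsubmxK.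
set a := lsubmx f1; set b := rsubmx f1 => /isotropicE ff.
rewrite mul_row_block adj_row mul_row_col !(mulmx0, mul0mx, mulmx1, addr0, add0r).
move=> bE; have b1 : b 0 0 = 1.
  have := congr1 (fun M => adj M 0 0) bE; rewrite adjM adjK // adj1.
  by rewrite /adj map_delta_mx trmx_delta -colE !mxE eqxx.
pose e0 : 'cV[K]_m.+1 := delta_mx 0 0.
have de : d0 *m e0 = 1%:M.
  by rewrite mul_delta_mx; apply/matrixP => i j; rewrite !mxE !ord1.
have be : b *m e0 = 1%:M.
  by rewrite -colE; apply/matrixP => i j; rewrite [LHS]mxE [RHS]mxE !ord1 b1.
pose N := e0 *m (b - d0).
have NN : N *m N = 0.
  by rewrite /N mulmxA -[_ *m e0]mulmxA mulmxBl be de subrr mulmx0 mul0mx.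
pose S2 := 1%:M + N.
have S2N : S2 *m (1%:M - N) = 1%:M.
  by rewrite mulmxDl !mulmxBr !mul1mx mulmx1 NN subr0 subrK.
have [S2u _] := mulmx1_unit S2N.
have S2V : invmx S2 = 1%:M - N by rewrite -[RHS](mulKmx S2u) S2N mulmx1.
have dS2 : d0 *m S2 = b.
  by rewrite mulmxDr mulmx1 mulmxA de mul1mx addrC subrK.
pose S := adj (invmx S2).
have Su : S \in unitmx by rewrite adj_unit unitmx_inv.
have ade : adj e0 = d0 by rewrite /adj map_delta_mx trmx_delta.
have dS : d0 *m S = d0.
  have db : d0 *m adj (b - d0) = 0.
    by rewrite -{1}ade -adjM mulmxBl be de subrr adj0.
  by rewrite /S S2V adjD adjN adj1 mulmxBr mulmx1 adjM mulmxA db mul0mx subr0.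
have c0 : (a *m adj S2) 0 0 + theta ((a *m adj S2) 0 0) = 0.
  have -> : (a *m adj S2) 0 0 = (a *m adj S2 *m e0) 0 0 by rewrite -colE [RHS]mxE.
  have -> : a *m adj S2 *m e0 = adj (b *m adj a).
    by rewrite adjM adjK // -[in RHS]dS2 adjM -ade adjK // mulmxA.
  by rewrite adjE theta_inv addrC.
have [C sC dC] := skew_row0 c0.
exists (lower C *m levi S *m u); split.
- by apply: unitaryM uu; apply: unitaryM; [exact: unitary_lower | exact: unitary_levi].
- rewrite 2!mulmxA !mul_row_block.
  by rewrite !(mulmx0, mulmx1, mul0mx, addr0, add0r) dS.
rewrite 2!mulmxA !mul_row_block !(mulmx0, mulmx1, mul0mx, addr0, add0r) dC.
by rewrite /S adj_invK // dS2 -mulmxA -adjM mulVmx // adj1 mulmx1.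
Qed.
End Pairs.

End Reduction.

(** * Block splittings *)

Section Splitting.
Variables (K : fieldType) (theta : {rmorphism K -> K}).
Hypothesis theta_inv : involutive theta.
Local Notation adj := (adj theta).
Local Notation unitary := (unitary theta).
Local Notation skew := (skew theta).
Local Notation levi := (levi theta).
Local Notation hypJ := (hypJ K).

(** Let [E] and [F] be the spans of the first [j] vectors of the two Lagrangian bases. Then [g] maps
    [E] to [F] by [Q0], and [c] is the induced map from [E^perp / E] to [F^perp / F], both
    identified with the remaining [2m] coordinates. *)
Definition split_form j m (Q0 : 'M[K]_j) (c : 'M_(m + m)) (g : 'M_((j + m) + (j + m))) : Prop :=
  exists Q21 R11 R12 S11 S12 S21, g = block_mx
    (block_mx 0 0 0 (ulsubmx c)) (block_mx Q0 0 Q21 (ursubmx c))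
    (block_mx R11 R12 0 (dlsubmx c)) (block_mx S11 S12 S21 (drsubmx c)).

(** Zeros in the first [j] rows suffice: unitarity makes [Q0] invertible, and this forces the other
    zero blocks. *)
Lemma unitary_split_form j m (g : 'M_((j + m) + (j + m))) : unitary g ->
    usubmx (ulsubmx g) = 0 -> ursubmx (ursubmx g) = 0 ->
  exists2 c, split_form (ulsubmx (ursubmx g)) c g &
    ulsubmx (ursubmx g) \in unitmx /\ unitary c.
Proof.
move=> ug Pu Qr; have gE := submxK g; move: ug; rewrite -gE.
rewrite -[ulsubmx g]vsubmxK Pu -[dsubmx _]hsubmxK.
rewrite -[ursubmx g]submxK Qr -[dlsubmx g]submxK -[drsubmx g]submxK.
rewrite !(block_mxKul, block_mxKur).
set P21 := lsubmx _; set P3 := rsubmx _; set Q0 := ulsubmx _; set Q21 := dlsubmx _.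
set Q3 := drsubmx _; set R11 := ulsubmx _; set R12 := ursubmx _.
set R21 := dlsubmx _; set R3 := drsubmx _; set S11 := ulsubmx _.
set S12 := ursubmx _; set S21 := dlsubmx _; set S3 := drsubmx _.
have -> : col_mx (0 : 'M_(j, j + m)) (row_mx P21 P3) = block_mx 0 0 P21 P3.
  by rewrite -[X in col_mx X _]row_mx0.
move/(unitary_block theta_inv) => [] ; rewrite !adj_block !adj0 !mulmx_block !add_block_mx.
rewrite !(mul0mx, mulmx0, add0r, addr0).
move=> e1 e2 e3.
have /eq_block_mx[_ QP _ PQ] := etrans e1 (esym (block_mx0 _ _ _ _ _)).
have /eq_block_mx[QR11 QR21 _ PS] := etrans e2 (scalar_mx_block _ _ _).
have /eq_block_mx[_ _ _ RS] := etrans e3 (esym (block_mx0 _ _ _ _ _)).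
have [Q0u _] := mulmx1_unit QR11.
have P21E : P21 = 0.
  by apply: (can_inj (@adjK _ _ theta_inv _ _)); apply: (can_inj (mulKmx Q0u)); rewrite QP adj0 mulmx0.
have R21E : R21 = 0.
  by apply: (can_inj (@adjK _ _ theta_inv _ _)); apply: (can_inj (mulKmx Q0u)); rewrite QR21 adj0 mulmx0.
exists (block_mx P3 Q3 R3 S3).
  do 6!eexists; rewrite P21E R21E !(block_mxKul, block_mxKur, block_mxKdl, block_mxKdr).
  by congr block_mx.
split=> //; apply/(unitary_block theta_inv); split.
- by move: PQ; rewrite P21E adj0 mul0mx mulmx0 !add0r.
- by move: PS; rewrite P21E R21E adj0 mul0mx mulmx0 !add0r.
by move: RS; rewrite R21E adj0 mul0mx mulmx0 !add0r.
Qed.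

(** Orthogonal sum of the identity on [j] hyperbolic planes with [w]; the blocks are interleaved
    because each Lagrangian basis is split separately. *)
Definition dsum j m (w : 'M[K]_(m + m)) : 'M_((j + m) + (j + m)) := block_mx
  (block_mx 1%:M 0 0 (ulsubmx w)) (block_mx 0 0 0 (ursubmx w))
  (block_mx 0 0 0 (dlsubmx w)) (block_mx 1%:M 0 0 (drsubmx w)).

Lemma dsumM j m (v w : 'M[K]_(m + m)) : dsum j (v *m w) = dsum j v *m dsum j w.
Proof.
rewrite /dsum !mulmx_block !(mul0mx, mulmx0, mul1mx, addr0, add0r) !add_block_mx.
rewrite !(addr0, add0r).
rewrite -[in LHS](submxK v) -[in LHS](submxK w) mulmx_block.
by rewrite !(block_mxKul, block_mxKur, block_mxKdl, block_mxKdr).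
Qed.

Lemma dsum1 j m : dsum j (1%:M : 'M[K]_(m + m)) = 1%:M.
Proof.
rewrite /dsum [in LHS](scalar_mx_block m m).
rewrite !(block_mxKul, block_mxKur, block_mxKdl, block_mxKdr).
by rewrite -!scalar_mx_block !block_mx0 -scalar_mx_block.
Qed.

Lemma dsum_unit j m (w : 'M[K]_(m + m)) : w \in unitmx -> dsum j w \in unitmx.
Proof.
by move=> wu; apply: (proj1 (@mulmx1_unit _ _ _ (dsum j (invmx w)) _)); rewrite -dsumM mulmxV ?dsum1.
Qed.

Lemma dsumV j m (w : 'M[K]_(m + m)) : w \in unitmx ->
  invmx (dsum j w) = dsum j (invmx w).
Proof.
move=> wu; apply: (can_inj (mulKmx (dsum_unit j wu))).
by rewrite mulmxV ?dsum_unit // -dsumM mulmxV ?dsum1.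
Qed.

Lemma unitary_dsum j m (w : 'M_(m + m)) : unitary w -> unitary (dsum j w).
Proof.
move=> uw; have adjw : adj (dsum j w) = dsum j (adj w).
  rewrite /dsum !adj_block !adj0 !adj1 -[w in RHS]submxK adj_block.
  by rewrite !(block_mxKul, block_mxKur, block_mxKdl, block_mxKdr).
have JE : hypJ (j + m) = block_mx (block_mx 0 0 0 0) (block_mx 1%:M 0 0 1%:M)
    (block_mx 1%:M 0 0 1%:M) (block_mx 0 0 0 0).
  by rewrite !block_mx0 -!scalar_mx_block.
have := uw; rewrite /unitary adjw JE /dsum -{1 2}(submxK w) /hypJ !adj_block.
rewrite !mulmx_block !(mul0mx, mulmx0, mul1mx, mulmx1, addr0, add0r).
move=> /eq_block_mx[e1 e2 e3 e4]; rewrite !add_block_mx !(addr0, add0r).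
rewrite !mulmx_block !(mul0mx, mulmx0, mul1mx, mulmx1, addr0, add0r) !add_block_mx !(addr0, add0r).
have -> : adj w = block_mx (adj (ulsubmx w)) (adj (dlsubmx w))
                           (adj (ursubmx w)) (adj (drsubmx w)).
  by rewrite -adj_block submxK.
by rewrite !(block_mxKul, block_mxKur, block_mxKdl, block_mxKdr) e1 e2 e3 e4.
Qed.

Lemma split_form_conj j m Q0 (c w : 'M_(m + m)) (g : 'M_((j + m) + (j + m))) :
    w \in unitmx -> split_form Q0 c g ->
  split_form Q0 (w *m c *m invmx w) (dsum j w *m g *m invmx (dsum j w)).
Proof.
move=> wu [Q21 [R11 [R12 [S11 [S12 [S21 gE]]]]]].
rewrite dsumV //; set w' := invmx w; rewrite gE /dsum.
rewrite !mulmx_block !(mul0mx, mulmx0, mul1mx, mulmx1, addr0, add0r) !add_block_mx.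
rewrite !(addr0, add0r).
rewrite !mulmx_block !(mul0mx, mulmx0, mul1mx, mulmx1, addr0, add0r) !add_block_mx.
rewrite !(addr0, add0r) /split_form.
have -> : w *m c *m w' =
    block_mx (ulsubmx w) (ursubmx w) (dlsubmx w) (drsubmx w) *m
    block_mx (ulsubmx c) (ursubmx c) (dlsubmx c) (drsubmx c) *m
    block_mx (ulsubmx w') (ursubmx w') (dlsubmx w') (drsubmx w').
  by rewrite !submxK.
rewrite !mulmx_block !(block_mxKul, block_mxKur, block_mxKdl, block_mxKdr).
by do 6!eexists.
Qed.

(* Not the spectrum of [g], but that of its compression to some Lagrangian
   subspace. *)
Definition spec n (g : 'M[K]_(n + n)) (s : seq K) : Prop :=
  exists2 u, unitary u &
    char_poly (ulsubmx (u *m g *m invmx u)) = \prod_(a <- s) ('X - a%:P).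

Lemma spec_conj n (g u : 'M[K]_(n + n)) s : unitary u ->
  spec (u *m g *m invmx u) s -> spec g s.
Proof.
move=> uu [v uv vs]; exists (v *m u); first exact: unitaryM.
rewrite -vs; congr (char_poly (ulsubmx _)).
have vu := unitary_unit uv; have uu' := unitary_unit uu.
have vuu : v *m u \in unitmx by rewrite unitmx_mul vu.
apply: (can_inj (mulmxK vuu)); rewrite mulmxKV //.
by rewrite !mulmxA mulmxKV // mulmxKV.
Qed.

(** Conjugation by [lower T] replaces the upper left block [P] by [P - Q T]. For [T] with the single
    block [- H] this is block triangular with diagonal blocks [Q0 H] and the block of [c]. *)
Lemma spec_split j m Q0 (c : 'M_(m + m)) (g : 'M_((j + m) + (j + m))) H s0 s :
    split_form Q0 c g -> skew H ->
    char_poly (Q0 *m H) = \prod_(a <- s0) ('X - a%:P) -> spec c s ->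
  spec g (s0 ++ s).
Proof.
move=> gsplit sH cH [w uw ws].
have wu := unitary_unit uw.
have := split_form_conj wu gsplit; set g' := (_ *m _ *m invmx _) => g'split.
apply: (spec_conj (unitary_dsum j uw)); rewrite -/g'.
pose T : 'M_(j + m) := block_mx (- H) 0 0 0.
have sT : skew T.
  rewrite /skew adj_block !adj0 adjN add_block_mx !addr0 -opprD sH oppr0.
  exact: block_mx0.
exists (lower T); first exact: unitary_lower.
have -> : invmx (lower T) = lower (- T).
  have lT : lower T *m lower (- T) = 1%:M.
    rewrite mulmx_block !(mul0mx, mulmx0, mul1mx, mulmx1, addr0, add0r) subrr.
    by rewrite -scalar_mx_block.
  have [Tu _] := mulmx1_unit lT.
  by rewrite -[RHS](mulKmx Tu) lT mulmx1.
case: g'split => [Q21 [R11 [R12 [S11 [S12 [S21 ->]]]]]].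
rewrite /lower !mulmx_block !(mul0mx, mulmx0, mul1mx, mulmx1, addr0, add0r) block_mxKul.
rewrite mulmxN /T mulmx_block !(mul0mx, mulmx0, addr0, add0r) !mulmxN.
rewrite opp_block_mx !opprK !oppr0 add_block_mx !(add0r, addr0).
by rewrite char_poly_lblock cH big_cat -ws.
Qed.

End Splitting.

(** * Conjugates with a prescribed block *)

Section Spectrum.
Variables (K : fieldType) (theta : {rmorphism K -> K}).
Hypothesis theta_inv : involutive theta.
Hypothesis theta_neq1 : exists a : K, theta a <> a.
Local Notation adj := (adj theta).
Local Notation unitary := (unitary theta).
Local Notation skew := (skew theta).
Local Notation levi := (levi theta).
Local Notation hypJ := (hypJ K).
Local Notation spec := (spec theta).

(** An isotropic [x] not orthogonal to [x g] forms a hyperbolic pair with a multiple of [x g]; in a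
    basis starting with this pair, [g] sends the first vector to a multiple of its partner. *)
Lemma exists_split1 m (g : 'M[K]_((1 + m) + (1 + m))) :
    unitary g -> ~~ is_scalar_mx g ->
  exists u (b : K) c, [/\ unitary u, b != 0, unitary c &
    split_form (b%:M : 'M_1) c (u *m g *m invmx u)].
Proof.
move=> ug /negP gs.
have [x xx xg] := exists_isotropic theta_inv theta_neq1 ug gs.
set R := (x *m _ *m _) in xg; pose r := R 0 0.
have RE : R = r%:M by exact: mx11_scalar.
have r0 : r != 0 by apply/eqP => r0; apply: xg; rewrite RE r0 raddf0.
have tr0 : theta r != 0 by rewrite fmorph_eq0.
pose f := (theta r)^-1 *: (x *m g).
have ff : f *m hypJ (1 + m) *m adj f = 0.
  rewrite /f adjZ -!scalemxAl -scalemxAr adjM !mulmxA -[x *m g *m _]mulmxA.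
  by rewrite -[x *m _ *m adj g]mulmxA ug xx !scaler0.
have xf : x *m hypJ (1 + m) *m adj f = 1%:M.
  rewrite /f adjZ -scalemxAr -/R RE fmorphV theta_inv -mul_scalar_mx.
  by rewrite -scalar_mxM mulVf.
have [u [uu ux uf]] := unitary_hyperbolic_rows theta_inv xx ff xf.
have uu' := unitary_unit uu.
have [g' g'E] : exists g' : 'M[K]_((1 + m) + (1 + m)), g' = u *m g *m invmx u by eexists.
have ug' : unitary g' by rewrite g'E; apply: unitaryM (unitaryV uu); exact: unitaryM.
have g'0 : row_mx (delta_mx 0 0) 0 *m g' = row_mx 0 (theta r *: delta_mx 0 0) :> 'rV_(m.+1 + m.+1).
  have -> : row_mx 0 (theta r *: delta_mx 0 0) = theta r *: row_mx 0 (delta_mx 0 0) :> 'rV[K]_(m.+1 + m.+1).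
    by rewrite scale_row_mx scaler0.
  rewrite g'E !mulmxA ux; apply: (can_inj (mulmxK uu')); rewrite mulmxKV //.
  by rewrite -scalemxAl uf /f scalerA divff // scale1r.
have rows : row_mx (delta_mx 0 0 *m ulsubmx g') (delta_mx 0 0 *m ursubmx g')
    = row_mx 0 (theta r *: delta_mx 0 0) :> 'rV_(m.+1 + m.+1).
  rewrite -g'0 -[g' in RHS](@submxK _ m.+1 m.+1 m.+1 m.+1) mul_row_block.
  by rewrite !mul0mx !addr0.
have [P0 Q0] := eq_row_mx rows.
have Pu : usubmx (ulsubmx g') = 0.
  apply/matrixP => i j; have /rowP/(_ j) := P0; rewrite -rowE !mxE => <-.
  by rewrite ord1; congr (g' _ _); apply: val_inj.
have QE (i : 'I_(1 + m)) : (ursubmx g') 0 i = theta r *+ (i == 0).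
  have /rowP/(_ i) := Q0; rewrite -rowE [LHS]mxE => ->.
  by rewrite !mxE mulr_natr.
have Qr : ursubmx (ursubmx g') = 0.
  apply/matrixP => i j; rewrite mxE [LHS]mxE ord1 [RHS]mxE.
  have -> : lshift m 0 = 0 :> 'I_(1 + m) by apply: val_inj.
  by rewrite QE.
have [c gc [_ uc]] := unitary_split_form theta_inv ug' Pu Qr.
exists u, (theta r), c; split=> //; rewrite -g'E.
rewrite [ulsubmx _]mx11_scalar in gc.
have E : (ulsubmx (ursubmx g')) 0 0 = theta r.
  rewrite [LHS]mxE [LHS]mxE; have -> : lshift m 0 = 0 :> 'I_(1 + m) by apply: val_inj.
  by rewrite QE eqxx.
by rewrite E in gc.
Qed.

Lemma split_form_rows j m (Q0 : 'M[K]_j) (c : 'M_(m + m)) g : split_form Q0 c g ->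
  [/\ usubmx (ulsubmx g) = 0, usubmx (ursubmx g) = row_mx Q0 0,
      drsubmx (ulsubmx g) = ulsubmx c, drsubmx (ursubmx g) = ursubmx c
    & dlsubmx (ulsubmx g) = 0].
Proof.
case=> [Q21 [R11 [R12 [S11 [S12 [S21 ->]]]]]].
rewrite !(block_mxKul, block_mxKur) !(block_mxKdr, block_mxKdl).
by rewrite !col_mxKu row_mx0.
Qed.

(** Two successive splittings of size 1 merge into one of size 2; the lower left entry of [Q0]
    remains arbitrary. *)
Lemma split_form2 m (g : 'M_((1 + (1 + m)) + (1 + (1 + m)))) (b1 b2 : K) c c2 :
    unitary g -> split_form (b1%:M : 'M_1) c g -> split_form (b2%:M : 'M_1) c2 c ->
  exists (Q0 : 'M_2) (c' : 'M_(m + m)),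
    [/\ @split_form _ 2 m Q0 c' g, Q0 0 1 = 0, Q0 \in unitmx & unitary c'].
Proof.
move=> ug /split_form_rows[gP gQ cP cQ gPl] /split_form_rows[cP0 cQ0 _ _ _].
have P0 (k : 'I_(1 + (1 + m))) : (ulsubmx g) 0 k = 0.
  have H : usubmx (ulsubmx g) 0 k = 0 by rewrite gP mxE.
  by rewrite mxE in H; rewrite -[RHS]H; congr (ulsubmx g _ _); apply: val_inj.
have Q0k (k : 'I_(1 + m)) : (ursubmx g) 0 (rshift 1 k) = 0.
  have H : usubmx (ursubmx g) 0 (rshift 1 k) = 0 by rewrite gQ row_mxEr mxE.
  by rewrite mxE in H; rewrite -[RHS]H; congr (ursubmx g _ _); apply: val_inj.
pose i1 : 'I_(1 + (1 + m)) := rshift 1 (lshift m 0).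
have P1 (k : 'I_(1 + (1 + m))) : (ulsubmx g) i1 k = 0.
  case: (splitP k) => [k' kk'|k' kk'].
    have H : dlsubmx (ulsubmx g) (lshift m 0) k' = 0 by rewrite gPl mxE.
    rewrite mxE [LHS]mxE in H; rewrite -[RHS]H.
    by congr (ulsubmx g _ _); apply: val_inj.
  have H : drsubmx (ulsubmx g) (lshift m 0) k' = 0.
    have H : usubmx (ulsubmx c) 0 k' = 0 by rewrite cP0 mxE.
    by rewrite cP -[RHS]H [RHS]mxE.
  rewrite mxE [LHS]mxE in H; rewrite -[RHS]H.
  by congr (ulsubmx g _ _); apply: val_inj.
have Q1k (k : 'I_m) : (ursubmx g) i1 (rshift 1 (rshift 1 k)) = 0.
  have H : drsubmx (ursubmx g) (lshift m 0) (rshift 1 k) = 0.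
    have H : usubmx (ursubmx c) 0 (rshift 1 k) = 0 by rewrite cQ0 row_mxEr mxE.
    by rewrite cQ -[RHS]H [RHS]mxE.
  by rewrite mxE [LHS]mxE in H; rewrite -[RHS]H.
pose g2 : 'M_((2 + m) + (2 + m)) := g.
have ordE (i : 'I_2) : lshift m i = 0 :> 'I_(1 + (1 + m)) \/ lshift m i = i1 :> 'I_(1 + (1 + m)).
  by case: i => [[|[|//]]] lti; [left | right]; apply: val_inj.
have Pu : @usubmx _ 2 m (2 + m) (ulsubmx g2) = 0.
  apply/matrixP => i k; rewrite mxE [RHS]mxE.
  by case: (ordE i) => ->; [exact: P0 | exact: P1].
have Qr : @ursubmx _ 2 m 2 m (ursubmx g2) = 0.
  apply/matrixP => i k; rewrite mxE [LHS]mxE [RHS]mxE.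
  have -> : rshift 2 k = rshift 1 (rshift 1 k) :> 'I_(1 + (1 + m)) by apply: val_inj.
  by case: (ordE i) => ->; [exact: Q0k | exact: Q1k].
have [c' gc' [Qu uc']] := @unitary_split_form _ _ theta_inv 2 m g2 ug Pu Qr.
exists (ulsubmx (ursubmx g2)), c'; split=> //.
rewrite [LHS]mxE [LHS]mxE.
have -> : lshift m (1 : 'I_2) = rshift 1 0 :> 'I_(1 + (1 + m)) by apply: val_inj.
have -> : lshift m (0 : 'I_2) = 0 :> 'I_(1 + (1 + m)) by apply: val_inj.
exact: Q0k.
Qed.

(** The determinant of a skew matrix of size 2 lies in the fixed field; here it can be prescribed.
    Distinct eigenvalues create a simple one when the rest of the sequence is constant; avoiding [c]
    keeps [c] simple if it already is. *)
Definition two_block : Prop := forall (Q0 : 'M[K]_2) (eta : K),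
    Q0 0 1 = 0 -> Q0 \in unitmx -> eta != 0 -> theta eta = eta ->
  (exists H p q, [/\ skew H, \det H = eta, p != q &
     char_poly (Q0 *m H) = ('X - p%:P) * ('X - q%:P)]) /\
  forall c, exists H p q, [/\ skew H, \det H = eta, (p != c) && (q != c) &
     char_poly (Q0 *m H) = ('X - p%:P) * ('X - q%:P)].

Hypothesis two_blockP : two_block.

Definition simple_seq (s : seq K) := exists c, count_mem c s = 1%N.

Lemma char_poly_prod_det n (M : 'M[K]_n) s :
  char_poly M = \prod_(a <- s) ('X - a%:P) -> \det M = \prod_(a <- s) a.
Proof.
move=> cM; have sz : size s = n.
  have := size_char_poly M; rewrite cM size_prod_XsubC => -[] //.
have := char_poly_det M; rewrite cM -horner_coef0 horner_prod.
under eq_bigr do rewrite hornerXsubC sub0r -mulN1r.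
rewrite big_split /= big_const_seq iter_mulr_1 count_predT sz.
by move=> /(mulfI (negbT (signr_eq0 _ _))).
Qed.

(** The parameter [eta] is the determinant of [H], so it scales the product of the eigenvalues
    freely over the fixed field. *)
Lemma spec_two_block m (g : 'M_((2 + m) + (2 + m))) Q0 (c : 'M_(m + m)) s3 :
    split_form Q0 c g -> Q0 0 1 = 0 -> Q0 \in unitmx ->
    spec c s3 -> 0 \notin s3 -> simple_seq s3 \/ (exists l, s3 = nseq m l) ->
  exists2 p0, p0 != 0 & forall eta, eta != 0 -> theta eta = eta ->
    exists s, [/\ spec g s, 0 \notin s, simple_seq s & \prod_(a <- s) a = p0 * eta].
Proof.
move=> gc Q01 Q0u cs s30 s3P.
exists (\det Q0 * \prod_(a <- s3) a).
  rewrite mulf_neq0 // -?unitfE -?unitmxE // unitfE prodf_seq_neq0.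
  by apply/allP => a /=; apply: contraTneq => ->.
move=> eta eta0 teta; have [dist avoid] := two_blockP Q01 Q0u eta0 teta.
have finish H p q : skew H -> \det H = eta ->
    char_poly (Q0 *m H) = ('X - p%:P) * ('X - q%:P) -> simple_seq ([:: p; q] ++ s3) ->
    exists s, [/\ spec g s, 0 \notin s, simple_seq s
                & \prod_(a <- s) a = \det Q0 * \prod_(a <- s3) a * eta].
  move=> sH dH; have -> : ('X - p%:P) * ('X - q%:P) = \prod_(a <- [:: p; q]) ('X - a%:P).
    by rewrite !big_cons big_nil mulr1.
  move=> cH simp; exists ([:: p; q] ++ s3).
  have pq : \det Q0 * eta = p * q.
    by rewrite -dH -det_mulmx (char_poly_prod_det cH) !big_cons big_nil mulr1.
  split=> //.
  - exact: (spec_split theta_inv gc sH cH cs).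
  - have : p * q != 0 by rewrite -pq mulf_neq0 // -unitfE -unitmxE.
    rewrite mulf_eq0 negb_or => /andP[p0 q0].
    by rewrite mem_cat !inE negb_or s30 andbT !(eq_sym 0) negb_or p0.
  by rewrite big_cat /= !big_cons big_nil mulr1 -pq mulrAC.
case: s3P => [[x cx]|[l s3E]].
  have [H [p [q [sH dH /andP[px qx] cH]]]] := avoid x.
  apply: (finish H p q) => //; exists x.
  by rewrite count_cat /= (negPf px) (negPf qx) cx.
have [H [p [q [sH dH pq cH]]]] := dist.
apply: (finish H p q) => //; rewrite s3E.
(* As [p] and [q] differ, one of them is not [l], and that one is simple. *)
have [pl|pl] := eqVneq p l; [exists q | exists p]; rewrite count_cat /= count_nseq /=.
  by rewrite (negPf pq) eqxx -pl (negPf pq).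
by rewrite eqxx eq_sym (negPf pq) eq_sym (negPf pl).
Qed.

Lemma spec_scalar n (l : K) : spec (l%:M : 'M_(n + n)) (nseq n l).
Proof.
exists 1%:M; first exact: unitary1.
rewrite mul1mx invmx1 mulmx1 (scalar_mx_block n n) block_mxKul.
rewrite char_poly_trig ?scalar_mx_is_trig // big_nseq.
under eq_bigr do rewrite mxE eqxx.
by rewrite prodr_const cardT size_enum_ord iter_mulr_1.
Qed.

Lemma spec_split1_scalar m (b : K) l (g : 'M_((1 + m) + (1 + m))) h :
    split_form (b%:M : 'M_1) (l%:M : 'M_(m + m)) g -> h + theta h = 0 ->
  spec g (b * h :: nseq m l).
Proof.
move=> gc hs; rewrite -cat1s.
have sH : skew (h%:M : 'M_1) by rewrite /skew adj_scalar -raddfD /= hs raddf0.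
apply: (spec_split theta_inv gc sH) (spec_scalar _ _).
by rewrite -scalar_mxM char_poly1 big_seq1.
Qed.

Lemma unitary_scalar n (l : K) : unitary (l%:M : 'M_(n.+1 + n.+1)) -> l * theta l = 1.
Proof.
rewrite /unitary adj_scalar mul_scalar_mx -scalemxAl mul_mx_scalar scalerA.
move/matrixP/(_ (lshift _ 0) (rshift _ 0)).
by rewrite mxE !block_mxEur !mxE eqxx mulr1.
Qed.

Lemma nseq_simple_or_const m (x l : K) : x != 0 -> unitary (l%:M : 'M_(m + m)) ->
  0 \notin x :: nseq m l /\ (simple_seq (x :: nseq m l) \/ x :: nseq m l = nseq m.+1 l).
Proof.
move=> x0 ul; split.
  rewrite inE negb_or eq_sym x0 mem_nseq; case: m ul => //= m /unitary_scalar ll.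
  by apply: contraTneq isT => l0; move/eqP: ll; rewrite -l0 mul0r eq_sym oner_eq0.
have [->|xl] := eqVneq x l; [by right | left; exists x].
by rewrite /= eqxx count_nseq /= eq_sym (negPf xl).
Qed.

Lemma split_form_twice m (g : 'M_((1 + m) + (1 + m))) (b : K) c :
    unitary g -> unitary c -> ~~ is_scalar_mx c -> split_form (b%:M : 'M_1) c g ->
  exists m' u (Q0 : 'M_2) (c' : 'M_(m' + m')) (e : (1 + m = 2 + m')%N),
    [/\ unitary u, Q0 0 1 = 0, Q0 \in unitmx, unitary c' &
      split_form Q0 c' (castmx (congr2 addn e e, congr2 addn e e) (u *m g *m invmx u))].
Proof.
move=> ug uc; case: m g c ug uc => [|m] g c ug uc cs gc.
  by case/negP: cs; apply/is_scalar_mxP; exists 0; apply/matrixP => -[].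
have [u [b2 [c2 [uu _ _ cc2]]]] := exists_split1 uc cs.
have uD := unitary_dsum 1 uu.
have gD := split_form_conj (unitary_unit uu) gc.
have ugD : unitary (dsum 1 u *m g *m invmx (dsum 1 u)).
  by apply: unitaryM (unitaryV uD); exact: unitaryM.
have [Q0 [c' [gQ Q01 Q0u uc']]] := split_form2 ugD gD cc2.
exists m, (dsum 1 u), Q0, c', erefl; split=> //.
by rewrite castmx_id.
Qed.

(** Strong induction, two dimensions at a time. It stops when [g] or what remains after one
    splitting is scalar, where a constant sequence may be unavoidable. *)
Lemma spec_simple_or_const n (g : 'M_(n + n)) : unitary g ->
  exists s, [/\ spec g s, 0 \notin s & simple_seq s \/ (exists l, s = nseq n l)].
Proof.
have [k] := ubnP n; elim: k n g => // k IHk [|m] g lt_mk ug.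
  exists [::]; split=> //; last by right; exists 0.
  have -> : g = (0 : K)%:M by apply/matrixP => -[].
  exact: (spec_scalar 0).
have [/is_scalar_mxP[l gl]|gs] := boolP (is_scalar_mx g).
  exists (nseq m.+1 l); split; [by rewrite gl; exact: spec_scalar| |by right; exists l].
  rewrite mem_nseq /= eq_sym; apply: contraTneq isT => l0.
  have : l * theta l = 1 by apply: (@unitary_scalar m); rewrite -gl.
  by move/eqP; rewrite l0 mul0r eq_sym oner_eq0.
have [u [b [c [uu b0 uc gc]]]] := exists_split1 ug gs.
have [/is_scalar_mxP[l cl]|cs] := boolP (is_scalar_mx c).
  have [e e0 es] := exists_skew_elt theta_inv theta_neq1.
  rewrite cl in uc gc; have [z0 sP] := nseq_simple_or_const (mulf_neq0 b0 e0) uc.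
  exists (b * e :: nseq m l); split=> //.
    by apply: (spec_conj uu); exact: (@spec_split1_scalar m).
  by case: sP => [|sE]; [left | right; exists l].
have ug1 : unitary (u *m g *m invmx u) by apply: unitaryM (unitaryV uu); exact: unitaryM.
have [m' [v [Q0 [c' [e [uv Q01 Q0u uc']]]]]] := split_form_twice ug1 uc cs gc.
have mE : m = m'.+1 := succn_inj e.
subst m; rewrite castmx_id => gQ.
have [s3 [cs3 s30 s3P]] := IHk m' c' (ltn_trans (ltnSn _) lt_mk) uc'.
have [p0 p00 /(_ 1 (oner_neq0 _) (rmorph1 _))[s [gs' s0 ss _]]] :=
  spec_two_block gQ Q01 Q0u cs3 s30 s3P.
by exists s; split; [exact: (spec_conj uu (spec_conj uv gs'))| |left].
Qed.

(** The product is the determinant of an upper left block [P], and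
    [1 = \det g = \det P / theta (\det P)]. *)
Lemma spec_prod_fixed n (g : 'M_(n + n)) s : unitary g -> \det g = 1 ->
  spec g s -> 0 \notin s -> theta (\prod_(a <- s) a) = \prod_(a <- s) a.
Proof.
move=> ug dg [u uu /char_poly_prod_det us] s0.
have us0 : \prod_(a <- s) a != 0.
  by rewrite prodf_seq_neq0; apply/allP => a /=; apply: contraTneq => ->.
set g' := _ *m _ *m _ in us; have ug' : unitary g'.
  by apply: unitaryM (unitaryV uu); exact: unitaryM.
have Pu : ulsubmx g' \in unitmx by rewrite unitmxE unitfE us.
have dg' : \det g' = 1.
  rewrite !det_mulmx dg mulr1 det_inv divff // -unitfE -unitmxE; exact: unitary_unit uu.
rewrite -[g']submxK in ug' dg'; have := det_unitary_ulsubmx theta_inv Pu ug'.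
rewrite dg' us => /(canLR (divfK _)); rewrite mul1r; apply.
by rewrite fmorph_eq0.
Qed.

(** Conjugation by [lower T], where [T] has corner [- l / b] and first row completed by [tau], turns
    the corner of the block into [l]. If [Q21] is nonzero it supplies the rank one part and
    [tau = 0] works; otherwise a nonzero [tau] creates it. *)
Lemma exists_transvection m (g : 'M_((1 + m.+1) + (1 + m.+1))) (b l : K) :
    b != 0 -> l != 0 -> split_form (b%:M : 'M_1) (l%:M : 'M_(m.+1 + m.+1)) g ->
    l / b + theta (l / b) = 0 ->
  exists u v w, [/\ unitary u, ulsubmx (u *m g *m invmx u) = l%:M + v *m w,
                     w *m v = 0 :> 'M_1, v != 0 & w != 0].
Proof.
move=> b0 l0 [Q21 [R11 [R12 [S11 [S12 [S21 gE]]]]]] lb.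
have conjE (tau : 'rV_m.+1) : exists2 u, unitary u &
    ulsubmx (u *m g *m invmx u) = block_mx (l%:M : 'M_1) (- (b *: tau))
      ((l / b) *: Q21) (l%:M - Q21 *m tau).
  pose T : 'M_(1 + m.+1) := block_mx (- (l / b))%:M tau (- adj tau) 0.
  have sT : skew T.
    rewrite /skew /T adj_block adj0 adjN adjK // adj_scalar add_block_mx.
    by rewrite subrr addNr addr0 -raddfD rmorphN /= -opprD lb oppr0 raddf0 block_mx0.
  exists (lower T); first exact: unitary_lower.
  have -> : invmx (lower T) = lower (- T).
    have lT : lower T *m lower (- T) = 1%:M.
      rewrite mulmx_block !(mul0mx, mulmx0, mul1mx, mulmx1, addr0, add0r) subrr.
      by rewrite -scalar_mx_block.
    have [Tu _] := mulmx1_unit lT.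
    by rewrite -[RHS](mulKmx Tu) lT mulmx1.
  rewrite gE (scalar_mx_block m.+1 m.+1) !(block_mxKul, block_mxKur, block_mxKdl, block_mxKdr).
  rewrite /lower !mulmx_block !(mul0mx, mulmx0, mul1mx, mulmx1, addr0, add0r) block_mxKul.
  rewrite mulmxN /T mulmx_block !(mul0mx, mulmx0, addr0, add0r) opp_block_mx add_block_mx.
  rewrite !add0r -scalar_mxM mul_scalar_mx mul_mx_scalar mulrN raddfN opprK mulrC divfK //.
  by rewrite ?mulNmx ?scaleNr ?opprK.
have [Q0|Q0] := eqVneq Q21 0; last first.
  have [u uu uE] := conjE 0; exists u, (col_mx 0 ((l / b) *: Q21)), (row_mx 1%:M 0).
  split=> //.
  - rewrite uE mulmx0 subr0 scaler0 oppr0 (scalar_mx_block 1 m.+1) mul_col_row add_block_mx.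
    by rewrite !(mulmx0, mulmx1, addr0, add0r).
  - by rewrite mul_row_col mul0mx mulmx0 addr0.
  - rewrite col_mx_eq0 negb_and scaler_eq0 negb_or Q0 mulf_neq0 ?invr_eq0 ?orbT //.
  by rewrite row_mx_eq0 negb_and; apply/orP; left; apply/eqP => /matrixP/(_ 0 0)/eqP; rewrite !mxE oner_eq0.
have [u uu uE] := conjE (delta_mx 0 0).
exists u, (col_mx 1%:M 0), (row_mx 0 (- (b *: delta_mx 0 0))); split=> //.
- rewrite uE Q0 mul0mx subr0 scaler0 (scalar_mx_block 1 m.+1) mul_col_row add_block_mx.
  by rewrite !(mul0mx, mul1mx, addr0, add0r).
- by rewrite mul_row_col mul0mx mulmx0 addr0.
- by rewrite col_mx_eq0 negb_and; apply/orP; left; apply/eqP => /matrixP/(_ 0 0)/eqP; rewrite !mxE oner_eq0.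
rewrite row_mx_eq0 negb_and oppr_eq0 scaler_eq0 negb_or b0 orbC /=.
by apply/orP; left; apply/eqP => /matrixP/(_ 0 0)/eqP; rewrite !mxE oner_eq0.
Qed.

(** If the remainder after one splitting is a scalar [l], the first eigenvalue [x] must be
    [d / l^(n-1)]. It is simple unless [x = l], the exceptional case with [l^n = d]. A nonscalar
    remainder is split again, and the parameter [eta] gives the product [d]. *)
Theorem spec_target n (g : 'M_(n + n)) (d : K) : (1 < n)%N -> unitary g ->
    \det g = 1 -> ~~ is_scalar_mx g -> d != 0 -> theta d = d ->
  (exists s, [/\ spec g s, simple_seq s & \prod_(a <- s) a = d]) \/
  (exists u l v w, [/\ unitary u, ulsubmx (u *m g *m invmx u) = l%:M + v *m w,
      w *m v = 0 :> 'M_1, v != 0 & w != 0] /\ l * theta l = 1 /\ l ^+ n = d).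
Proof.
case: n g => [|[|m]] // g _ ug dg gs d0 td.
have [u [b [c [uu b0 uc gc]]]] := exists_split1 ug gs.
have ug1 : unitary (u *m g *m invmx u) by apply: unitaryM (unitaryV uu); exact: unitaryM.
have [/is_scalar_mxP[l cl]|cs] := boolP (is_scalar_mx c).
  have [e e0 es] := exists_skew_elt theta_inv theta_neq1.
  rewrite cl in uc gc; have [z0 _] := nseq_simple_or_const (mulf_neq0 b0 e0) uc.
  have ll : l * theta l = 1 := unitary_scalar uc.
  have l0 : l != 0 by apply: contra_eq_neq ll => ->; rewrite mul0r eq_sym oner_neq0.
  have spec1 h : h + theta h = 0 -> spec g (b * h :: nseq m.+1 l).
    by move=> hs; apply: (spec_conj uu); exact: (@spec_split1_scalar m.+1).
  have := spec_prod_fixed ug dg (spec1 _ es) z0.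
  rewrite big_cons big_nseq iter_mulr_1 => fixed.
  pose x := d / l ^+ m.+1; have lm0 : l ^+ m.+1 != 0 by rewrite expf_neq0.
  have x0 : x != 0 by rewrite mulf_neq0 ?invr_eq0.
  (* By [spec_prod_fixed] the product [b e l^(m+1)] is fixed, so [x / b] is the skew [e] times a
     fixed element. *)
  have xs : x / b + theta (x / b) = 0.
    have xE : x / b = e * (d / (b * e * l ^+ m.+1)).
      rewrite /x; move: (l ^+ m.+1) lm0 => L L0; field.
      by rewrite e0 b0 L0.
    rewrite xE rmorphM fmorph_div td fixed -mulrDl es mul0r //.
  have bxb : b * (x / b) = x by rewrite mulrC divfK.
  have specx : spec g (x :: nseq m.+1 l) by rewrite -[x in x :: _]bxb; exact: spec1.
  have [_ [sx|sx]] := nseq_simple_or_const x0 uc.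
    by left; exists (x :: nseq m.+1 l); split=> //; rewrite big_cons big_nseq iter_mulr_1 /x divfK.
  have xl : x = l by case: sx.
  rewrite xl in xs; right.
  have [v [y [w [uv vE wy y0 w0]]]] := exists_transvection b0 l0 gc xs.
  exists (v *m u), l, y, w; split; last first.
    by split=> //; rewrite exprS -{1}xl /x divfK.
  split=> //; first exact: unitaryM.
  rewrite -vE; congr ulsubmx; have vu := unitary_unit uv; have uu' := unitary_unit uu.
  have vuu : v *m u \in unitmx by rewrite unitmx_mul vu.
  apply: (can_inj (mulmxK vuu)); rewrite mulmxKV //.
  by rewrite !mulmxA mulmxKV // mulmxKV.
left.
have [m' [v [Q0 [c' [e [uv Q01 Q0u uc']]]]]] := split_form_twice ug1 uc cs gc.
have mE : m = m' := succn_inj (succn_inj e).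
subst m'; rewrite castmx_id => gQ.
have [s3 [cs3 s30 s3P]] := spec_simple_or_const uc'.
have [p0 p00 spec2] := spec_two_block gQ Q01 Q0u cs3 s30 s3P.
(* The value [eta = 1] serves only to show that [p0] is fixed, which makes [eta = d / p0]
   admissible. *)
have [s1 [gs1 s10 _ p1]] := spec2 1 (oner_neq0 _) (rmorph1 _).
have := spec_prod_fixed ug dg (spec_conj uu (spec_conj uv gs1)) s10.
rewrite p1 mulr1 => tp0.
have [||s [gs2 s20 ss ps]] := spec2 (d / p0).
- by rewrite mulf_neq0 ?invr_eq0.
- by rewrite fmorph_div td tp0.
exists s; split=> //; first exact: (spec_conj uu (spec_conj uv gs2)).
by rewrite ps mulrC divfK.
Qed.

End Spectrum.

(** * The two by two step *)

Section TwoBlock.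
Variables (K : fieldType) (theta : {rmorphism K -> K}).
Hypothesis theta_inv : involutive theta.
Hypothesis theta_neq1 : exists a : K, theta a <> a.

(* [g1], [g2], [t] are the entries of a lower triangular matrix and [a], [e],
   [b] those of a hermitian matrix of determinant [eta]; [p] and [q] are the
   eigenvalues of the product *)
Definition block_data (g1 g2 t eta p q : K) : Prop := exists a e b,
  [/\ theta a = a, theta e = e, a * e - b * theta b = eta,
      p + q = g1 * a + t * b + g2 * e & p * q = g1 * g2 * eta].

Definition scalar_block : Prop := forall g1 g2 t eta : K,
    g1 != 0 -> g2 != 0 -> eta != 0 -> theta eta = eta ->
  (exists p q, p != q /\ block_data g1 g2 t eta p q) /\
  forall c, exists p q, [/\ p != c, q != c & block_data g1 g2 t eta p q].

Lemma det_mx22 (M : 'M[K]_2) : \det M = M 0 0 * M 1 1 - M 0 1 * M 1 0.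
Proof.
rewrite (expand_det_row _ 0) !big_ord_recl big_ord0 addr0 /cofactor !det_mx11 !mxE /=.
have -> : lift 0 0 = 1 :> 'I_2 by apply: val_inj.
have -> : lift 1 0 = 0 :> 'I_2 by apply: val_inj.
by rewrite /= expr0 mul1r expr1 mulN1r mulrN.
Qed.

Lemma char_poly_mx22 (M : 'M[K]_2) p q : p + q = M 0 0 + M 1 1 -> p * q = \det M ->
  char_poly M = ('X - p%:P) * ('X - q%:P).
Proof.
have det22 (N : 'M[{poly K}]_2) : \det N = N 0 0 * N 1 1 - N 0 1 * N 1 0.
  rewrite (expand_det_row _ 0) !big_ord_recl big_ord0 addr0 /cofactor !det_mx11 !mxE /=.
  have -> : lift 0 0 = 1 :> 'I_2 by apply: val_inj.
  have -> : lift 1 0 = 0 :> 'I_2 by apply: val_inj.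
  by rewrite /= expr0 mul1r expr1 mulN1r mulrN.
move=> pq pqd; rewrite /char_poly det22 !mxE /= !mulr1n !mulr0n !sub0r.
have pqE : p%:P + q%:P = (M 0 0)%:P + (M 1 1)%:P :> {poly K} by rewrite -!polyCD pq.
have pqdE : p%:P * q%:P = (M 0 0)%:P * (M 1 1)%:P - (M 0 1)%:P * (M 1 0)%:P :> {poly K}.
  by rewrite -!polyCM -polyCB pqd det_mx22.
transitivity ('X * 'X - (p%:P + q%:P) * 'X + p%:P * q%:P : {poly K}); last by ring.
by rewrite pqE pqdE; ring.
Qed.

(** A skew matrix is [e] times a hermitian one for a skew scalar [e]; then [Q0 H] is [e Q0] times
    that hermitian matrix, and determinants change by the fixed element [e * e]. *)
Lemma scalar_block_two_block : scalar_block -> two_block theta.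
Proof.
move=> sb Q0 eta Q01 Q0u eta0 teta.
have [e e0 es] := exists_skew_elt theta_inv theta_neq1.
have te : theta e = - e by apply/eqP; rewrite -addr_eq0 addrC es.
have dQ : \det Q0 = Q0 0 0 * Q0 1 1 by rewrite det_mx22 Q01 mul0r subr0.
have : Q0 0 0 * Q0 1 1 != 0 by rewrite -dQ -unitfE -unitmxE.
rewrite mulf_eq0 negb_or => /andP[g1 g2].
have ee0 : e * e != 0 by rewrite mulf_neq0.
have eta'0 : eta / (e * e) != 0 by rewrite mulf_neq0 ?invr_eq0.
have teta' : theta (eta / (e * e)) = eta / (e * e).
  by rewrite fmorph_div rmorphM te mulrNN teta.
have main p q : block_data (e * Q0 0 0) (e * Q0 1 1) (e * Q0 1 0) (eta / (e * e)) p q ->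
    exists H, [/\ skew theta H, \det H = eta
      & char_poly (Q0 *m H) = ('X - p%:P) * ('X - q%:P)].
  move=> [a [f [b [ta tf abf pq pqd]]]].
  pose H : 'M[K]_2 := \matrix_(i, j) (e * if i == 0 then if j == 0 then a else b
     else if j == 0 then theta b else f).
  have H00 : H 0 0 = e * a by rewrite mxE.
  have H01 : H 0 1 = e * b by rewrite mxE.
  have H10 : H 1 0 = e * theta b by rewrite mxE.
  have H11 : H 1 1 = e * f by rewrite mxE.
  have dH : \det H = eta.
    rewrite det_mx22 H00 H01 H10 H11 -[RHS](divfK ee0) -abf; ring.
  exists H; split=> //.
    have ord2 (i : 'I_2) : i = 0 \/ i = 1.
      by case: i => [[|[|//]]] lti; [left | right]; apply: val_inj.
    apply/matrixP => i j; rewrite [LHS]mxE [RHS]mxE adjE.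
    case: (ord2 i) => ->; case: (ord2 j) => ->; rewrite ?H00 ?H01 ?H10 ?H11;
      by rewrite rmorphM te ?ta ?tf ?theta_inv mulNr subrr.
  apply: char_poly_mx22.
    rewrite pq !mxE !big_ord_recl !big_ord0 !addr0.
    have -> : lift ord0 0 = 1 :> 'I_2 by apply: val_inj.
    by rewrite Q01 H00 H01 H10 H11; ring.
  by rewrite det_mulmx dH dQ pqd; field.
have [[p [q [pq /main[H [sH dH cH]]]]] avoid] :=
  sb _ _ (e * Q0 1 0) _ (mulf_neq0 e0 g1) (mulf_neq0 e0 g2) eta'0 teta'.
split; first by exists H, p, q.
move=> c; have [p' [q' [p'c q'c /main[H' [sH' dH' cH']]]]] := avoid c.
by exists H', p', q'; split; rewrite ?p'c.
Qed.

(** Diagonal hermitian matrices with entries [a] and [eta / a] suffice. Each of the two eigenvalues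
    equals [c] for at most one [a], so one of the distinct values 1, [x], [x^-1] avoids [c]. *)
Lemma scalar_block_large (x : K) : theta x = x -> x != 0 -> x != 1 -> x != -1 ->
  scalar_block.
Proof.
move=> tx x0 x1 xN1 g1 g2 t eta g10 g20 eta0 teta.
have xx1 : x * x != 1.
  by rewrite -subr_eq0 (_ : _ - _ = (x - 1) * (x + 1)) ?mulf_neq0 ?subr_eq0 ?addr_eq0 //; ring.
have diag a : theta a = a -> a != 0 -> block_data g1 g2 t eta (g1 * a) (g2 * (eta / a)).
  move=> ta a0; exists a, (eta / a), 0; split=> //.
  - by rewrite fmorph_div teta ta.
  - by rewrite mul0r subr0 mulrC divfK.
  - by rewrite mulr0 addr0.
  by field.
split.
  have [g|g] := eqVneq g1 (g2 * eta); last first.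
    exists (g1 * 1), (g2 * (eta / 1)); split; last exact: diag (rmorph1 _) (oner_neq0 _).
    by rewrite mulr1 divr1.
  exists (g1 * x), (g2 * (eta / x)); split; last exact: diag.
  apply: contra xx1; rewrite mulrA -g => /eqP/(congr1 ( *%R^~ x)).
  by rewrite divfK // -mulrA -[RHS]mulr1 => /(mulfI g10)/eqP.
move=> c; pose ok a := (g1 * a != c) && (g2 * (eta / a) != c).
suff [a [ta a0 /andP[pc qc]]] : exists a, [/\ theta a = a, a != 0 & ok a].
  by exists (g1 * a), (g2 * (eta / a)); split=> //; exact: diag.
have [ok1|nok1] := boolP (ok 1); first by exists 1; rewrite rmorph1 oner_eq0.
have [okx|nokx] := boolP (ok x); first by exists x.
have [okv|nokv] := boolP (ok x^-1); first by exists x^-1; rewrite fmorphV tx invr_eq0.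
have geta : g2 * eta != 0 by rewrite mulf_neq0.
have xv : x != x^-1.
  by apply: contra xx1 => /eqP xv; rewrite {1}xv mulVf.
have v1 : x^-1 != 1 by rewrite invr_eq1.
have inj1 a b : a != b -> g1 * a = c -> g1 * b = c -> False.
  by move=> /eqP ab <- /(mulfI g10) /esym.
have inj2 a b : a != b -> g2 * (eta / a) = c -> g2 * (eta / b) = c -> False.
  by move=> /eqP ab <-; rewrite !mulrA => /(mulfI geta)/invr_inj/esym.
have x1' : 1 != x by rewrite eq_sym.
have v1' : 1 != x^-1 by rewrite eq_sym.
move: nok1 nokx nokv; rewrite /ok !negb_and !negbK.
by do 3![case/orP => /eqP ?]; exfalso; eauto.
Qed.

(** The field with four elements and its Frobenius automorphism. Likewise [is_F9] describes the
    field with nine elements, where [e] is a square root of -1 and [ternary] the prime field. *)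
Definition is_F4 (w : K) : Prop :=
  [/\ 1 + 1 = 0 :> K, w * w = w + 1, theta w = w + 1 &
      forall x : K, [\/ x = 0, x = 1, x = w | x = w + 1]].

Definition ternary (u : K) : Prop := [\/ u = 0, u = 1 | u = -1].

Definition is_F9 (e : K) : Prop :=
  [/\ 1 + 1 + 1 = 0 :> K, e * e = -1, theta e = - e &
      forall x : K, exists u v, [/\ ternary u, ternary v & x = u + v * e]].

(** Traces and norms are fixed, so few values remain. In characteristic 2 an element moved by
    [theta] has trace and norm 1. Otherwise 3 = 0, and a skew [e] has square -1, because square 1
    would make [e] fixed. *)
Lemma small_field : (forall a : K, theta a = a -> ternary a) ->
  (exists w, is_F4 w) \/ (exists e, is_F9 e).
Proof.
move=> small; have t2 : theta (1 + 1) = 1 + 1 by rewrite rmorphD rmorph1.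
have fixN x : theta (x * theta x) = x * theta x by rewrite rmorphM theta_inv mulrC.
have fixT x : theta (x + theta x) = x + theta x by rewrite rmorphD theta_inv addrC.
have [c2|c2] := eqVneq (1 + 1 : K) 0.
  left; have addxx x : x + x = 0 :> K by rewrite -[x]mul1r -mulrDl c2 mul0r.
  have oppE x : - x = x :> K by apply/eqP; rewrite eq_sym -addr_eq0 addxx.
  have bin a : theta a = a -> a = 0 \/ a = 1.
    by case/small => ->; [left | right | right; rewrite oppE].
  have nfix x : theta x <> x -> theta x = x + 1 /\ x * x = x + 1.
    move=> tx; have t1 : x + theta x = 1.
      case: (bin _ (fixT x)) => // /eqP; rewrite addr_eq0 oppE => /eqP xx.
      by case: tx; exact/esym.
    have n1 : x * theta x = 1.
      case: (bin _ (fixN x)) => // /eqP; rewrite mulf_eq0 => /orP[]/eqP x0.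
        by case: tx; rewrite x0 rmorph0.
      by case: tx; rewrite x0; apply: (can_inj theta_inv); rewrite rmorph0 x0.
    have tE : theta x = x + 1 by rewrite -t1 addrA addxx add0r.
    split=> //; move: n1; rewrite tE mulrDr mulr1 => <-.
    by rewrite addrCA addxx addr0.
  have [w tw] := theta_neq1; have [tE wE] := nfix w tw.
  exists w; split=> // x; have [tx|/eqP tx] := eqVneq (theta x) x.
    by case: (bin _ tx) => ->; [constructor 1 | constructor 2].
  have [txE _] := nfix x tx.
  have /bin : theta (x + w) = x + w.
    by rewrite rmorphD txE tE addrACA addxx addr0.
  case=> [/eqP|/(canRL (addrK _)) ->].
    by rewrite addr_eq0 oppE => /eqP ->; constructor 3.
  by constructor 4; rewrite oppE addrC.
right; have c3 : 1 + 1 + 1 = 0 :> K.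
  case: (small _ t2) => [/eqP|/eqP|->]; first by rewrite (negPf c2).
    by rewrite -subr_eq0 addrK oner_eq0.
  by rewrite addNr.
have [e e0 es] := exists_skew_elt theta_inv theta_neq1.
have te : theta e = - e by apply/eqP; rewrite -addr_eq0 addrC es.
have ee : e * e = -1.
  have /small : theta (e * e) = e * e by rewrite rmorphM te mulrNN.
  case=> //; first by move/eqP; rewrite mulf_eq0 (negPf e0).
  move/eqP; rewrite -subr_eq0 (_ : _ - 1 = (e - 1) * (e + 1)); last by ring.
  have nk u : theta u = u -> e = u -> False.
    move=> tu eu; move: te; rewrite eu tu => /eqP; rewrite -addr_eq0 -eu.
    have -> : e + e = (1 + 1) * e by ring.
    by rewrite mulf_eq0 (negPf c2) (negPf e0).
  rewrite mulf_eq0 subr_eq0 addr_eq0 => /orP[]/eqP.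
    by move/(nk _ (rmorph1 _)).
  by move/nk; case; rewrite rmorphN rmorph1.
exists e; split=> // x.
have tern2 u : ternary u -> ternary (- u).
  by case=> ->; [rewrite oppr0; constructor 1 | constructor 3 | rewrite opprK; constructor 2].
have T1 := tern2 _ (small _ (fixT x)).
have /small T2 : theta ((x - theta x) * e) = (x - theta x) * e.
  by rewrite rmorphM rmorphB theta_inv te; ring.
(* These are the halves of the fixed and skew parts of [x], as -1 is the inverse of 2 and of
   [e * e]. *)
exists (- (x + theta x)), ((x - theta x) * e); split=> //.
rewrite -mulrA ee; apply/eqP; rewrite -subr_eq0.
have -> : x - (- (x + theta x) + (x - theta x) * -1) = x * (1 + 1 + 1) by ring.
by rewrite c3 mulr0.
Qed.

(** All nonzero norms are 1, so [eta = 1], and every element is a square. With [s * s = g1 g2], the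
    double eigenvalue [s] avoids every [c] other than [s]; for [c = s], distinct eigenvalues with
    product [s * s] avoid it. *)
Lemma scalar_block_F4 w : is_F4 w -> scalar_block.
Proof.
move=> [c2 ww tw enum] g1 g2 t eta g10 g20 eta0 teta.
have addxx x : x + x = 0 :> K by rewrite -[x]mul1r -mulrDl c2 mul0r.
have oppE x : - x = x :> K by apply/eqP; rewrite eq_sym -addr_eq0 addxx.
have wv : w * (w + 1) = 1 by rewrite mulrDr mulr1 ww addrAC addxx add0r.
have tw1 : theta (w + 1) = w by rewrite rmorphD rmorph1 tw -addrA addxx addr0.
have norm (x : K) : x != 0 -> x * theta x = 1.
  move=> x0; case: (enum x) => xE; move: x0; rewrite xE ?eqxx // => _.
  - by rewrite rmorph1 mulr1.
  - by rewrite tw.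
  - by rewrite tw1 mulrC.
have sq x : x * x = theta x.
  have [->|x0] := eqVneq x 0; first by rewrite mulr0 rmorph0.
  case: (enum x) => -> //; rewrite ?mulr0 ?mulr1 ?rmorph0 ?rmorph1 ?tw ?tw1 //.
  by rewrite mulrDr mulr1 mulrC wv addrCA addxx addr0.
have eta1 : eta = 1.
  case: (enum eta) => etaE; first by rewrite etaE eqxx in eta0.
  - by [].
  - move/eqP: teta; rewrite etaE tw -subr_eq0 addrAC subrr add0r => /eqP w10.
    by move/eqP: (oner_neq0 K); rewrite w10.
  move/eqP: teta; rewrite etaE tw1 eq_sym -subr_eq0 addrAC subrr add0r => /eqP w10.
  by move/eqP: (oner_neq0 K); rewrite w10.
have t1 : theta 1 = 1 := rmorph1 theta; have t0 : theta 0 = 0 := rmorph0 theta.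
have dist : exists p q, [/\ p != q, p * q = g1 * g2 & block_data g1 g2 t eta p q].
  have [g|g] := eqVneq g1 g2; last first.
    exists g1, g2; split=> //; exists 1, 1, 0.
    by rewrite t0 !mulr0 subr0 addr0 !mulr1 eta1 mulr1.
  exists (g1 * w), (g1 * (w + 1)); split.
  - rewrite (inj_eq (mulfI g10)) -subr_eq0 opprD addrA subrr add0r oppr_eq0.
    exact: oner_neq0.
  - by rewrite mulrACA wv mulr1 g.
  have sumE : g1 * w + g1 * (w + 1) = g1.
    by rewrite -mulrDr addrA addxx add0r mulr1.
  have prodE : g1 * w * (g1 * (w + 1)) = g1 * g2 * eta by rewrite mulrACA wv eta1 g.
  have [tE|t_neq] := eqVneq t 0.
    exists 1, 0, 1; split=> //; last by rewrite sumE tE mul0r mulr0 mulr1 !addr0.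
    by rewrite mulr0 t1 mulr1 sub0r oppE eta1.
  exists 0, 0, (g1 / t); split=> //; last by rewrite sumE !mulr0 add0r addr0 mulrC divfK.
  by rewrite mulr0 norm ?sub0r ?oppE ?eta1 // mulf_neq0 ?invr_eq0.
split; first by case: dist => p [q [pq _ bd]]; exists p, q.
move=> c; pose s := theta (g1 * g2).
have ss : s * s = g1 * g2 by rewrite sq theta_inv.
have s0 : s != 0 by rewrite fmorph_eq0 mulf_neq0.
have [cs|cs] := eqVneq s c.
  have [p [q [pq pqs bd]]] := dist; exists p, q; rewrite -cs; split=> //.
    apply: contra pq => /eqP ps; rewrite ps; apply/eqP.
    by apply: (mulfI s0); rewrite ss -pqs ps.
  apply: contra pq => /eqP qs; rewrite qs; apply/eqP.
  by apply: (mulIf s0); rewrite ss -pqs qs.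
exists s, s; split=> //.
have [g|g] := eqVneq g1 g2.
  exists 1, 1, 0; split=> //; rewrite ?t0 ?mulr0 ?subr0 ?mulr1 ?eta1 //.
    by rewrite addr0 addxx g addxx.
  by rewrite ss mulr1.
have [tE|t_neq] := eqVneq t 0.
  exists 0, 0, 1; split=> //; rewrite ?tE ?t1 ?mulr0 ?mul0r ?mulr1 ?sub0r ?oppE ?eta1 ?ss ?mulr1 //.
  by rewrite addxx !addr0.
exists 0, 1, (g2 / t); split=> //.
- by rewrite mul0r norm ?sub0r ?oppE ?eta1 // mulf_neq0 ?invr_eq0.
- by rewrite addxx mulr0 add0r mulr1 mulrC divfK // addxx.
by rewrite ss eta1 mulr1.
Qed.

(** Diagonal matrices only allow [a = 1] and [a = -1]. When they fail, [g2] is [g1 eta] or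
    [- (g1 eta)], and an off-diagonal entry [b] of suitable norm realizes an explicit pair of
    eigenvalues; both 1 and -1 are norms. *)
Lemma scalar_block_F9 e : is_F9 e -> scalar_block.
Proof.
move=> [c3 ee te enum] g1 g2 t eta g10 g20 eta0 teta.
have e0 : e != 0 by apply: contra_eq_neq ee => ->; rewrite mul0r eq_sym oppr_eq0 oner_neq0.
(* Equality modulo 3 and [e^2 + 1]: the cofactors [A] and [B] are given by hand so that [ring] can
   check the identity. *)
have mod9 X Y A B : X - Y = (1 + 1 + 1) * A + (e * e + 1) * B -> X = Y :> K.
  by move=> XY; apply/eqP; rewrite -subr_eq0 XY c3 ee addNr !mul0r addr0.
have t1 : theta 1 = 1 := rmorph1 theta; have t0 : theta 0 = 0 := rmorph0 theta.
have tN1 : theta (-1) = -1 by rewrite rmorphN t1.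
have tern_fix u : ternary u -> theta u = u by case=> ->.
have neg1 : -1 != 1 :> K.
  apply/eqP => N1; move/eqP: c3; rewrite -{1}N1 addNr add0r.
  by rewrite (negPf (oner_neq0 K)).
have fix2 x : theta x = x -> x != 0 -> x = 1 \/ x = -1.
  have [u [v [tu tv xE]]] := enum x.
  rewrite xE rmorphD rmorphM te !tern_fix // => xfix.
  have -> : v = 0.
    have ve : v * e = 0.
      have d0 : v * e + v * e = 0.
        have -> : v * e + v * e = (u + v * e) - (u + v * - e) by ring.
        by rewrite xfix subrr.
      have -> : v * e = (1 + 1 + 1) * (v * e) - (v * e + v * e) by ring.
      by rewrite c3 mul0r d0 subrr.
    by move/eqP: ve; rewrite mulf_eq0 (negPf e0) orbF => /eqP.
  by rewrite mul0r addr0; case: tu => ->; [rewrite eqxx | left | right].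
have fixN x : theta (x * theta x) = x * theta x by rewrite rmorphM theta_inv mulrC.
have norm (x : K) : x != 0 -> x * theta x = 1 \/ x * theta x = -1.
  by move=> x0; apply: fix2 => //; rewrite mulf_neq0 ?fmorph_eq0.
have exnorm k : k = 1 \/ k = -1 -> exists b, b * theta b = k.
  case=> ->; first by exists 1; rewrite t1 mulr1.
  by exists (1 + e); rewrite rmorphD t1 te; apply: (mod9 _ _ 1 (-1)); ring.
have eta2 := fix2 _ teta eta0.
have etaN : - eta = 1 \/ - eta = -1.
  by case: eta2 => ->; [right | left; rewrite opprK].
have etaeta : eta * eta = 1 by case: eta2 => ->; rewrite ?mulr1 ?mulrNN ?mulr1.
have te1 x : e * x * theta (e * x) = x * theta x.
  by rewrite rmorphM te; apply: (mod9 _ _ 0 (- (x * theta x))); ring.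
have diag a : theta a = a -> a * a = 1 -> block_data g1 g2 t eta (g1 * a) (g2 * (eta * a)).
  move=> ta aa; exists a, (eta * a), 0; split=> //.
  - by rewrite rmorphM teta ta.
  - by rewrite mul0r subr0 mulrCA aa mulr1.
  - by rewrite mulr0 addr0.
  by rewrite mulrACA [a * _]mulrCA aa mulr1.
have dbl (x : K) : x != 0 -> x != - x.
  move=> x0; apply: contra x0 => /eqP xx.
  have d0 : x + x = 0 by rewrite {1}xx addNr.
  have xE : x = (1 + 1 + 1) * x - (x + x) by ring.
  by rewrite xE c3 d0 mul0r subrr.
split.
  have [g|g] := eqVneq g1 (g2 * eta); last first.
    exists (g1 * 1), (g2 * (eta * 1)); split; last exact: (diag 1 t1 (mulr1 1)).
    by rewrite !mulr1.
  have g2E : g2 = g1 * eta by rewrite g -mulrA etaeta mulr1.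
  have [tE|t_neq] := eqVneq t 0.
    have [b bE] := exnorm _ eta2.
    exists (e * g1), (- (e * g1)); split; first by rewrite dbl ?mulf_neq0.
    exists 1, (- eta), b; split=> //.
    - by rewrite rmorphN teta.
    - by rewrite bE; apply: (mod9 _ _ (- eta) 0); ring.
    - rewrite tE g2E subrr mul0r addr0 mulr1 mulrN -mulrA etaeta mulr1 subrr //.
    by rewrite g2E -!mulrA etaeta mulr1; apply: (mod9 _ _ 0 (- (g1 * g1))); ring.
  have x0 : g1 / t != 0 by rewrite mulf_neq0 ?invr_eq0.
  have tb : t * (e * (g1 / t)) = e * g1 by field.
  exists (- ((e + 1) * g1)), ((1 - e) * g1); split.
    rewrite -subr_eq0 (_ : _ - _ = g1); first by [].
    by apply: (mod9 _ _ (- g1) 0); ring.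
  have pqE : - ((e + 1) * g1) * ((1 - e) * g1) = g1 * g2 * eta.
    rewrite g2E -!mulrA etaeta mulr1; apply: (mod9 _ _ (- (g1 * g1)) (g1 * g1)); ring.
  have [xN|xN] : (g1 / t) * theta (g1 / t) = - eta \/ (g1 / t) * theta (g1 / t) = eta.
    case: (norm _ x0) => ->; case: eta2 => ->; rewrite ?opprK; by [left | right].
    exists 0, 0, (e * (g1 / t)); split=> //.
    - by rewrite te1 xN mul0r sub0r opprK.
    rewrite tb !mulr0 add0r addr0; apply: (mod9 _ _ (- (e * g1)) 0); ring.
  exists 1, (- eta), (e * (g1 / t)); split=> //.
  - by rewrite rmorphN teta.
  - by rewrite te1 xN; apply: (mod9 _ _ (- eta) 0); ring.
  rewrite tb g2E [_ * - eta]mulrN -[g1 * eta * eta]mulrA etaeta.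
  by apply: (mod9 _ _ (- (e * g1)) 0); ring.
move=> c.
have [/andP[c1 c2]|nc1] := boolP ((g1 * 1 != c) && (g2 * (eta * 1) != c)).
  by exists (g1 * 1), (g2 * (eta * 1)); split=> //; exact: (diag 1 t1 (mulr1 1)).
have [/andP[c1 c2]|nc2] := boolP ((g1 * -1 != c) && (g2 * (eta * -1) != c)).
  by exists (g1 * -1), (g2 * (eta * -1)); split=> //; apply: (diag (-1) tN1); rewrite mulrNN mulr1.
have [g2E cE] : g2 = - (g1 * eta) /\ (c = g1 \/ c = - g1).
  move: nc1 nc2; rewrite !negb_and !negbK !mulr1 !mulrN1 => /orP[]/eqP <- /orP[]/eqP cE.
  - by move/eqP: (dbl _ g10); rewrite cE.
  - split; last by left.
    by rewrite -cE mulrN mulNr opprK -mulrA etaeta mulr1.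
  - split; last by right.
    by rewrite -mulNr cE -mulrA etaeta mulr1.
  have /dbl/eqP : g2 * eta != 0 by rewrite mulf_neq0.
  by case; rewrite -{1}cE mulrN.
have pqE : - ((e + 1) * g1) * ((e - 1) * g1) = g1 * g2 * eta.
  have -> : g1 * g2 * eta = - (g1 * g1).
    by rewrite g2E mulrN mulNr -!mulrA etaeta mulr1.
  by apply: (mod9 _ _ (g1 * g1) (- (g1 * g1))); ring.
exists (- ((e + 1) * g1)), ((e - 1) * g1).
have ge x : x * g1 == 0 -> x = 0 by rewrite mulf_eq0 (negPf g10) orbF => /eqP.
have ne1 : e + 1 != 0.
  apply: contra_eq_neq ee => e1; have -> : e = -1 by apply/eqP; rewrite -addr_eq0 e1.
  by rewrite mulrNN mulr1 eq_sym.
have ne2 : e - 1 != 0.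
  by apply: contra_eq_neq ee => /subr0_eq ->; rewrite mulr1 eq_sym.
split.
- case: cE => ->; apply/eqP => H.
    move/eqP: ne2; apply; apply: ge; apply/eqP; apply: (mod9 _ _ (- g1) 0).
    have -> : (e - 1) * g1 - 0 = (e + 1) * g1 + g1 - (1 + 1 + 1) * g1 by ring.
    by rewrite -[in X in _ + X - _]H; ring.
  move/eqP: e0; apply; apply: ge; apply/eqP.
  have -> : e * g1 = - (- ((e + 1) * g1)) - g1 by ring.
  by rewrite H; ring.
- case: cE => ->; apply/eqP => H.
    move/eqP: ne1; apply; apply: ge; apply/eqP; apply: (mod9 _ _ g1 0).
    have -> : (e + 1) * g1 - 0 = (e - 1) * g1 - g1 + (1 + 1 + 1) * g1 by ring.
    by rewrite H; ring.
  move/eqP: e0; apply; apply: ge; apply/eqP.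
  have -> : e * g1 = ((e - 1) * g1) + g1 by ring.
  by rewrite H; ring.
have sumE : - ((e + 1) * g1) + (e - 1) * g1 = g1.
  by apply: (mod9 _ _ (- g1) 0); ring.
have [tE|t_neq] := eqVneq t 0.
  have [b bE] := exnorm _ etaN.
  exists 1, 0, b; split=> //; first by rewrite mulr0 bE sub0r opprK.
  by rewrite sumE tE mul0r mulr0 mulr1 !addr0.
have x0 : g1 / t != 0 by rewrite mulf_neq0 ?invr_eq0.
have [xN|xN] : (g1 / t) * theta (g1 / t) = - eta \/ (g1 / t) * theta (g1 / t) = eta.
  case: (norm _ x0) => ->; case: eta2 => ->; rewrite ?opprK; by [left | right].
  exists 0, 0, (g1 / t); split=> //; first by rewrite mul0r xN sub0r opprK.
  by rewrite sumE !mulr0 add0r addr0 mulrC divfK.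
exists 1, (- eta), (- (g1 / t)); split=> //.
- by rewrite rmorphN teta.
- by rewrite rmorphN mulrNN xN; apply: (mod9 _ _ (- eta) 0); ring.
rewrite sumE g2E mulrNN -[g1 * eta * eta]mulrA etaeta.
have -> : t * - (g1 / t) = - g1 by field.
by rewrite !mulr1 subrr add0r.
Qed.

End TwoBlock.

(** * The choice of the companion matrix *)

Section Choice.
Variables (K : fieldType) (theta : {rmorphism K -> K}).
Hypothesis theta_inv : involutive theta.
Hypothesis theta_neq1 : exists a : K, theta a <> a.

(* The third condition says that [A] and its inverse have no common eigenvalue,
   the fourth one is needed when the block to factorize is [l] plus a nilpotent
   matrix of rank one, and the last one allows one to correct the determinant of
   a conjugating matrix. *)
Definition admissible n (a : 'rV[K]_n.+1) : Prop := let A := comp_mx a in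
  [/\ A \in unitmx, map_mx theta A = A,
      horner_mx (invmx A) (char_poly A) \in unitmx,
      forall l, l * theta l = 1 -> ~ similar A (l *: invmx A) &
      forall k, k != 0 -> exists S,
        [/\ S \in unitmx, S *m A = A *m S & theta (\det S / k) = \det S / k]].

Lemma comp_mx_of_poly n (p : {poly K}) : p \is monic -> size p = n.+2 ->
  exists2 a : 'rV[K]_n.+1, char_poly (comp_mx a) = p &
    map_poly theta p = p -> map_mx theta (comp_mx a) = comp_mx a.
Proof.
move=> pmon sp; pose a : 'rV[K]_n.+1 := poly_rV ('X^(n.+1) - p).
exists a.
  rewrite char_poly_comp_mx poly_rV_K; first by rewrite subKr.
  apply/leq_sizeP => i; rewrite leq_eqVlt => /orP[/eqP <-|lt_ni].
    rewrite coefB coefXn eqxx; have := pmon; rewrite monicE lead_coefE sp => /eqP ->.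
    by rewrite subrr.
  by rewrite coefB coefXn gtn_eqF // sub0r nth_default ?oppr0 ?sp.
move=> tp; apply/matrixP => i j; rewrite !mxE; case: ifP => _; last by rewrite rmorph_nat.
rewrite coefB coefXn rmorphB rmorph_nat; congr (_ - _).
by rewrite -[in RHS]tp coef_map.
Qed.

Lemma similar_inv_root n (A : 'M[K]_n.+1) l x : A \in unitmx ->
    similar A (l *: invmx A) -> root (char_poly A) x -> x != 0 ->
  root (char_poly A) (l / x).
Proof.
move=> Au Al rx x0; have : root (char_poly (l *: invmx A)) x by rewrite -(similar_char_poly Al).
rewrite -!eigenvalue_root_char => /eigenvalueP[v vA v0].
have lv : l *: v = x *: (v *m A).
  by rewrite scalemxAl -vA -scalemxAr -scalemxAl mulmxKV.
apply/eigenvalueP; exists v => //.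
by rewrite mulrC -scalerA lv scalerA mulVf // scale1r.
Qed.

(** A factor [A^-1 - b] is singular only if [b^-1] is an eigenvalue of [A], giving two elements of
    [s] with product 1. *)
Lemma horner_inv_unit n (A : 'M[K]_n.+1) s : A \in unitmx ->
    char_poly A = \prod_(b <- s) ('X - b%:P) ->
    (forall b c, b \in s -> c \in s -> b * c != 1) ->
  horner_mx (invmx A) (char_poly A) \in unitmx.
Proof.
move=> Au cA s1; rewrite cA rmorph_prod.
have s_unit b : b \in s -> horner_mx (invmx A) ('X - b%:P) \in unitmx.
  move=> bs; rewrite rmorphB /= horner_mx_X horner_mx_C unitmxE unitfE.
  apply/negP => /eqP/eqP/det0P[v v0]; rewrite mulmxBr mul_mx_scalar => /eqP.
  rewrite subr_eq0 => /eqP vA.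
  have b0 : b != 0.
    apply: contra v0 => /eqP b0; rewrite -[v](mulmxK Au) -[v *m A]mulmx1.
    by rewrite -[v](mulmxKV Au) vA b0 scale0r !mul0mx.
  have : root (char_poly A) b^-1.
    rewrite -eigenvalue_root_char; apply/eigenvalueP; exists v => //.
    by rewrite -[v in RHS](mulmxKV Au) vA -scalemxAl scalerA mulVf // scale1r.
  rewrite cA root_prod_XsubC => /(s1 _ _ bs).
  by rewrite divff ?eqxx.
elim: s {cA s1} s_unit => [|b s IHs] s_unit; first by rewrite big_nil unitmx1.
rewrite big_cons -mulmxE unitmx_mul s_unit ?mem_head //; apply: IHs => c cs.
by apply: s_unit; rewrite inE cs orbT.
Qed.

(** The simple eigenvalue splits off as a block of size 1, and scaling that block by [k] commutes
    with [A]. *)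
Lemma centralizer_simple_root n (A : 'M[K]_n.+1) c s :
    char_poly A = \prod_(b <- c :: s) ('X - b%:P) -> c \notin s ->
  forall k, k != 0 -> exists S, [/\ S \in unitmx, S *m A = A *m S & \det S = k].
Proof.
move=> cA cs k k0.
have /eigenrow[v [T AT]] : root (char_poly A) c.
  by rewrite cA big_cons rootM root_XsubC eqxx.
have cT : char_poly T = \prod_(b <- s) ('X - b%:P).
  have := similar_char_poly AT; rewrite [LHS]cA char_poly_lblock char_poly1 big_cons.
  by move/mulfI=> -> //; rewrite polyXsubC_eq0.
have {AT} [G Gu GA] := similar_trans AT (similar_lblock v (unitmx_sub_scalar cT cs)).
pose D : 'M[K]_(1 + n) := block_mx k%:M 0 0 1%:M.
have dD : \det D = k by rewrite det_ublock det_scalar1 det1 mulr1.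
have Du : D \in unitmx by rewrite unitmxE dD unitfE.
exists (invmx G *m D *m G); split.
- by rewrite !unitmx_mul unitmx_inv Gu Du.
- apply: (can_inj (mulKmx Gu)); rewrite !mulmxA GA mulmxV // mul1mx.
  rewrite -!mulmxA GA [G *m (invmx G *m _)]mulmxA mulmxV // mul1mx !mulmxA.
  congr (_ *m _); rewrite /D !mulmx_block !(mulmx0, mul0mx, addr0, add0r, mulmx1, mul1mx).
  by rewrite scalar_mxC.
rewrite !det_mulmx det_inv dD mulrAC mulVf ?mul1r //.
by rewrite -unitfE -unitmxE.
Qed.

(** Suppose every moved element has norm 1 or -1. Comparing [w] with [x w] gives [x * x = -1], so
    the characteristic is not 2; comparing the norms of [1 + e] and [x + e] for a skew [e] then
    gives [4 e^2 = 0]. *)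
Lemma exists_norm_not_sign (x : K) : theta x = x -> x != 0 -> x != 1 -> x != -1 ->
  exists2 z, theta z != z & (z * theta z) ^+ 2 != 1.
Proof.
move=> tx x0 x1 xN1; apply: contrapT => no.
have N z : theta z != z -> (z * theta z) ^+ 2 = 1.
  by move=> tz; apply/eqP; apply: contrapT => /negP Nz; apply: no; exists z.
have [w /eqP tw] := theta_neq1.
have xx1 : x * x != 1.
  by rewrite -subr_eq0 (_ : _ - _ = (x - 1) * (x + 1)) ?mulf_neq0 ?subr_eq0 ?addr_eq0 //; ring.
have Nw := N _ tw.
have txw : theta (x * w) != x * w by rewrite rmorphM tx (inj_eq (mulfI x0)).
have xxN : x * x = -1.
  have := N _ txw; rewrite rmorphM tx.
  have -> : (x * w * (x * theta w)) ^+ 2 = (x * x) ^+ 2 * (w * theta w) ^+ 2 by ring.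
  rewrite Nw mulr1 => /eqP; rewrite -subr_eq0.
  have -> : (x * x) ^+ 2 - 1 = (x * x - 1) * (x * x + 1) by ring.
  by rewrite mulf_eq0 subr_eq0 (negPf xx1) addr_eq0 => /eqP.
have c2 : 1 + 1 != 0 :> K.
  apply: contra xx1; rewrite xxN addr_eq0 => /eqP N1; by rewrite {2}N1.
have [e e0 es] := exists_skew_elt theta_inv theta_neq1.
have te : theta e = - e by apply/eqP; rewrite -addr_eq0 addrC es.
have Ne y : theta y = y -> (- (e * e) + y * y) ^+ 2 = 1.
  move=> ty; rewrite -(N (y + e)).
    by rewrite rmorphD ty te; ring.
  rewrite rmorphD ty te (inj_eq (addrI y)) eq_sym -subr_eq0 opprK.
  by rewrite -[e in X in X != 0]mul1r -mulrDl mulf_neq0.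
have := Ne 0 (rmorph0 _); have := Ne 1 (rmorph1 _); have := Ne x tx.
rewrite xxN mul0r mulr1 addr0 => hx h1 h0.
have : (1 + 1) * (1 + 1) * (e * e) = 0.
  have -> : (1 + 1) * (1 + 1) * (e * e) = (- (e * e) - 1) ^+ 2 - (- (e * e) + 1) ^+ 2 by ring.
  by rewrite hx h1 subrr.
by move/eqP; rewrite !mulf_eq0 (negPf c2) (negPf e0).
Qed.

(** The eigenvalues are [z], [theta z] and copies of [x]: the polynomial is fixed by [theta], and
    [z] is a simple root, so determinants on the centralizer are arbitrary. *)
Lemma admissible_large n (x : K) : theta x = x -> x != 0 -> x != 1 -> x != -1 ->
  exists a : 'rV_n.+2, admissible a.
Proof.
move=> tx x0 x1 xN1; have [z tz Nz] := exists_norm_not_sign tx x0 x1 xN1.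
pose s := [:: z, theta z & nseq n x].
pose p := \prod_(b <- s) ('X - b%:P).
have pmon : p \is monic by exact: monic_prod_XsubC.
have sp : size p = n.+3 by rewrite size_prod_XsubC /= size_nseq.
have xx1 : x * x != 1.
  by rewrite -subr_eq0 (_ : _ - _ = (x - 1) * (x + 1)) ?mulf_neq0 ?subr_eq0 ?addr_eq0 //; ring.
have [a cA fixA] := comp_mx_of_poly pmon sp.
exists a; rewrite /admissible; set A := comp_mx a in cA fixA *.
have tp : map_poly theta p = p.
  rewrite /p rmorph_prod !big_cons /= !big_nseq !rmorphB /= !map_polyX !map_polyC /= theta_inv tx.
  by rewrite mulrCA.
have z0 : z != 0 by apply: contra tz => /eqP ->; rewrite rmorph0.
have tz0 : theta z != 0 by rewrite fmorph_eq0.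
have sE b : b \in s -> [\/ b = z, b = theta z | b = x].
  rewrite !inE mem_nseq => /or3P[/eqP ->|/eqP ->|/andP[_ /eqP ->]];
    [by constructor 1 | by constructor 2 | by constructor 3].
have Au : A \in unitmx.
  rewrite unitmxE (char_poly_prod_det cA) unitfE prodf_seq_neq0.
  by apply/allP => b /sE[] ->.
have fixI y : theta y = y -> z * y != 1 /\ theta z * y != 1.
  move=> ty; have zy : z * y != 1.
    apply: contra tz => /eqP zy; have y0 : y != 0.
      by apply: contra_eq_neq zy => ->; rewrite mulr0 eq_sym oner_neq0.
    by apply/eqP/(mulIf y0); rewrite -{1}ty -rmorphM zy rmorph1.
  split=> //; apply: contra zy => /eqP/(congr1 theta).
  by rewrite rmorphM theta_inv ty rmorph1 => ->.
have zNz : z * theta z != 1 by apply: contra Nz => /eqP ->; rewrite expr1n.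
have zz y : theta y != y -> y * y != 1.
  move=> ty; apply: contra ty; rewrite -subr_eq0.
  have -> : y * y - 1 = (y - 1) * (y + 1) by ring.
  rewrite mulf_eq0 subr_eq0 addr_eq0 => /orP[]/eqP ->; rewrite ?rmorph1 //.
  by rewrite rmorphN rmorph1.
have ttz : theta (theta z) != theta z by rewrite theta_inv eq_sym.
split; rewrite ?fixA //.
- have [zx tzx] := fixI _ tx; have zz1 := zz _ tz; have tz1 := zz _ ttz.
  apply: (horner_inv_unit Au cA) => b c /sE[] -> /sE[] -> //; by rewrite mulrC.
(* The spectrum would be stable under [b] to [l / b]. As [l] has norm 1 but the norm of [z] does not
   square to 1, both [z] and [theta z] would go to [x], whence [z = theta z]. *)
- move=> l ll Al; have root_s b : b \in s -> root (char_poly A) b.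
    by rewrite cA root_prod_XsubC.
  have inv_s b : b \in s -> b != 0 -> l / b \in s.
    by move=> bs b0; rewrite -root_prod_XsubC -[\prod_(_ <- _) _]cA similar_inv_root ?root_s.
  have Nl : theta l * l = 1 by rewrite mulrC.
  have NE y : y = z \/ y = theta z -> y * theta y = z * theta z.
    by case=> -> //; rewrite theta_inv mulrC.
  have key y : y = z \/ y = theta z -> l = x * y.
    move=> yz; have y0 : y != 0 by case: yz => ->.
    have /inv_s/(_ y0) : y \in s by case: yz => ->; rewrite !inE eqxx ?orbT.
    move=> /sE ly; have lE b : l / y = b -> l = b * y by move=> <-; rewrite divfK.
    have bad b : b = z \/ b = theta z -> l / y = b -> False.
      move=> bz /lE lb; move/eqP: Nz; apply.
      rewrite expr2 -{1}(NE _ bz) -(NE _ yz) -[RHS]ll lb rmorphM; ring.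
    case: ly => [/(bad _ (or_introl erefl))|/(bad _ (or_intror erefl))|/lE] //.
  have := key _ (or_introl erefl); rewrite (key _ (or_intror erefl)).
  by move/(mulfI x0)/eqP; rewrite (negPf tz).
move=> k k0; have [|S [Su SA dS]] := @centralizer_simple_root _ A z [:: theta z & nseq n x] cA _ k k0.
  rewrite inE mem_nseq negb_or eq_sym tz /= negb_and; apply/orP; right.
  by apply: contra tz => /eqP ->; rewrite tx.
by exists S; split=> //; rewrite dS divff // rmorph1.
Qed.

End Choice.

(** * Companion matrices of trinomials *)

Section Trinomial.
Variables (K : fieldType) (theta : {rmorphism K -> K}).
Implicit Types (c d l : K).

Definition trinomial N j c d : {poly K} := 'X^N + (c *: 'X^j + d%:P).

Lemma size_trinomial_tail N j c d : (0 < j < N)%N -> (size (c *: 'X^j + d%:P)%R <= N)%N.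
Proof.
case/andP=> j0 jN; apply: leq_trans (size_polyD _ _) _; rewrite geq_max.
rewrite (leq_trans (size_scale_leq _ _)) ?size_polyXn //=.
by rewrite (leq_trans (size_polyC_leq1 _)) // (leq_trans j0) // ltnW.
Qed.

Lemma size_trinomial N j c d : (0 < j < N)%N -> size (trinomial N j c d) = N.+1.
Proof.
by move=> jN; rewrite size_polyDl size_polyXn // ltnS size_trinomial_tail.
Qed.

Lemma trinomial_monic N j c d : (0 < j < N)%N -> trinomial N j c d \is monic.
Proof.
move=> jN; rewrite monicE lead_coefDl ?lead_coefXn //.
by rewrite size_polyXn ltnS size_trinomial_tail.
Qed.

Lemma map_trinomial N j c d : theta c = c -> theta d = d ->
  map_poly theta (trinomial N j c d) = trinomial N j c d.
Proof.
move=> tc td; rewrite /trinomial !rmorphD /= map_polyXn map_polyC /= td.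
by rewrite -mul_polyC rmorphM /= map_polyC map_polyXn /= tc.
Qed.

Lemma horner_trinomial N j c d x : (trinomial N j c d).[x] = x ^+ N + (c * x ^+ j + d).
Proof. by rewrite !hornerE. Qed.

Lemma det_scalar_sub n (A : 'M[K]_n) x : \det (x%:M - A) = (char_poly A).[x].
Proof.
rewrite -[RHS]/(horner_eval x _) /char_poly -det_map_mx; congr (\det _).
apply/matrixP => i j; rewrite !mxE /= /horner_eval.
by rewrite hornerD hornerN hornerC hornerMn hornerX.
Qed.

(** Row 0 of a polynomial in the companion matrix of degree at most [n] thus lists its
    coefficients. *)
Lemma row_expr_comp_mx n (a : 'rV[K]_n.+1) k : (k < n.+1)%N ->
  row 0 (comp_mx a ^+ k) = delta_mx 0 (inord k).
Proof.
elim: k => [_|k IHk ltk].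
  rewrite expr0; apply/rowP => j; rewrite !mxE eqxx /= eq_sym.
  by congr (_ == _)%:R; apply/val_inj; rewrite /= inordK.
have ltk' : (k < n.+1)%N by exact: ltnW.
rewrite exprSr -mulmxE row_mul IHk // -rowE.
have ltk2 : ((inord k : 'I_n.+1).+1 < n.+1)%N by rewrite inordK.
by rewrite (row_comp_mx _ ltk2); congr (delta_mx _ _); apply/val_inj; rewrite /= !inordK.
Qed.

Lemma expr_comp_mx0E n (a : 'rV[K]_n.+1) k (i : 'I_n.+1) : (k < n.+1)%N ->
  (comp_mx a ^+ k) 0 i = (i == k :> nat)%:R.
Proof.
move=> ltk; have /rowP/(_ i) := row_expr_comp_mx a ltk; rewrite !mxE eqxx /= => ->.
by rewrite -val_eqE /= inordK.
Qed.

Section TrinomialMatrix.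
Variables (n j : nat) (c d : K) (a : 'rV[K]_n.+1).
Let A := comp_mx a.
Hypotheses (cA : char_poly A = trinomial n.+1 j c d) (jn : (0 < j < n.+1)%N).

Lemma horner_mx_trinomial (B : 'M[K]_n.+1) :
  horner_mx B (trinomial n.+1 j c d) = B ^+ n.+1 + (c *: B ^+ j + d%:M).
Proof.
rewrite /trinomial !rmorphD /= horner_mx_C rmorphXn /= horner_mx_X.
by rewrite -mul_polyC rmorphM /= horner_mx_C rmorphXn /= horner_mx_X -mulmxE mul_scalar_mx.
Qed.

Lemma trinomial_expr : A ^+ n.+1 = - (c *: A ^+ j + d%:M).
Proof.
have := Cayley_Hamilton A; rewrite cA horner_mx_trinomial => /eqP.
by rewrite addr_eq0 => /eqP.
Qed.

Lemma trinomial_unit : d != 0 -> A \in unitmx.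
Proof.
move=> d0; have := det_scalar_sub A 0; rewrite cA horner_trinomial expr0n.
rewrite -[(0 ^+ j)%R]/(0 ^+ j)%R expr0n; case: (j) jn => // k _ /=.
rewrite mulr0 !add0r raddf0 sub0r -scaleN1r detZ => dE.
rewrite unitmxE unitfE; apply: contra d0 => /eqP dA.
by rewrite -dE dA mulr0.
Qed.

(** With [N = n.+1] and [B = l A^-1], Cayley-Hamilton for [B] times [A^N] gives a relation of degree
    below [N] after reduction of [A^N]; its coefficient at [A^(N-j)] is [c l^j], not 0. *)
Lemma trinomial_not_similar l : d != 0 -> c != 0 -> l != 0 -> (j + j != n.+1)%N ->
  ~ similar A (l *: invmx A).
Proof.
move=> d0 c0 l0 jj Al; have Au := trinomial_unit d0; set B := l *: invmx A in Al.
have AB : A * B = l%:M by rewrite -mulmxE -scalemxAr mulmxV // scalemx1.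
have BA : B * A = l%:M by rewrite -mulmxE -scalemxAl mulVmx // scalemx1.
have ABX k : A ^+ k * B ^+ k = (l ^+ k)%:M.
  by rewrite -exprMn_comm ?AB ?rmorphXn // /GRing.comm AB BA.
have := Cayley_Hamilton B; rewrite -(similar_char_poly Al) cA horner_mx_trinomial.
move/(congr1 (fun X => A ^+ n.+1 * X)); rewrite mulr0 !mulrDr ABX.
have /andP[j0 jn1] := jn.
have -> : A ^+ n.+1 * (c *: B ^+ j) = (c * l ^+ j) *: A ^+ (n.+1 - j).
  have -> : A ^+ n.+1 = A ^+ (n.+1 - j) * A ^+ j by rewrite -exprD subnK // ltnW.
  rewrite -scalerAr -mulrA ABX -mulmxE mul_mx_scalar.
  by rewrite scalerA.
rewrite -mulmxE mul_mx_scalar trinomial_expr.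
have ltm : (n.+1 - j < n.+1)%N by lia.
pose i : 'I_n.+1 := Ordinal ltm.
have i0 : (0 == i) = false by apply/eqP => /(congr1 val) /=; lia.
move/matrixP/(_ 0 i); rewrite !mxE !expr_comp_mx0E // i0 /= eqxx.
have -> : (n.+1 - j == j)%N = false by apply/eqP; lia.
rewrite !(mulr0n, mulr0, add0r, oppr0, addr0) mulr1 => /eqP.
by rewrite mulf_eq0 (negPf c0) expf_eq0 (negPf l0) andbF.
Qed.

(** With [N = n.+1] and [d * d = 1], multiplying the evaluation at [A^-1] by [A^N] leaves
    [c (A^(N-2j) - d) A^j]. A kernel vector is thus an eigenvector of [A^(N-2j)]. *)
Lemma trinomial_horner_inv : c != 0 -> d * d = 1 -> (j + j < n.+1)%N ->
    (forall v : 'rV_n.+1, v *m A ^+ (n.+1 - (j + j)) = d *: v ->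
      v *m A ^+ n.+1 = - (c *: (v *m A ^+ j) + d *: v) -> v = 0) ->
  horner_mx (invmx A) (char_poly A) \in unitmx.
Proof.
move=> c0 dd jj inj; have d0 : d != 0.
  by apply: contra_eq_neq dd => ->; rewrite mulr0 eq_sym oner_neq0.
have Au := trinomial_unit d0; rewrite cA horner_mx_trinomial.
set X := _ + _; have AX : X * A ^+ n.+1 = c *: (A ^+ (n.+1 - (j + j)) - d%:M) * A ^+ j.
  have invX k : invmx A ^+ k * A ^+ k = 1.
    by rewrite -exprMn_comm ?mulmxE -?mulmxE ?mulVmx ?expr1n // /GRing.comm -!mulmxE mulVmx ?mulmxV.
  have /andP[j0 jn1] := jn.
  rewrite /X !mulrDl invX -scalerAl.
  have -> : invmx A ^+ j * A ^+ n.+1 = A ^+ (n.+1 - j).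
    have -> : A ^+ n.+1 = A ^+ j * A ^+ (n.+1 - j) by rewrite -exprD subnKC // ltnW.
    by rewrite mulrA invX mul1r.
  have dX : d%:M * A ^+ n.+1 = - (1%:M + (c * d) *: A ^+ j).
    rewrite trinomial_expr mulrN -mulmxE mul_scalar_mx scalerDr scalerA mulrC.
    by rewrite scale_scalar_mx dd addrC.
  rewrite dX -scalerAl mulrBl -exprD (_ : n.+1 - (j + j) + j = n.+1 - j)%N; last by lia.
  rewrite -mulmxE mul_scalar_mx scalerBr scalerA opprD addrCA.
  by rewrite [1 + _]addrA subrr add0r.
rewrite unitmxE unitfE; apply/negP => /eqP/eqP/det0P[v v0 vX].
move/eqP: v0; apply; apply: inj; last first.
  rewrite trinomial_expr mulmxN mulmxDr mul_mx_scalar; congr (- (_ + _)).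
  by rewrite -scalemxAr.
have : v *m (X * A ^+ n.+1) = 0 by rewrite -mulmxE mulmxA vX mul0mx.
rewrite AX -mulmxE -scalemxAl -scalemxAr mulmxA => /eqP.
rewrite scaler_eq0 (negPf c0) /= => /eqP vA.
have AjU : A ^+ j \in unitmx by rewrite -[_ \in _]/(_ \is a GRing.unit) unitrX.
apply/eqP; rewrite -subr_eq0 -mul_mx_scalar -mulmxBr.
by rewrite -[_ *m _](mulmxK AjU) vA mul0mx.
Qed.

End TrinomialMatrix.


Hypothesis theta_inv : involutive theta.

Definition det_onto n (A : 'M[K]_n) : Prop := forall k, k != 0 -> exists S,
  [/\ S \in unitmx, S *m A = A *m S & theta (\det S / k) = \det S / k].

(** The multiplicative group is cyclic of order 3 and generated by [\det S], so 1, [S] and [S^2]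
    suffice. *)
Lemma det_onto_F4 n (A : 'M[K]_n) w S : is_F4 theta w ->
  S *m A = A *m S -> \det S = w \/ \det S = w + 1 -> det_onto A.
Proof.
move=> [c2 ww tw enum] SA dS k k0.
have addxx x : x + x = 0 :> K by rewrite -[x]mul1r -mulrDl c2 mul0r.
have w0 : w != 0 by apply: contra_eq_neq ww => ->; rewrite mul0r add0r eq_sym oner_neq0.
have w10 : w + 1 != 0.
  by apply: contra_eq_neq ww => ->; rewrite mulf_neq0.
have Su : S \in unitmx by rewrite unitmxE unitfE; case: dS => ->.
have SSA : S *m S *m A = A *m (S *m S) by rewrite -mulmxA SA !mulmxA SA.
have vv : (w + 1) * (w + 1) = w.
  have -> : (w + 1) * (w + 1) = w + (w * w - (w + 1)) + (1 + 1) * (w + 1) by ring.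
  by rewrite ww c2 mul0r subrr !addr0.
have t1 : theta (k / k) = k / k by rewrite divff // rmorph1.
have [k1|[kw|kw]] : k = 1 \/ k = w \/ k = w + 1.
  by case: (enum k) k0 => ->; rewrite ?eqxx //; auto.
- by exists 1%:M; rewrite unitmx1 mul1mx mulmx1 det1; split=> //; rewrite k1 in t1 *.
- case: dS => dS; first by exists S; rewrite dS -kw.
  by exists (S *m S); rewrite unitmx_mul Su det_mulmx dS vv -kw.
- case: dS => dS; last by exists S; rewrite dS -kw.
  by exists (S *m S); rewrite unitmx_mul Su det_mulmx dS ww -kw.
Qed.

(** Elements of norm -1 generate the cyclic group of order 8, so the determinants of 1, [S], [S^2],
    [S^3] represent all four classes modulo the fixed field. *)
Lemma det_onto_F9 n (A : 'M[K]_n) e S : is_F9 theta e ->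
  S *m A = A *m S -> \det S * theta (\det S) = -1 -> det_onto A.
Proof.
move=> [c3 ee te enum] SA NS k k0; set z := \det S in NS.
have N11 : -1 != 1 :> K.
  apply/eqP => N1; move/eqP: c3; rewrite -{1}N1 addNr add0r.
  by rewrite (negPf (oner_neq0 K)).
have z0 : z != 0 by apply: contra_eq_neq NS => ->; rewrite mul0r eq_sym oppr_eq0 oner_neq0.
have Su : S \in unitmx by rewrite unitmxE unitfE.
have SSA : S *m S *m A = A *m (S *m S) by rewrite -mulmxA SA !mulmxA SA.
have SSSA : S *m (S *m S) *m A = A *m (S *m (S *m S)) by rewrite -mulmxA SSA !mulmxA SA.
have tern_fix (u : K) : ternary u -> theta u = u.
  by case=> ->; rewrite ?rmorph0 ?rmorph1 // rmorphN rmorph1.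
have normE u v : ternary u -> ternary v -> (u + v * e) * theta (u + v * e) = u * u + v * v.
  move=> tu tv; rewrite rmorphD rmorphM te !tern_fix //.
  have -> : (u + v * e) * (u + v * - e) = u * u - (v * v) * (e * e) by ring.
  by rewrite ee mulrN1 opprK.
have sqE (u : K) : ternary u -> u = 0 \/ u * u = 1.
  by case=> ->; [left | right; rewrite mulr1 | right; rewrite mulrNN mulr1].
have cases (x : K) : x != 0 -> (theta x = x \/ theta x = - x) \/ x * theta x = -1.
  have [u [v [tu tv ->]]] := enum x; rewrite normE //.
  case: (sqE u tu) => [->|uu] ; first by rewrite add0r rmorphM te tern_fix // mulrN; auto.
  case: (sqE v tv) => [->|vv]; first by rewrite mul0r addr0 tern_fix //; auto.
  rewrite uu vv; right; apply/eqP; rewrite -subr_eq0 opprK.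
  by rewrite c3.
have tzz : theta (z * z) = - (z * z).
  have [u [v [tu tv zE]]] := enum z; move: NS; rewrite zE normE // rmorphM rmorphD rmorphM te !tern_fix //.
  case: (sqE u tu) => [->|uu]; case: (sqE v tv) => [->|vv]; rewrite ?mul0r ?mulr0 ?add0r ?addr0.
  - by move/eqP; rewrite eq_sym oppr_eq0 oner_eq0.
  - by rewrite vv => /esym/eqP; rewrite (negPf N11).
  - by rewrite uu => /esym/eqP; rewrite (negPf N11).
  move=> _; apply/eqP; rewrite -subr_eq0 opprK.
  have -> : (u + v * - e) * (u + v * - e) + (u + v * e) * (u + v * e) =
    (1 + 1) * (u * u + (v * v) * (e * e)) by ring.
  by rewrite uu vv ee mul1r subrr mulr0.
case: (cases k k0) => [[tk|tk]|Nk].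
- by exists 1%:M; rewrite unitmx1 mul1mx mulmx1 det1; split=> //; rewrite fmorph_div rmorph1 tk.
- exists (S *m S); rewrite unitmx_mul Su det_mulmx; split=> //.
  by rewrite fmorph_div tzz tk invrN mulrNN.
have tz : theta z = - z^-1 by apply: (mulfI z0); rewrite NS mulrN mulfV.
have tk : theta k = - k^-1 by apply: (mulfI k0); rewrite Nk mulrN mulfV.
have zk0 : z / k != 0 by rewrite mulf_neq0 ?invr_eq0.
case: (cases _ zk0) => [[tx|tx]|Nx].
- by exists S.
- exists (S *m (S *m S)); rewrite !unitmx_mul Su !det_mulmx; split=> //.
  by rewrite -/z mulrAC rmorphM tzz tx mulrNN.
move: Nx; rewrite fmorph_div tz tk invrN invrK mulrNN mulrACA divff // mulVf // mulr1.
by move/esym/eqP; rewrite (negPf N11).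
Qed.

(* When the fixed field has 2 or 3 elements there are too few eigenvalues for a
   split polynomial, hence the recourse to trinomials. *)
Lemma trinomial_admissible n j c d (a : 'rV[K]_n.+1) :
    char_poly (comp_mx a) = trinomial n.+1 j c d -> map_mx theta (comp_mx a) = comp_mx a ->
    (0 < j)%N -> (j + j < n.+1)%N -> c != 0 -> d * d = 1 ->
    (forall v : 'rV_n.+1, v *m comp_mx a ^+ (n.+1 - (j + j)) = d *: v ->
      v *m comp_mx a ^+ n.+1 = - (c *: (v *m comp_mx a ^+ j) + d *: v) -> v = 0) ->
    det_onto (comp_mx a) -> admissible theta a.
Proof.
move=> cA fixA j0 jj c0 dd inj onto.
have jn : (0 < j < n.+1)%N by lia.
have d0 : d != 0.
  by apply: contra_eq_neq dd => ->; rewrite mulr0 eq_sym oner_neq0.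
split=> //.
- exact: trinomial_unit cA jn d0.
- exact: trinomial_horner_inv cA jn c0 dd jj inj.
move=> l ll; have l0 : l != 0 by apply: contra_eq_neq ll => ->; rewrite mul0r eq_sym oner_neq0.
have jjn : (j + j != n.+1)%N by lia.
exact: (trinomial_not_similar cA jn d0 c0 l0 jjn).
Qed.

End Trinomial.

(** * Admissible trinomials over the fields with 4 and 9 elements *)

Section SmallField.
Variables (K : fieldType) (theta : {rmorphism K -> K}).
Hypothesis theta_inv : involutive theta.

Lemma expr_period n (A : 'M[K]_n.+1) (v : 'rV_n.+1) m q r : v *m A ^+ m = v ->
  v *m A ^+ (m * q + r) = v *m A ^+ r.
Proof.
move=> vA; elim: q => [|q IHq]; first by rewrite muln0.
by rewrite mulnS -addnA exprD -mulmxE mulmxA vA.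
Qed.

(** For [c = d] the two relations on [v] combine so that [A^j] acts as a root of [X^2 + X + 1],
    hence with period 3. *)
Lemma trinomial_period n (A : 'M[K]_n.+1) (v : 'rV_n.+1) (d : K) j :
    d * d = 1 -> (j + j < n.+1)%N -> v *m A ^+ (n.+1 - (j + j)) = d *: v ->
    v *m A ^+ n.+1 = - (d *: (v *m A ^+ j) + d *: v) ->
  v *m A ^+ (j + j) = - (v *m A ^+ j + v) /\ v *m A ^+ (3 * j) = v.
Proof.
move=> dd jj vA1 vA2; have vA3 : v *m A ^+ (j + j) = - (v *m A ^+ j + v).
  have -> : v *m A ^+ (j + j) = d *: (v *m A ^+ n.+1).
    have -> : A ^+ n.+1 = A ^+ (n.+1 - (j + j)) * A ^+ (j + j) by rewrite -exprD subnK // ltnW.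
    by rewrite -mulmxE mulmxA vA1 -scalemxAl scalerA dd scale1r.
  by rewrite vA2 -scalerDr scalerN scalerA dd scale1r.
split=> //; rewrite (_ : 3 * j = j + j + j)%N; last by lia.
rewrite exprD -mulmxE mulmxA vA3 mulNmx mulmxDl -mulmxA mulmxE -exprD vA3.
by rewrite opprD opprK addrAC addrN add0r.
Qed.

(** By the period 3, only [n.+1 - 2] modulo 3 matters: remainder 0 gives [v = d v], the others
    [v A = d v] and then [(1 + d + 1) v = 0]. *)
Lemma trinomial_inj1 n (A : 'M[K]_n.+1) (v : 'rV_n.+1) (d : K) :
    (2 < n.+1)%N -> d * d = 1 -> 1 + 1 + d != 0 -> ((n.+1 %% 3)%N = 2%N -> d <> 1) ->
    v *m A ^+ (n.+1 - 2) = d *: v -> v *m A ^+ n.+1 = - (d *: (v *m A ^+ 1) + d *: v) ->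
  v = 0.
Proof.
move=> n2 dd d2 dn vA1 vA2; have [vA3 vA4] := @trinomial_period _ _ _ _ 1 dd n2 vA1 vA2.
have vAr : v *m A ^+ ((n.+1 - 2) %% 3) = d *: v.
  by rewrite -vA1 [in RHS](divn_eq (n.+1 - 2) 3) mulnC expr_period.
have fin : v *m A = d *: v -> v = 0.
  move=> vA; move: vA3; rewrite expr1 vA expr2 -mulmxE mulmxA vA -scalemxAl vA scalerA dd scale1r.
  move/eqP; rewrite -subr_eq0 opprK addrC -addrA -{2 3}[v]scale1r -!scalerDl addrC scaler_eq0.
  by rewrite (negPf d2) => /eqP.
have r3 : ((n.+1 - 2) %% 3 < 3)%N by rewrite ltn_mod.
case rE : ((n.+1 - 2) %% 3)%N r3 vAr => [|[|[|r]]] // _.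
- rewrite expr0 mulmx1 => vd; have /dn d1 : (n.+1 %% 3 = 2)%N by lia.
  apply/eqP; have /eqP : (1 - d) *: v = 0 by rewrite scalerBl scale1r -vd subrr.
  by rewrite scaler_eq0 subr_eq0 eq_sym (negPf (introN eqP d1)).
move=> vAA; apply: fin; rewrite -[in RHS]vA4 muln1 exprSr -mulmxE mulmxA vAA -scalemxAl.
by rewrite scalerA dd scale1r.
Qed.

(** Here [A^6] fixes [v], and twice [n.+1 - 4] is 2 modulo 6; so [A^2] fixes [v], and the period
    relation reads [3 v = 0]. *)
Lemma trinomial_inj2 n (A : 'M[K]_n.+1) (v : 'rV_n.+1) :
    (4 < n.+1)%N -> (n.+1 %% 3 = 2)%N -> 1 + 1 + 1 != 0 :> K ->
    v *m A ^+ (n.+1 - 4) = 1 *: v -> v *m A ^+ n.+1 = - (1 *: (v *m A ^+ 2) + 1 *: v) ->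
  v = 0.
Proof.
move=> n4 n3 c3 vA1 vA2; have [vA3 vA4] := @trinomial_period _ _ _ _ 2 (mulr1 1) n4 vA1 vA2.
rewrite scale1r in vA1.
have vAA : v *m A ^+ 2 = v.
  have := expr_period 2 0 vA1; rewrite addn0 mulmx1.
  have -> : ((n.+1 - 4) * 2 = 6 * ((n.+1 - 4) %/ 3) + 2)%N by lia.
  by rewrite expr_period.
move: vA3; rewrite exprD -mulmxE mulmxA !vAA => /eqP.
rewrite -subr_eq0 opprK addrA -{1 2 3}[v]scale1r -!scalerDl scaler_eq0.
by rewrite (negPf c3) => /eqP.
Qed.

Lemma admissible_F4 n w : is_F4 theta w -> (3 < n.+1)%N ->
  exists a : 'rV_n.+1, admissible theta a.
Proof.
move=> F4w n3; have [c2 ww tw enum] := F4w.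
have c3 : 1 + 1 + 1 != 0 :> K by rewrite c2 add0r oner_neq0.
(* For [N = n.+1] congruent to 2 modulo 3, [X^N + X + 1] is divisible by [X^2 + X + 1], whose roots
   have product 1; the middle term [X^2] avoids this. *)
pose j := if (n.+1 %% 3 == 2)%N then 2%N else 1%N.
have j0 : (0 < j)%N by rewrite /j; case: ifP.
have jj : (j + j < n.+1)%N by rewrite /j; case: ifP => /eqP; lia.
have jn : (0 < j < n.+1)%N by lia.
have [a cA fixA] := comp_mx_of_poly theta (trinomial_monic 1 1 jn) (size_trinomial 1 1 jn).
exists a; apply: (trinomial_admissible cA) => //.
- by apply/fixA/map_trinomial; rewrite rmorph1.
- exact: oner_neq0.
- exact: mulr1.
- move=> v; rewrite /j; case: ifP => /eqP n2; first by apply: trinomial_inj2 => //; lia.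
  by apply: trinomial_inj1 => //; [lia | rewrite mulr1].
have w3 : w ^+ 3 = 1.
  have -> : w ^+ 3 = w * (w * w - (w + 1)) + (w * w - (w + 1)) + (1 + 1) * w + 1 by ring.
  by rewrite ww c2 subrr mulr0 mul0r !add0r.
have wX q r : w ^+ (q * 3 + r) = w ^+ r by rewrite exprD mulnC exprM w3 expr1n mul1r.
have r3 : (n.+1 %% 3 < 3)%N by rewrite ltn_mod.
(* The scalar [w] has determinant [w^(n.+1)], which is 1 if 3 divides the size; then [w - A] has
   determinant [w] instead. *)
have [N0|N0] := eqVneq (n.+1 %% 3)%N 0%N.
  apply: (det_onto_F4 (S := w%:M - comp_mx a) F4w).
    by rewrite mulmxBl mulmxBr scalar_mxC.
  left; rewrite det_scalar_sub cA horner_trinomial /j N0 /= (divn_eq n.+1 3) N0 wX.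
  by rewrite expr0 expr1 mul1r [w + 1]addrC addrA c2 add0r.
apply: (det_onto_F4 (S := w%:M) F4w); first by rewrite scalar_mxC.
rewrite det_scalar (divn_eq n.+1 3) wX.
by case: (n.+1 %% 3)%N r3 N0 => [|[|[|]]] // _ _; [left; rewrite expr1 | right; rewrite expr2].
Qed.

Lemma admissible_F9 n e : is_F9 theta e -> (2 < n.+1)%N ->
  exists a : 'rV_n.+1, admissible theta a.
Proof.
move=> F9e n2; have [c3 ee te enum] := F9e.
have N11 : -1 != 1 :> K.
  apply/eqP => N1; move/eqP: c3; rewrite -{1}N1 addNr add0r.
  by rewrite (negPf (oner_neq0 K)).
have tN1 : theta (-1) = -1 by rewrite rmorphN rmorph1.
(* The constant term -1 is chosen since [1 + 1 + d] would vanish for [d = 1]. *)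
have jn : (0 < 1 < n.+1)%N by lia.
have [a cA fixA] := comp_mx_of_poly theta (trinomial_monic (-1) (-1) jn) (size_trinomial (-1) (-1) jn).
exists a; apply: (trinomial_admissible cA) => //.
- exact/fixA/map_trinomial.
- by rewrite oppr_eq0 oner_neq0.
- by rewrite mulrNN mulr1.
- move=> v; apply: trinomial_inj1 => //; first by rewrite mulrNN mulr1.
    by rewrite addrK oner_neq0.
  by move=> _; apply/eqP.
have mod9 X Y A B : X - Y = (1 + 1 + 1) * A + (e * e + 1) * B -> X = Y :> K.
  by move=> XY; apply/eqP; rewrite -subr_eq0 XY c3 ee addNr !mul0r addr0.
pose z := 1 + e.
have z2 : z ^+ 2 = - e by apply: (mod9 _ _ e 1); rewrite /z; ring.
have z4 : z ^+ 4 = -1 by rewrite (exprM z 2 2) z2 sqrrN expr2.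
have z8 : z ^+ 8 = 1 by rewrite (exprM z 4 2) z4 sqrrN expr1n.
have nz : z * theta z = -1.
  by rewrite /z rmorphD te rmorph1; apply: (mod9 _ _ 1 (-1)); ring.
have zX q r : z ^+ (q * 8 + r) = z ^+ r by rewrite exprD mulnC exprM z8 expr1n mul1r.
have onto x y : (trinomial n.+1 1 (-1) (-1)).[x] = y -> y * theta y = -1 -> det_onto theta (comp_mx a).
  move=> xy Ny; apply: (det_onto_F9 (S := x%:M - comp_mx a) F9e).
    by rewrite mulmxBl mulmxBr scalar_mxC.
  by rewrite det_scalar_sub cA xy.
have [oddN|evenN] := boolP (odd n.+1).
  apply: (det_onto_F9 (S := z%:M) F9e); first by rewrite scalar_mxC.
  by rewrite det_scalar rmorphXn -exprMn nz -signr_odd oddN expr1.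
(* In even dimension scalars have determinant of norm 1. The matrices [x - A] replace them, with [x]
   picked by the size modulo 8 so that the trinomial takes a value of norm -1 at [x]. *)
have r8 : (n.+1 %% 8 < 8)%N by rewrite ltn_mod.
have rN : odd (n.+1 %% 8) = false by lia.
have NE := divn_eq n.+1 8; set q := (n.+1 %/ 8)%N in NE.
have norm (x : K) : x = 1 \/ x = -1 -> forall y, y = 1 \/ y = -1 -> (x + y * e) * theta (x + y * e) = -1.
  have tE (x' : K) : x' = 1 \/ x' = -1 -> theta x' = x' /\ x' * x' = 1.
    by case=> ->; rewrite ?rmorph1 ?tN1 ?mulrNN mulr1.
  move=> /tE[tx xx] y /tE[ty yy]; rewrite rmorphD rmorphM te tx ty.
  have -> : (x + y * e) * (x + y * - e) = x * x - (y * y) * (e * e) by ring.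
  by rewrite xx yy ee; apply: (mod9 _ _ 1 0); ring.
case rE: (n.+1 %% 8)%N r8 rN NE => [|[|[|[|[|[|[|[|r]]]]]]]] // _ _ NE.
- apply: (onto z (-1 + -1 * e)); last by apply: norm; auto.
  by rewrite horner_trinomial NE zX /z; ring.
- apply: (onto z (1 + 1 * e)); last by apply: norm; auto.
  by rewrite horner_trinomial NE zX z2; apply: (mod9 _ _ (-1 - e) 0); rewrite /z; ring.
- apply: (onto (- z) (-1 + 1 * e)); last by apply: norm; auto.
  rewrite horner_trinomial exprNn -signr_odd (negPf evenN) expr0 mul1r NE zX z4.
  by rewrite /z; ring.
apply: (onto e (1 + -1 * e)); last by apply: norm; auto.
have -> : n.+1 = (2 * (2 * (2 * q + 1) + 1))%N by lia.
rewrite horner_trinomial exprM expr2 ee -signr_odd.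
have -> : odd (2 * (2 * q + 1) + 1) by lia.
by apply: (mod9 _ _ (-1) 0); ring.
Qed.

End SmallField.

(** * Products of two conjugates *)

Section Square.
Variables (K : fieldType) (theta : {rmorphism K -> K}).
Hypothesis theta_inv : involutive theta.
Hypothesis theta_neq1 : exists a : K, theta a <> a.

Lemma invmx_mul m (M N : 'M[K]_m) : M \in unitmx -> N \in unitmx ->
  invmx (M *m N) = invmx N *m invmx M.
Proof.
move=> Mu Nu; have MNu : M *m N \in unitmx by rewrite unitmx_mul Mu.
by apply: (can_inj (mulmxK MNu)); rewrite mulVmx // mulmxA mulmxKV // mulVmx.
Qed.

(** Together with Cayley-Hamilton this makes the Sylvester equations have only the zero solution. *)
Lemma horner_mx_intertwine n (A B M : 'M[K]_n.+1) p :
  M *m A = B *m M -> M *m horner_mx A p = horner_mx B p *m M.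
Proof.
move=> MA; elim/poly_ind: p => [|p c IHp]; first by rewrite !rmorph0 mulmx0 mul0mx.
rewrite !rmorphD !rmorphM /= !horner_mx_X !horner_mx_C -!mulmxE mulmxDr mulmxDl.
by rewrite mulmxA IHp -!mulmxA MA scalar_mxC.
Qed.

Lemma horner_mx_trmx n (A : 'M[K]_n.+1) p : horner_mx A^T p = (horner_mx A p)^T.
Proof.
elim/poly_ind: p => [|p c IHp]; first by rewrite !rmorph0 trmx0.
rewrite !rmorphD !rmorphM /= !horner_mx_X !horner_mx_C -!mulmxE raddfD /= tr_scalar_mx.
rewrite trmx_mul -IHp; congr (_ + _); rewrite -[LHS]/(horner_mx A^T p *m A^T).
by apply/esym/horner_mx_intertwine.
Qed.

(** The bordered matrix with blocks [l], [v], [-w], 1 is eliminated in two ways. *)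
Lemma det_scalar_add_rank1 n l (v : 'cV[K]_n) (w : 'rV_n) : l != 0 -> w *m v = 0 ->
  \det (l%:M + v *m w) = l ^+ n.
Proof.
move=> l0 wv; have E1 : block_mx l%:M v (- w) (1%:M : 'M_1) =
    block_mx 1%:M v 0 1%:M *m block_mx (l%:M + v *m w) 0 (- w) 1%:M.
  rewrite mulmx_block !(mul1mx, mul0mx, mulmx0, mulmx1, add0r, addr0).
  by rewrite mulmxN addrK.
have E2 : block_mx l%:M v (- w) (1%:M : 'M_1) =
    block_mx 1%:M 0 (- (l^-1 *: w)) 1%:M *m block_mx l%:M v 0 1%:M.
  rewrite mulmx_block !(mul1mx, mul0mx, mulmx0, mulmx1, add0r, addr0) !mulNmx.
  by rewrite -!scalemxAl wv mul_mx_scalar scalerA mulVf // scale1r scaler0 oppr0 add0r.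
have := congr1 determinant (etrans (esym E1) E2).
by rewrite !det_mulmx !det_ublock !det_lblock !det1 !mul1r !mulr1 det_scalar.
Qed.

Lemma simple_seq_perm (s : seq K) : simple_seq s ->
  exists c r, perm_eq s (c :: r) /\ c \notin r.
Proof.
case=> c cs; have c_s : c \in s by rewrite -has_pred1 has_count cs.
exists c, (rem c s); split; first exact: perm_to_rem.
by apply/count_memPn; rewrite count_rem c_s /= eqxx cs.
Qed.

Variables (n : nat) (a : 'rV[K]_n.+1).
Hypothesis adm : admissible theta a.
Let A := comp_mx a.
Let t := levi theta A.

Let Au : A \in unitmx. Proof. by case: adm. Qed.

Let adj_invE : adj theta (invmx A) = (invmx A)^T.
Proof. by rewrite /adj map_invmx; case: adm => _ -> _ _ _. Qed.

Let det_fixed : theta (\det A) = \det A.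
Proof. by rewrite -det_map_mx; case: adm => _ -> _ _ _. Qed.

Lemma det_levi_admissible : \det t = 1.
Proof. by rewrite det_levi det_fixed divff // -unitfE -unitmxE. Qed.

(** By Hilbert 90, [\det g = v / theta v]. If [S] commutes with [A] and [\det S] times [v] is fixed,
    then [levi S] centralizes [t] and cancels this determinant. *)
Lemma conj_levi_det1 g : unitary theta g -> exists g', [/\ unitary theta g', \det g' = 1
  & invmx g' *m t *m g' = invmx g *m t *m g].
Proof.
move=> ug; have [v v0 vE] := hilbert90 theta_inv theta_neq1 (det_unitary ug).
have [_ _ _ _ /(_ v^-1)] := adm; rewrite invr_eq0 => /(_ v0)[S [Su SA]].
rewrite invrK => Sfix; have uS := unitary_levi theta_inv Su.
have tS : t *m levi theta S = levi theta S *m t.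
  by rewrite /t -!leviM // SA.
exists (levi theta S *m g); split; first exact: unitaryM.
  rewrite det_mulmx det_levi; have tv0 : theta v != 0 by rewrite fmorph_eq0.
  have -> : \det g = v / theta v by rewrite vE -{2}vE mulfK.
  rewrite mulf_div -rmorphM Sfix divff // mulf_neq0 // -unitfE -unitmxE //.
have Lu := unitary_unit uS; have gu := unitary_unit ug.
by rewrite invmx_mul // !mulmxA -[_ *m t *m levi _ S]mulmxA tS mulmxA mulmxKV.
Qed.

(** [A] is fixed by [theta] and similar to its transpose, so [A^-1] is similar to its inverse
    adjoint partner [adj (A^-1)], and [hypJ] swaps the two diagonal blocks. *)
Lemma levi_inv_conj : exists2 b, unitary theta b & invmx t = invmx b *m t *m b.
Proof.
have [S Su SA] := comp_mx_similar_tr a; rewrite -/A in SA.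
have SAi : S *m invmx A = (invmx A)^T *m S.
  apply: (can_inj (mulmxK Au)); rewrite mulmxKV // -mulmxA SA mulmxA -trmx_mul mulmxV //.
  by rewrite trmx1 mul1mx.
have uS := unitary_levi theta_inv Su; have uJ := unitary_hypJ theta n.+1.
exists (hypJ K n.+1 *m levi theta S); first exact: unitaryM.
have JS := unitary_unit (unitaryM uJ uS); have tu := unitary_unit (unitary_levi theta_inv Au).
have Aiu : invmx A \in unitmx by rewrite unitmx_inv.
have tV : invmx t = levi theta (invmx A).
  apply: (can_inj (mulmxK tu)); rewrite mulVmx // -leviM // mulVmx //.
  by rewrite /levi invmx1 adj1 -scalar_mx_block.
apply: (can_inj (mulKmx JS)); rewrite -mulmxA mulKVmx // tV -mulmxA -leviM // SAi leviM ?unitmx_tr //.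
by rewrite -adj_invE levi_swap // !mulmxA hypJ2 mul1mx.
Qed.

Hypothesis two_blockP : two_block theta.
Hypothesis n0 : (0 < n)%N.

Theorem unitary_conj_square g : unitary theta g -> \det g = 1 ->
  exists b c z, [/\ unitary theta b, \det b = 1, unitary theta c, \det c = 1 &
    g = z *: ((invmx b *m t *m b) *m (invmx c *m t *m c))].
Proof.
move=> ug dg.
have [/is_scalar_mxP[l gl]|gs] := boolP (is_scalar_mx g).
  have [b ub tb] := levi_inv_conj; have [b' [ub' db' bb']] := conj_levi_det1 ub.
  (* The product is [t t^-1 = 1]; the scalar [l] itself is absorbed in [z]. *)
  exists 1%:M, b', l; rewrite det1; split=> //; first exact: unitary1.
  rewrite bb' -tb invmx1 mul1mx mulmx1 mulmxV ?scalemx1 //.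
  exact: (unitary_unit (unitary_levi theta_inv Au)).
have n1 : (1 < n.+1)%N by [].
pose d := \det A ^+ 2.
have d0 : d != 0 by rewrite expf_neq0 // -unitfE -unitmxE.
have td : theta d = d by rewrite rmorphXn /= det_fixed.
have [u uu [X [Y [XA YA XY]]]] : exists2 u, unitary theta u & exists X Y,
    [/\ similar X A, similar Y A & X *m Y = ulsubmx (u *m g *m invmx u)].
  have [_ _ _ nsim _] := adm; rewrite -/A in nsim.
  have [[s [[u uu cP] ss ps]]|[u [l [v [w [[uu PE wv v0 w0] [ll ln]]]]]]] :=
    spec_target theta_inv theta_neq1 two_blockP n1 ug dg gs d0 td; exists u => //.
    have [c [r [scr cr]]] := simple_seq_perm ss.
    apply: (mul_similar_comp_simple Au _ cr); last by rewrite (char_poly_prod_det cP).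
    by rewrite cP; exact: perm_big.
  have l0 : l != 0 by apply: contra_eq_neq ll => ->; rewrite mul0r eq_sym oner_neq0.
  apply: (mul_similar_comp_transvection Au PE v0 w0 wv); last exact: nsim.
  by rewrite PE det_scalar_add_rank1.
have u_unit := unitary_unit uu.
have ugu : unitary theta (u *m g *m invmx u).
  by apply: unitaryM (unitaryV uu); exact: unitaryM.
have [_ _ hU _ _] := adm; rewrite -/A in hU.
have hU' : horner_mx (adj theta (invmx A)) (char_poly A) \in unitmx.
  by rewrite adj_invE horner_mx_trmx unitmx_tr.
have A1 B : B *m A = adj theta (invmx A) *m B -> B = 0.
  move/(horner_mx_intertwine (char_poly A)); rewrite Cayley_Hamilton mulmx0 => E.
  by apply: (can_inj (mulKmx hU')); rewrite -E mulmx0.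
have A2 B : B *m adj theta (invmx A) = A *m B -> B = 0.
  move/(horner_mx_intertwine (char_poly A)); rewrite Cayley_Hamilton mul0mx => E.
  by apply: (can_inj (mulmxK hU')); rewrite E mul0mx.
move: (ugu); rewrite -[X in unitary _ X]submxK => ugu'.
have [b [c [ub uc gE]]] := unitary_mul_conj_levi theta_inv Au A1 A2 ugu' XA YA XY.
rewrite submxK in gE.
have [b' [ub' db' bE]] := conj_levi_det1 (unitaryM ub uu).
have [c' [uc' dc' cE]] := conj_levi_det1 (unitaryM uc uu).
exists b', c', 1; split=> //; rewrite scale1r bE cE.
rewrite !invmx_mul ?(unitary_unit ub) ?(unitary_unit uc) //.
apply: (can_inj (mulKmx u_unit)); apply: (can_inj (mulmxKV u_unit)).
by rewrite gE !mulmxA !(mulmxK u_unit) mulmxV // mul1mx.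
Qed.

End Square.

Lemma card_le_seq (T : eqType) (s : seq T) (k : nat) : (size s <= k)%N ->
  (forall x, x \in s) -> ([set: T]%classic #<= `I_k)%card.
Proof.
case: s => [|x0 s] sk sT.
  by rewrite (_ : [set: T]%classic = set0) ?card_ge0 //; apply/seteqP; split=> // x; have := sT x.
have -> : [set: T]%classic = (nth x0 (x0 :: s) @` `I_k)%classic.
  apply/seteqP; split=> // x _; exists (index x (x0 :: s)); last by rewrite nth_index.
  by apply: leq_trans sk; rewrite index_mem.
exact: card_image_le.
Qed.

Theorem SU_conj_square_mx (K : fieldType) (theta : {rmorphism K -> K}) n :
    involutive theta -> (exists a : K, theta a <> a) -> (1 < n)%N ->
    (([set: K]%classic #<= `I_9)%card -> (3 < n)%N) ->
  exists t : 'M[K]_(n + n), [/\ unitary theta t, \det t = 1 &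
    forall g, unitary theta g -> \det g = 1 ->
    exists b c z, [/\ unitary theta b, \det b = 1, unitary theta c, \det c = 1 &
      g = z *: ((invmx b *m t *m b) *m (invmx c *m t *m c))]].
Proof.
move=> theta_inv theta_neq1 n1 K9.
suff: two_block theta /\ exists a : 'rV[K]_n.-1.+1, admissible theta a.
  case: n n1 {K9} => [|n] // n1 [tb [a adm]]; exists (levi theta (comp_mx a)); split.
  - by apply: unitary_levi => //; case: adm.
  - exact: det_levi_admissible.
  - exact: (unitary_conj_square theta_inv theta_neq1 adm tb n1).
have sb := scalar_block_two_block theta_inv theta_neq1.
(* The fixed field consists of 0, 1, -1 exactly when it has 2 or 3 elements. *)
have [[x [tx nx]]|small] := pselect (exists x, theta x = x /\ ~ ternary x).
  have x0 : x != 0 by apply/eqP => E; apply: nx; constructor 1.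
  have x1 : x != 1 by apply/eqP => E; apply: nx; constructor 2.
  have xN1 : x != -1 by apply/eqP => E; apply: nx; constructor 3.
  split; first exact: sb (scalar_block_large tx x0 x1 xN1).
  by case: n n1 {K9} => [|[|n]] // _; exact: admissible_large tx x0 x1 xN1.
have [|[w F4w]|[e F9e]] := small_field theta_inv theta_neq1.
- by move=> x tx; apply: contrapT => nx; apply: small; exists x.
- split; first exact: sb (scalar_block_F4 theta_inv F4w).
  apply: (admissible_F4 F4w); rewrite prednK ?(ltnW n1) //; apply: K9.
  have [_ _ _ enum] := F4w; apply: (@card_le_seq _ [:: 0; 1; w; w + 1]) => // x.
  by rewrite !inE; case: (enum x) => ->; rewrite eqxx ?orbT.
split; first exact: sb (scalar_block_F9 theta_inv F9e).
apply: (admissible_F9 F9e); rewrite prednK ?(ltnW n1) //; apply: ltnW; apply: K9.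
have [_ _ _ enum] := F9e.
apply: (@card_le_seq _ [seq u + v * e | u <- [:: 0; 1; -1], v <- [:: 0; 1; -1]]) => // x.
have [u [v [tu tv ->]]] := enum x.
by apply/allpairsP; exists (u, v); split=> //=; [case: tu | case: tv] => ->; rewrite !inE eqxx ?orbT.
Qed.

(** * Transfer to linear maps *)

Section Coordinates.
Variables (K : fieldType) (theta : {rmorphism K -> K}) (V : vectType K).
Variable h : {hermitian_sym V for theta}.

Definition gram m (e : m.-tuple V) : 'M[K]_m := \matrix_(i, j) h (tnth e i) (tnth e j).

Lemma form_vecof (e : (\dim {:V}).-tuple V) (x y : 'rV_(\dim {:V})) :
  h (vecof e x) (vecof e y) = (x *m gram e *m adj theta y) 0 0.
Proof.
rewrite /vecof linear_sumlz mxE.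
under [RHS]eq_bigr => j _ do rewrite !mxE mulr_suml.
rewrite exchange_big; apply: eq_bigr => i _.
rewrite linearZl_LR linear_sumr mulr_sumr; apply: eq_bigr => j _.
by rewrite linearZr_LR /= !mxE !(tnth_nth 0) mulrA mulrAC.
Qed.

(** The dictionary is kept abstract so that the size may be [n + n] rather than [\dim V].
    Coordinates are rows, so [F] reverses products. *)
Lemma basis_matrix m (e : m.-tuple V) : basis_of {:V} e ->
  exists (F : 'End(V) -> 'M[K]_m) (G : 'M[K]_m -> 'End(V)),
  [/\ cancel F G, cancel G F,
      forall f g, F (f \o g)%VF = F g *m F f,
      forall c f, F (c *: f) = c *: F f &
      forall f : 'End(V), \det (F f) = lfun_det f /\
        (isometry h h f <-> F f *m gram e *m adj theta (F f) = gram e)].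
Proof.
move=> eb; have dimE := esym (size_basis eb); subst m.
exists (mxof e e), (hommx e e); split.
- exact: mxofK.
- exact: hommxK.
- by move=> f g; rewrite (mxof_comp _ _ eb).
- by move=> c f; rewrite linearZ.
move=> f; split; first by rewrite (lfun_detE _ eb).
set F := mxof e e f.
have hf x y : h (f (vecof e x)) (f (vecof e y)) =
    (x *m (F *m gram e *m adj theta F) *m adj theta y) 0 0.
  by rewrite !(hom_vecof _ eb) form_vecof adjM !mulmxA.
split=> [fh|FE u v]; last by rewrite -[u](rVofK eb) -[v](rVofK eb) hf FE form_vecof.
have entry (M : 'M[K]_(\dim {:V})) i j : ((delta_mx 0 i : 'rV_(\dim {:V})) *m M *m adj theta (delta_mx 0 j : 'rV_(\dim {:V}))) 0 0 = M i j.
  have -> : adj theta (delta_mx 0 j : 'rV_(\dim {:V})) = delta_mx j 0.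
    by apply/matrixP => k l; rewrite !mxE rmorph_nat andbC.
  by rewrite -rowE -colE !mxE.
by apply/matrixP => i j; rewrite -!entry -hf fh form_vecof !entry.
Qed.

End Coordinates.

Local Open Scope classical_set_scope.
Local Open Scope ring_scope.

Theorem theorem1p6 (K : fieldType) (theta : {rmorphism K -> K})
  (theta_inv : involutive theta) (theta_neq1 : exists a : K, theta a <> a)
  (V : vectType K) (h : {hermitian_sym V for theta})
  (h_hyp : hyperbolic_form h)
  (dimV4 : (4 <= \dim {:V})%N)
  (dimV8 : ([set: K] #<= `I_9)%card -> (8 <= \dim {:V})%N) :
  exists C : set (PSU h),
    is_conj_class C /\ prodset C C = [set: PSU h].
Proof.
have [n [e [eb gramE]]] := h_hyp.
have dimE : \dim {:V} = (n + n)%N by rewrite (size_basis eb).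
have n1 : (1 < n)%N by move: dimV4; rewrite dimE; case: (n) => [|[|]].
have K9 : ([set: K]%classic #<= `I_9)%card -> (3 < n)%N.
  by move/dimV8; rewrite dimE; case: (n) => [|[|[|[|]]]].
have [F [G [FK GK FM FZ Fdi]]] := basis_matrix h eb.
have Fdet f : \det (F f) = lfun_det f by exact: proj1 (Fdi f).
have Fiso (f : 'End(V)) : isometry h h f <-> unitary theta (F f).
  by have := proj2 (Fdi f); rewrite /gram gramE -/(hypJ K n).
have FI : F \1%VF = 1%:M.
  by have := FM \1%VF (G 1%:M); rewrite comp_lfun1l GK mul1mx.
have FS (x : SU h) : unitary theta (F (val x)) /\ \det (F (val x)) = 1.
  by have /SU_predP[xh xd] := valP x; rewrite Fdet; split=> //; exact/Fiso.
have FV (x : SU h) : F (val x^-1%g) = invmx (F (val x)).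
  have xu := unitary_unit (proj1 (FS x)); apply: (can_inj (mulmxK xu)).
  by rewrite mulVmx // -FM -val_SUM mulgV.
have lift M : unitary theta M -> \det M = 1 -> exists x : SU h, F (val x) = M.
  move=> uM dM; have MS : G M \in SU_pred h.
    by apply/SU_predP; rewrite -Fdet GK; split=> //; apply/Fiso; rewrite GK.
  by exists (Sub (G M) MS); rewrite SubK GK.
have FJ (x y : SU h) : F (val (x ^ y)%g) = F (val y) *m F (val x) *m invmx (F (val y)).
  by rewrite conjgE !val_SUM !FM FV.
have [T [uT dT conjT]] := SU_conj_square_mx theta_inv theta_neq1 n1 K9.
have [t tE] := lift T uT dT.
pose pi (x : SU h) : PSU h := (\pi_(PSU h) x)%qT.
have piM x y : (pi x * pi y)%g = pi (x * y)%g by exact: quotg_piM.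
have piV x : ((pi x)^-1)%g = pi (x^-1)%g by exact: quotg_piV.
have piJ x y : (pi x ^ pi y)%g = pi (x ^ y)%g.
  by rewrite !conjgE piV (piM x y) (piM y^-1%g).
exists (conj_class (pi t)); split; first by exists (pi t).
apply/seteqP; split=> // p _; elim/quotW: p => x.
have [b [c [z [ub db uc dc xE]]]] := conjT _ (proj1 (FS x)) (proj2 (FS x)).
have detV (M : 'M[K]_(n + n)) : \det M = 1 -> \det (invmx M) = 1 by rewrite det_inv => ->; rewrite invr1.
have [y yE] := lift _ (unitaryV ub) (detV _ db).
have [w wE] := lift _ (unitaryV uc) (detV _ dc).
(* Since [F] reverses products, the factor belonging to [c] comes first, and conjugators are lifted
   from inverses. *)
exists (pi t ^ pi w)%g; first by exists (pi w).
exists (pi t ^ pi y)%g; first by exists (pi y).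
rewrite !piJ piM; apply/quotg_eqP/SU_scalarP; exists z.
set s := (t ^ w * t ^ y)%g.
have sE : F (val s) = invmx b *m T *m b *m (invmx c *m T *m c).
  by rewrite val_SUM FM !FJ tE yE wE !invmxK.
have xsE : val x = z *: val s.
  by apply: (can_inj FK); rewrite FZ xE sE.
have sK : lker (val s) == 0%VS by exact: SU_lker (valP s).
by rewrite val_SUM val_SUV xsE -comp_lfunZr lker0_compVf.
Qed.
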